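(* (1) Let $f \in \mathcal{S}'(\mathbb{T}) \setminus \mathcal{S}(\mathbb{T})$. Then the function $\frac{1}{p} \mapsto s_f(p)$ (that is, $u \mapsto s_f(1/u)$, $u\in[0,\infty)$) is a non-decreasing, concave, and $1$-Lipschitz function from $[0,\infty)$ to $\mathbb{R}$. (2) Moreover, for any function $s : (0,\infty] \rightarrow \mathbb{R}$ such that $\frac{1}{p}\mapsto s(p)$ (that is, $u \mapsto s(1/u)$, $u \in [0,\infty)$) is non-decreasing, concave, and $1$-Lipschitz, there exists a periodic generalized function $f \in \mathcal{S}'(\mathbb{T}) \setminus \mathcal{S}(\mathbb{T})$ such that $s_f(p) = s(p)$ for every $p \in (0,\infty]$.
   Context: Convention: $1/\infty = 0$ and $1/0=\infty$. $\mathbb{T} = \mathbb{R}/\mathbb{Z}$ is the one-dimensional torus, $\mathcal{S}(\mathbb{T})$ is the space of infinitely smooth periodic functions with its usual Fréchet topology, and $\mathcal{S}'(\mathbb{T})$ (periodic generalized functions) is its topological dual. $(\widehat{f}_k)_{k\in\mathbb{Z}}$ denotes the Fourier coefficients of $f \in \mathcal{S}'(\mathbb{T})$ with respect to $e^{2 i\pi k\cdot}$. Besov spaces: fix non-negative $\varphi_0,\varphi_1$ in the Schwartz class $\mathcal{S}(\mathbb{R})$ with $\mathrm{Supp}\,\varphi_0 \subset \{|x|\le 2\}$, $\mathrm{Supp}\,\varphi_1\subset\{1\le |x|\le 4\}$, and $\sum_{j\ge 0}\varphi_j = 1$, where $\varphi_j = \varphi_1(2^{-(j-1)}\cdot)$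 for $j\ge 2$. For $0<p,q\le\infty$ and $s\in\mathbb{R}$, $B_{p,q}^s(\mathbb{T})$ is the space of $f\in\mathcal{S}'(\mathbb{T})$ such that $$\|f\|_{B^s_{p,q}} = \Big(\sum_{j\ge 0} 2^{jsq} \Big\| \sum_{k\in\mathbb{Z}} \varphi_j(k)\widehat{f}_k e^{2 i\pi k\cdot}\Big\|_{L_p}^q\Big)^{1/q}<\infty$$ (with a supremum over $j$ of $2^{js}\|\cdot\|_{L_p}$ if $q=\infty$). The space does not depend on the choice of $(\varphi_j)$. Critical smoothness: for $f\in\mathcal{S}'(\mathbb{T})$ and $0<p,q\le\infty$, $s_f(p,q)=\sup\{s\in\mathbb{R} : f\in B^s_{p,q}(\mathbb{T})\}\in(-\infty,\infty]$. This value does not depend on $q$; the common value is denoted $s_f(p)$, and $p\mapsto s_f(p)$ is the critical smoothness function of $f$. *)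

(* Defs.v *)
From HB Require Import structures.
From mathcomp Require Import all_boot all_order all_algebra.
From mathcomp Require Import ring complex.
From mathcomp Require Import all_classical all_reals all_analysis.

Set Implicit Arguments.
Unset Strict Implicit.
Unset Printing Implicit Defensive.

Import Order.TTheory GRing.Theory Num.Theory.
Import numFieldNormedType.Exports.

Local Open Scope ring_scope.
Local Open Scope complex_scope.
Local Open Scope classical_set_scope.

Local Notation "f ^` ( n )" := (derive1n n f) : ring_scope.

Section SmoothReal.
Context {R : realType}.
Implicit Types (g h : R -> R) (a b c : R).

Definition smooth g : Prop := forall n x, derivable (g^`(n)) x 1.

Lemma derive1n_lin g h a b n : smooth g -> smooth h ->
  (fun x => a * g x + b * h x)^`(n) =
  (fun x => a * g^`(n) x + b * h^`(n) x).
Proof.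
move=> sg sh; elim: n => [//|n IH]; rewrite derive1nS IH.
apply/funext => x; rewrite derive1E.
have dg : is_derive x 1 g^`(n) (g^`(n.+1) x).
  by rewrite derive1nS derive1E; apply: derivableP; exact: sg.
have dh : is_derive x 1 h^`(n) (h^`(n.+1) x).
  by rewrite derive1nS derive1E; apply: derivableP; exact: sh.
have := is_deriveD (is_deriveZ a dg) (is_deriveZ b dh).
by move=> [_ ?].
Qed.

Lemma smooth_lin g h a b : smooth g -> smooth h ->
  smooth (fun x => a * g x + b * h x).
Proof.
move=> sg sh n x; rewrite derive1n_lin//.
have dg : derivable (a \*: g^`(n)) x 1 by apply: derivableZ; exact: sg.
have dh : derivable (b \*: h^`(n)) x 1 by apply: derivableZ; exact: sh.
exact: (derivableD dg dh).
Qed.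

Lemma is_derive_trig a b c (x : R) :
  is_derive x 1 (fun x => a * cos (c * x) + b * sin (c * x))
    ((b * c) * cos (c * x) + (- (a * c)) * sin (c * x)).
Proof.
have dc : is_derive x 1 (fun x : R => c * x) c.
  by apply: (is_derive_eq (is_deriveZ c (is_derive_id x 1))); exact: mulr1.
have d1 := @is_derive1_comp R cos (fun x => c * x) x _ _ (is_derive_cos _) dc.
have d2 := @is_derive1_comp R sin (fun x => c * x) x _ _ (is_derive_sin _) dc.
apply: (is_derive_eq (is_deriveD (is_deriveZ a d1) (is_deriveZ b d2))).
rewrite /GRing.scale /=; ring.
Qed.

Lemma smooth_trig a b c : smooth (fun x => a * cos (c * x) + b * sin (c * x)).
Proof.
move=> n x; suff [a' [b' ->]] : exists a' b',
    (fun x => a * cos (c * x) + b * sin (c * x))^`(n) =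
    (fun x => a' * cos (c * x) + b' * sin (c * x)).
  by have [] := is_derive_trig a' b' c x.
elim: n => [|n [a' [b' IH]]]; first by exists a, b.
exists (b' * c), (- (a' * c)); rewrite derive1nS IH.
by apply/funext => y; rewrite derive1E; have [] := is_derive_trig a' b' c y.
Qed.

End SmoothReal.

Section TestFunctions.
Variable R : realType.

(* Functions on the torus are 1-periodic functions on the line.  A complex
   function is differentiated through its real and imaginary parts. *)
Definition smooth_periodic : {pred R -> R[i]^o} :=
  [pred g | `[< [/\ periodic g 1,
                    smooth (fun x => complex.Re (g x)) &
                    smooth (fun x => complex.Im (g x))] >]].

Lemma smooth_periodicP (g : R -> R[i]^o) :
  reflect [/\ periodic g 1, smooth (fun x => complex.Re (g x)) &
              smooth (fun x => complex.Im (g x))]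
          (g \in smooth_periodic).
Proof. exact: asboolP. Qed.

Lemma smooth_periodic_submod_closed : submod_closed smooth_periodic.
Proof.
have s0 : smooth (fun=> 0 : R).
  have := @smooth_trig R 0 0 0.
  by under eq_fun do rewrite !mul0r addr0.
split; first by apply/smooth_periodicP; split => //.
move=> a g h /smooth_periodicP[pg rg ig] /smooth_periodicP[ph rh ih].
apply/smooth_periodicP; split.
- by move=> u; rewrite /= !fctE /= (pg u) (ph u).
- have -> : (fun x => complex.Re ((a *: g + h) x)) = (fun x =>
      1 * (complex.Re a * complex.Re (g x) + (- complex.Im a) * complex.Im (g x))
      + 1 * complex.Re (h x)).
    apply/funext => x; rewrite !mul1r.
    rewrite [X in complex.Re X](_ : _ = a * g x + h x)//.
    by case: a (g x) (h x) => [? ?] [? ?] [? ?] /=; rewrite mulNr.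
  by apply: smooth_lin => //; exact: smooth_lin.
- have -> : (fun x => complex.Im ((a *: g + h) x)) = (fun x =>
      1 * (complex.Re a * complex.Im (g x) + complex.Im a * complex.Re (g x))
      + 1 * complex.Im (h x)).
    apply/funext => x; rewrite !mul1r.
    rewrite [X in complex.Im X](_ : _ = a * g x + h x)//.
    by case: a (g x) (h x) => [? ?] [? ?] [? ?] /=.
  by apply: smooth_lin => //; exact: smooth_lin.
Qed.

HB.instance Definition _ :=
  GRing.isSubmodClosed.Build R[i] (R -> R[i]^o) smooth_periodic
    smooth_periodic_submod_closed.

Record torus_test := TorusTest {
  test_fun :> R -> R[i]^o;
  test_smooth : test_fun \in smooth_periodic }.

HB.instance Definition _ := [isSub for test_fun].
HB.instance Definition _ := [Choice of torus_test by <:].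
HB.instance Definition _ := [SubChoice_isSubLmodule of torus_test by <:].

Definition cderive1n (n : nat) (g : R -> R[i]^o) (x : R) : R[i] :=
  (fun y => complex.Re (g y))^`(n) x +i* (fun y => complex.Im (g y))^`(n) x.

Definition expi_fun (k : int) (x : R) : R[i]^o :=
  cos (2 * pi * k%:~R * x) +i* sin (2 * pi * k%:~R * x).

Lemma expi_smooth_periodic (k : int) : expi_fun k \in smooth_periodic.
Proof.
apply/smooth_periodicP; split.
- move=> u; rewrite /expi_fun mulrDr mulr1.
  have cp (x : R) : cos (x + 2 * pi * k%:~R) = cos x /\
                    sin (x + 2 * pi * k%:~R) = sin x.
    case: k => n.
      have -> : 2 * pi * (Posz n)%:~R = (pi *+ 2) *+ n :> R.
        by rewrite mulr_natl mulr_natr.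
      by split; [exact: (periodicn (@cosD2pi R))|exact: (periodicn (@sinD2pi R))].
    have -> : 2 * pi * (Negz n)%:~R = - ((pi *+ 2) *+ n.+1) :> R.
      by rewrite NegzE mulr_natl mulrNz mulrN mulr_natr.
    have := periodicn (@cosD2pi R) n.+1 (x - (pi *+ 2) *+ n.+1).
    have := periodicn (@sinD2pi R) n.+1 (x - (pi *+ 2) *+ n.+1).
    by rewrite subrK => -> ->.
  by have [-> ->] := cp (2 * pi * k%:~R * u).
- have := @smooth_trig R 1 0 (2 * pi * k%:~R).
  by under eq_fun do rewrite mul1r mul0r addr0.
- have := @smooth_trig R 0 1 (2 * pi * k%:~R).
  by under eq_fun do rewrite mul1r mul0r add0r.
Qed.

Definition expi (k : int) : torus_test := TorusTest (expi_smooth_periodic k).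

(* Continuity for the Fréchet topology, that is, the locally convex topology
   of the seminorms g |-> sup_x |g^(m)(x)|, m in nat. *)
Definition frechet_continuous (f : torus_test -> R[i]) : Prop :=
  forall (g : torus_test) (e : R), 0 < e ->
  exists n : nat, exists2 d : R, 0 < d &
  forall h : torus_test,
    (forall m x, (m <= n)%N -> Normc.normc (cderive1n m (h - g) x) <= d) ->
    Normc.normc (f h - f g) < e.

Record periodic_gf := PeriodicGf {
  pgf_fun :> {linear torus_test -> R[i]^o};
  pgf_continuous : frechet_continuous pgf_fun }.

Definition torus_integral (F : R -> R[i]) : R[i] :=
  Rintegral lebesgue_measure `[0, 1] (fun x => complex.Re (F x)) +i*
  Rintegral lebesgue_measure `[0, 1] (fun x => complex.Im (F x)).

(* f is in S(T), where g in S(T) is identified with h |-> \int_T g h. *)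
Definition is_smooth (f : periodic_gf) : Prop :=
  exists g : torus_test, forall h : torus_test,
    f h = torus_integral (fun x => g x * h x).

Definition fourier (f : periodic_gf) (k : int) : R[i] := f (expi (- k)).

End TestFunctions.

Section Besov.
Variable R : realType.

Definition schwartz (phi : R -> R) : Prop :=
  smooth phi /\
  forall m n : nat, exists C : R, forall x, `|x ^+ m * phi^`(n) x| <= C.

Definition dyadic (phi0 phi1 : R -> R) (j : nat) : R -> R :=
  if j is j'.+1 then fun x => phi1 (x / 2 ^+ j') else phi0.

Definition is_dyadic_partition (phi0 phi1 : R -> R) : Prop :=
  [/\ schwartz phi0 /\ schwartz phi1,
      (forall x, 0 <= phi0 x) /\ (forall x, 0 <= phi1 x),
      closure [set x | phi0 x != 0] `<=` [set x | `|x| <= 2],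
      closure [set x | phi1 x != 0] `<=` [set x | 1 <= `|x| <= 4] &
      forall x, series (dyadic phi0 phi1 ^~ x) @ \oo --> (1 : R)].

Definition torus_measure : {measure set (measurableTypeR R) -> \bar R} :=
  mrestr (@lebesgue_measure R) (measurable_itv `[0, 1]%R).

(* The sum is finitely supported, since phi_j has compact support. *)
Definition besov_block (phi0 phi1 : R -> R) (f : periodic_gf R) (j : nat)
    (x : R) : R[i] :=
  \sum_(k \in [set: int])
    (dyadic phi0 phi1 j k%:~R)%:C * fourier f k * expi R k x.

Definition besov_block_norm (phi0 phi1 : R -> R) (f : periodic_gf R)
    (p : \bar R) (j : nat) : \bar R :=
  Lnorm torus_measure p
    (fun x => (Normc.normc (besov_block phi0 phi1 f j x))%:E).

(* Only 0 < q is meaningful. *)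
Definition besov_norm (phi0 phi1 : R -> R) (p q : \bar R) (s : R)
    (f : periodic_gf R) : \bar R :=
  (match q with
   | r%:E => (\sum_(0 <= j <oo) (2 `^ (j%:R * s * r))%:E *
                 besov_block_norm phi0 phi1 f p j `^ r) `^ r^-1
   | +oo => ereal_sup (range (fun j : nat => (2 `^ (j%:R * s))%:E *
                                besov_block_norm phi0 phi1 f p j))
   | -oo => 0
   end)%E.

Definition besov (phi0 phi1 : R -> R) (p q : \bar R) (s : R) :
    set (periodic_gf R) :=
  [set f | (besov_norm phi0 phi1 p q s f < +oo)%E].

Definition critical_smoothness (phi0 phi1 : R -> R) (f : periodic_gf R)
    (p q : \bar R) : \bar R :=
  ereal_sup [set s%:E | s in [set s | besov phi0 phi1 p q s f]].

(* S is p |-> s_f(p) on (0, oo], the common value of the s_f(p, q); the value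
   of S at non-positive p is irrelevant. *)
Definition is_critical_smoothness_function (phi0 phi1 : R -> R)
    (f : periodic_gf R) (S : \bar R -> \bar R) : Prop :=
  forall p q : \bar R, (0 < p)%E -> (0 < q)%E ->
    S p = critical_smoothness phi0 phi1 f p q.

(* u |-> s (1 / u); the inverse on \bar R satisfies 1 / 0 = +oo. *)
Definition recip_arg (s : \bar R -> R) (u : R) : R := s (u%:E^-1)%E.

Definition nondec_concave_1lipschitz (g : R -> R) : Prop :=
  [/\ {in `[0, +oo[ &, {homo g : u v / u <= v}},
      (forall t u v : R, 0 <= t <= 1 -> 0 <= u -> 0 <= v ->
         t * g u + (1 - t) * g v <= g (t * u + (1 - t) * v)) &
      1.-lipschitz_(`[0, +oo[) g].

End Besov.

(* Main.v *)
Require Import Defs.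
From HB Require Import structures.
From mathcomp Require Import all_boot all_order all_algebra.
From mathcomp Require Import ring lra zify complex.
From mathcomp Require Import all_classical all_reals all_analysis.

Set Implicit Arguments.
Unset Strict Implicit.
Unset Printing Implicit Defensive.

Import Order.TTheory GRing.Theory Num.Theory.
Import numFieldNormedType.Exports.
Import ess_sup_inf measurable_realfun ComplexField.
Local Open Scope ring_scope.
Local Open Scope complex_scope.
Local Open Scope classical_set_scope.

(** The variable throughout is u = 1/p, with u = 0 for p = oo, and g(u) is the
critical smoothness at p.  A dyadic block of f is, up to a factor of modulus
one, a polynomial of size 2^(j+2) in exp(2 i pi x).  Up to an arbitrarily small
loss in s, and whatever q is, f belongs to B^s_{p,q} when the L_p norms of its
blocks are O(2^(-j s)), so g(u) is the supremum of the exponents s of such a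
decay [critical_smoothnessE].

The shape of g.  Log-convexity of u |-> L_{1/u} ([lyapunov]) makes g concave.
The Fourier coefficients grow at most polynomially, which bounds g from below
by one constant for all u [exists_block_decay]; a concave function on the half
line that is bounded below is non-decreasing.  If g(u) were infinite for some
u, interpolation with this lower bound would give rapid decay in L_1, hence of
the Fourier coefficients; the Fourier series is then a smooth function with the
same coefficients as f, and it equals f because trigonometric polynomials are
dense in the test functions [smooth_of_block_decay].  By concavity the slopes of
g are at most those at 0, where the points u = 1/m suffice; there the Nikolskii
inequality between L_m and L_oo follows from the one between L_1 and L_oo,
applied to P^m [block_decay_nikolskii].

Prescribing g.  A non-decreasing, concave, 1-Lipschitz g is the infimum of its
supporting lines a + b u [supporting_line]; all have b in [0, 1] and a >= g(0),
and countably many suffice, those at rational points, because g is continuous.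
Near the frequencies of size 2^j, j a multiple of 4, f has the coefficients
2^(-j a) 2^(-l) phi_j(k) at the multiples k of 2^d, where l + d is about j and
l is about b j.  In space this is a function of height about 2^(-j a),
concentrated within about 2^(-j) of the lattice 2^(-d) Z, that is, on a set of
measure about 2^(-l), so that its L_{1/u} norm is about 2^(-j (a + b u)).
The upper bound is summation by parts: multiplying a polynomial by (1 - X)^r
takes finite differences of its coefficients, here samples of a smooth function
[construct_upper].  The lower bound comes from a single Fourier coefficient,
which bounds the L_1 norm from below; the exponent 1 is reached from u by
interpolating with the upper bound at 0 or 2 [construct_no_decay].  Each of the
countably many lines is used for infinitely many j, so the decay exponent of f
at u is the infimum of the lines, g(u) [exists_critical_smoothness]. *)

(** * Lp quasi-norms on the torus *)

Section TorusNorm.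
Variable R : realType.
Local Notation mu := (torus_measure R).

Lemma torus_measureT : mu [set: R] = 1%E.
Proof.
rewrite /torus_measure /= /mrestr /= setTI lebesgue_measure_itv /= lte_fin ltr01.
by rewrite oppr0 adde0.
Qed.

Lemma Lnorm_inv_gt0P (w : R -> R) (u A : R) : 0 < u -> (forall x, 0 <= w x) ->
  0 <= A ->
  (Lnorm mu (u%:E^-1) (EFin \o w) <= A%:E)%E <->
  (\int[mu]_x (w x `^ u^-1)%:E <= (A `^ u^-1)%:E)%E.
Proof.
move=> u0 w0 A0; rewrite inver gt_eqF// unlock invrK.
under eq_integral do rewrite /= ger0_norm//.
have i0 : (0 <= \int[mu]_x (w x `^ u^-1)%:E)%E.
  by apply: integral_ge0 => x _; rewrite lee_fin powR_ge0.
split=> h.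
  have := @gt0_ler_poweR R u^-1 _ _ _ _ _ h.
  rewrite -poweRrM divff ?gt_eqF// poweRe1// poweR_EFin; apply.
  - by rewrite invr_ge0 ltW.
  - by rewrite in_itv /= leey andbT poweR_ge0.
  - by rewrite in_itv /= leey andbT lee_fin.
have := @gt0_ler_poweR R u _ _ _ _ _ h.
rewrite poweR_EFin -powRrM mulVf ?gt_eqF// powRr1//; apply.
- by rewrite ltW.
- by rewrite in_itv /= leey andbT.
- by rewrite in_itv /= leey andbT lee_fin powR_ge0.
Qed.

Lemma Lnorm_inv0P (w : R -> R) (A : R) : (forall x, 0 <= w x) ->
  (Lnorm mu (0%:E^-1) (EFin \o w) <= A%:E)%E <-> {ae mu, forall x, w x <= A}.
Proof.
move=> w0; rewrite inver eqxx unlock /=.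
have -> : (0 < mu [set: R])%E by rewrite torus_measureT.
split.
  by move/ess_supP; apply: filterS => x /=; rewrite lee_fin ger0_norm.
move=> h; apply/ess_supP; apply: (@filterS _ _ (ae_filter_ringOfSetsType mu) _ _ _ h) => x /=.
by rewrite lee_fin ger0_norm.
Qed.

Lemma integral_lin_le (f g : R -> R) (a b F G : R) :
  measurable_fun setT f -> measurable_fun setT g ->
  (forall x, 0 <= f x) -> (forall x, 0 <= g x) -> 0 <= a -> 0 <= b ->
  (\int[mu]_x (f x)%:E <= F%:E)%E -> (\int[mu]_x (g x)%:E <= G%:E)%E ->
  (\int[mu]_x (a * f x + b * g x)%:E <= (a * F + b * G)%:E)%E.
Proof.
move=> mf mg f0 g0 a0 b0 hF hG.
under eq_integral do rewrite EFinD !EFinM.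
rewrite ge0_integralD//; last 4 first.
- by move=> x _; rewrite -EFinM lee_fin mulr_ge0.
- by apply: measurable_funeM; exact/measurable_EFinP.
- by move=> x _; rewrite -EFinM lee_fin mulr_ge0.
- by apply: measurable_funeM; exact/measurable_EFinP.
rewrite !ge0_integralZl_EFin//; last 4 first.
- by move=> x _; rewrite lee_fin.
- exact/measurable_EFinP.
- by move=> x _; rewrite lee_fin.
- exact/measurable_EFinP.
by rewrite EFinD !EFinM leeD// lee_wpmul2l// lee_fin.
Qed.

Lemma weighted_amgm (X Y th : R) : 0 <= X -> 0 <= Y -> 0 < th < 1 ->
  X `^ th * Y `^ (1 - th) <= th * X + (1 - th) * Y.
Proof.
move=> X0 Y0 /andP[t0 t1].
have t1' : 0 < 1 - th by rewrite subr_gt0.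
have := @conjugate_powR R (X `^ th) (Y `^ (1 - th)) th^-1 (1 - th)^-1
  (powR_ge0 _ _) (powR_ge0 _ _).
rewrite !invr_gt0 !invrK => /(_ t0 t1') -/(_ _)/le_trans; apply; first by rewrite addrC subrK.
by rewrite -!powRrM !divff ?gt_eqF// !powRr1// ![_ * X]mulrC ![_ * Y]mulrC.
Qed.

Lemma measurable_powR_comp (w : R -> R) a : measurable_fun setT w ->
  measurable_fun [set: R] (fun x => w x `^ a).
Proof.
by move=> mw; apply: (measurableT_comp (measurable_powR a)).
Qed.

Lemma powRVl (x a : R) : 0 <= x -> x^-1 `^ a = (x `^ a)^-1.
Proof. by move=> x0; rewrite -powR_inv1// -powRrM mulN1r powRN. Qed.

Lemma powR_split (t x : R) : 0 <= x -> x = x `^ t * x `^ (1 - t).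
Proof.
move=> x0; rewrite -powRD; first by rewrite addrC subrK powRr1.
by rewrite addrC subrK oner_eq0.
Qed.

Lemma scaled_integral_le1 (w : R -> R) (a A : R) : measurable_fun setT w ->
  (forall x, 0 <= w x) -> 0 < A ->
  (\int[mu]_x (w x `^ a)%:E <= (A `^ a)%:E)%E ->
  (\int[mu]_x ((w x / A) `^ a)%:E <= 1%:E)%E.
Proof.
move=> mw w0 A0 h.
have := @integral_lin_le (fun x => w x `^ a) (fun=> 0) ((A `^ a)^-1) 0 _ 0
  (measurable_powR_comp a mw) (measurable_cst _)
  (fun=> powR_ge0 _ _) (fun=> lexx _) _ (lexx _) h _.
rewrite invr_ge0 powR_ge0 => /(_ isT).
rewrite integral0 lexx => /(_ isT).
rewrite mulVf ?gt_eqF ?powR_gt0// mul0r addr0.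
congr (_ <= _)%E; apply: eq_integral => x _.
have Ai : 0 <= A^-1 by rewrite invr_ge0 ltW.
rewrite addr0 (powRM _ (w0 x) Ai).
by rewrite (powRVl _ (ltW A0)) mulrC.
Qed.

(** Normalizes w to norm at most one, the form in which the weighted AM-GM
    inequality is integrated. *)
Lemma scaled_Lnorm_le1 (w : R -> R) (u A : R) : 0 < u -> measurable_fun setT w ->
  (forall x, 0 <= w x) -> 0 < A ->
  (Lnorm mu (u%:E^-1) (EFin \o w) <= A%:E)%E ->
  (\int[mu]_x ((w x / A) `^ u^-1)%:E <= 1%:E)%E.
Proof.
move=> u0 mw w0 A0 /(Lnorm_inv_gt0P u0 w0 (ltW A0)) h.
exact: scaled_integral_le1.
Qed.

Lemma integral_le_of_ae (f g : R -> R) (F : R) : measurable_fun setT f ->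
  measurable_fun setT g -> (forall x, 0 <= f x) -> (forall x, 0 <= g x) ->
  {ae mu, forall x, f x <= g x} -> (\int[mu]_x (g x)%:E <= F%:E)%E ->
  (\int[mu]_x (f x)%:E <= F%:E)%E.
Proof.
move=> mf mg f0 g0 fg; apply: le_trans; apply: ae_ge0_le_integral => //.
- by move=> x _; rewrite lee_fin.
- exact/measurable_EFinP.
- by move=> x _; rewrite lee_fin.
- exact/measurable_EFinP.
- by apply: (@filterS _ _ (ae_filter_ringOfSetsType mu) _ _ _ fg) => x /= + _; rewrite lee_fin.
Qed.

Lemma Lnorm_ge0_le (p : \bar R) (w : R -> R) (A B : R) : A <= B ->
  (Lnorm mu p (EFin \o w) <= A%:E)%E -> (Lnorm mu p (EFin \o w) <= B%:E)%E.
Proof. by move=> AB /le_trans; apply; rewrite lee_fin. Qed.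

(** The endpoint u = 0 of [lyapunov], where the first norm is an essential
    supremum and bounds a power of w under the integral. *)
Lemma lyapunov_infinity (w : R -> R) (v t A B : R) : 0 <= v -> 0 < t < 1 ->
  measurable_fun setT w -> (forall x, 0 <= w x) -> 0 < A -> 0 < B ->
  (Lnorm mu (0%:E^-1) (EFin \o w) <= A%:E)%E ->
  (Lnorm mu (v%:E^-1) (EFin \o w) <= B%:E)%E ->
  (Lnorm mu (((1 - t) * v)%:E^-1) (EFin \o w) <= (A `^ t * B `^ (1 - t))%:E)%E.
Proof.
move=> v0 /andP[t0 t1] mw w0 A0 B0 /(Lnorm_inv0P _ w0) hA hB.
have t1' : 0 < 1 - t by rewrite subr_gt0.
move: v0; rewrite le_eqVlt => /predU1P[v0|v0].
  move: hB; rewrite -v0 mulr0 => /(Lnorm_inv0P _ w0) hB.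
  apply/(Lnorm_inv0P _ w0).
  apply: (@filterS2 _ _ (ae_filter_ringOfSetsType mu) _ _ _ _ hA hB) => x /= xA xB.
  rewrite [leLHS](powR_split t)//.
  by apply: ler_pM; rewrite ?powR_ge0//; apply: ge0_ler_powR; rewrite ?nnegrE ?(ltW A0) ?(ltW B0) ?(ltW t0) ?(ltW t1').
have r0 : 0 < (1 - t) * v by rewrite mulr_gt0.
apply/Lnorm_inv_gt0P => //; first by rewrite mulr_ge0 ?powR_ge0.
have hI := scaled_Lnorm_le1 v0 mw w0 B0 hB.
set r := (1 - t) * v; set K := (A `^ t * B `^ (1 - t)) `^ r^-1.
have K0 : 0 <= K by rewrite powR_ge0.
have mX : measurable_fun setT (fun x => (w x / B) `^ v^-1).
  apply: measurable_powR_comp; exact: measurable_funM.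
apply: (@integral_le_of_ae _ (fun x => K * (w x / B) `^ v^-1 + 0 * 0)) => //.
- exact: measurable_powR_comp.
- by apply: measurable_funD => //; exact: measurable_funM.
- by move=> x; rewrite powR_ge0.
- by move=> x; rewrite addr_ge0 ?mulr_ge0 ?powR_ge0 ?mulr0.
- apply: (@filterS _ _ (ae_filter_ringOfSetsType mu) _ _ _ hA) => x /= xA.
  rewrite mul0r addr0 /K /r.
  have Bi : 0 <= B^-1 by rewrite invr_ge0 ltW.
  rewrite [X in X `^ _ <= _](powR_split t)//.
  rewrite powRM ?powR_ge0// powRM ?powR_ge0//.
  rewrite -!powRrM.
  have -> : (1 - t) * ((1 - t) * v)^-1 = v^-1 by field; rewrite !gt_eqF.
  rewrite (powRM _ (w0 x) Bi) -[leRHS]mulrA.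
  apply: ler_pM; rewrite ?powR_ge0//.
    apply: ge0_ler_powR; rewrite ?nnegrE ?(ltW A0)//.
    by apply: divr_ge0; exact: ltW.
  by rewrite mulrCA (powRVl _ (ltW B0)) divff ?mulr1// gt_eqF// powR_gt0.
have := @integral_lin_le _ (fun=> 0) K 0 1 0 mX (measurable_cst _) _ _ K0 (lexx _) hI _.
rewrite mul0r addr0 mulr1; apply => //.
- by move=> x; rewrite powR_ge0.
- by rewrite integral0.
Qed.

(** Log-convexity of the norm in the reciprocal exponent u.  For finite exponents
    it is the weighted AM-GM inequality applied to the two normalized powers
    of w, with weight t u / (t u + (1 - t) v), then integrated. *)
Lemma lyapunov (w : R -> R) (u v t A B : R) : 0 <= u -> 0 <= v -> 0 <= t <= 1 ->
  measurable_fun setT w -> (forall x, 0 <= w x) -> 0 < A -> 0 < B ->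
  (Lnorm mu (u%:E^-1) (EFin \o w) <= A%:E)%E ->
  (Lnorm mu (v%:E^-1) (EFin \o w) <= B%:E)%E ->
  (Lnorm mu ((t * u + (1 - t) * v)%:E^-1) (EFin \o w) <= (A `^ t * B `^ (1 - t))%:E)%E.
Proof.
move=> u0 v0 /andP[]; rewrite le_eqVlt => /predU1P[<- _|t0].
  by rewrite mul0r add0r subr0 mul1r powRr0 mul1r => _ _ _ B0; rewrite powRr1// ltW.
rewrite le_eqVlt => /predU1P[->|t1].
  by rewrite subrr mul0r addr0 mul1r powRr0 mulr1 => _ _ A0 _; rewrite powRr1// ltW.
move=> mw w0 A0 B0 hA hB.
have t1' : 0 < 1 - t by rewrite subr_gt0.
move: u0; rewrite le_eqVlt => /predU1P[u0|u0].
  rewrite -u0 mulr0 add0r; apply: lyapunov_infinity => //; first by rewrite t0.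
  by rewrite u0.
move: v0; rewrite le_eqVlt => /predU1P[v0|v0].
  rewrite -v0 mulr0 addr0 [A `^ t * _]mulrC.
  set s := 1 - t; have -> : t = 1 - s by rewrite /s; ring.
  apply: lyapunov_infinity; rewrite ?(ltW u0)//; last by rewrite v0.
  by rewrite t1' /= ltrBlDr ltrDl.
set r := t * u + (1 - t) * v.
have r0 : 0 < r by rewrite addr_gt0// mulr_gt0.
apply/Lnorm_inv_gt0P => //; first by rewrite mulr_ge0 ?powR_ge0.
have hX := scaled_Lnorm_le1 u0 mw w0 A0 hA.
have hY := scaled_Lnorm_le1 v0 mw w0 B0 hB.
set K := (A `^ t * B `^ (1 - t)) `^ r^-1.
have K0 : 0 <= K by rewrite powR_ge0.
have mX : measurable_fun setT (fun x => (w x / A) `^ u^-1).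
  apply: measurable_powR_comp; exact: measurable_funM.
have mY : measurable_fun setT (fun x => (w x / B) `^ v^-1).
  apply: measurable_powR_comp; exact: measurable_funM.
pose th := t * u / r.
have th1 : 1 - th = (1 - t) * v / r by rewrite /th /r; field; rewrite gt_eqF.
have th0 : 0 < th by rewrite /th divr_gt0// mulr_gt0.
have th10 : 0 < 1 - th by rewrite th1 divr_gt0// mulr_gt0.
have a0 : 0 <= K * th by rewrite mulr_ge0// ltW.
have b0 : 0 <= K * (1 - th) by rewrite mulr_ge0// ltW.
apply: (@integral_le_of_ae _ (fun x => K * th * (w x / A) `^ u^-1 + K * (1 - th) * (w x / B) `^ v^-1)) => //.
- exact: measurable_powR_comp.
- by apply: measurable_funD => //; exact: measurable_funM.
- by move=> x; rewrite powR_ge0.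
- by move=> x; apply: addr_ge0; apply: mulr_ge0 => //; exact: powR_ge0.
- apply: aeW => x; rewrite -[K * th * _]mulrA -[K * (1 - th) * _]mulrA -mulrDr.
  have -> : w x `^ r^-1 = K * (((w x / A) `^ u^-1) `^ th * ((w x / B) `^ v^-1) `^ (1 - th)).
    rewrite -!powRrM th1 /th.
    have -> : u^-1 * (t * u / r) = t / r by field; rewrite !gt_eqF.
    have -> : v^-1 * ((1 - t) * v / r) = (1 - t) / r by field; rewrite !gt_eqF.
    rewrite /K powRM ?powR_ge0// -!powRrM mulrACA -!powRM ?divr_ge0// ?ltW//.
    rewrite ![_ * (w x / _)]mulrC !divfK ?gt_eqF//.
    rewrite -powRD; first by congr (_ `^ _); field; rewrite gt_eqF.
    by rewrite -mulrDl addrC subrK mul1r invr_eq0 gt_eqF.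
  apply: ler_wpM2l => //; apply: weighted_amgm; rewrite ?powR_ge0//.
  by rewrite th0 -subr_gt0.
have := integral_lin_le mX mY _ _ a0 b0 hX hY.
rewrite !mulr1 -mulrDr [th + _]addrC subrK mulr1; apply => x; exact: powR_ge0.
Qed.

Lemma Lnorm_le_of_bound (w : R -> R) (u A : R) : 0 <= u -> 0 <= A ->
  measurable_fun setT w -> (forall x, 0 <= w x) -> (forall x, w x <= A) ->
  (Lnorm mu (u%:E^-1) (EFin \o w) <= A%:E)%E.
Proof.
move=> + A0 mw w0 wA; rewrite le_eqVlt => /predU1P[<-|u0].
  by apply/Lnorm_inv0P => //; apply: aeW => x.
apply/Lnorm_inv_gt0P => //.
apply: (@integral_le_of_ae _ (fun=> A `^ u^-1)) => //.
- exact: measurable_powR_comp.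
- by move=> x; rewrite powR_ge0.
- by move=> x; rewrite powR_ge0.
- by apply: aeW => x; apply: ge0_ler_powR => //; rewrite ?nnegrE// invr_ge0 ltW.
- by rewrite integral_cst//= torus_measureT mule1.
Qed.
End TorusNorm.

(** * Complex functions and integrals on the torus *)

Section ComplexCalc.
Variable R : realType.
Local Notation normc := Normc.normc.
Local Notation mu := (torus_measure R).
Implicit Types (F G : R -> R[i]).

Definition ccontinuous F :=
  continuous (fun x => complex.Re (F x)) /\ continuous (fun x => complex.Im (F x)).

Lemma ReD (a b : R[i]) : complex.Re (a + b) = complex.Re a + complex.Re b.
Proof. by case: a b => [? ?] [? ?]. Qed.
Lemma ImD (a b : R[i]) : complex.Im (a + b) = complex.Im a + complex.Im b.
Proof. by case: a b => [? ?] [? ?]. Qed.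
Lemma ReM (a b : R[i]) : complex.Re (a * b) =
  complex.Re a * complex.Re b - complex.Im a * complex.Im b.
Proof. by case: a b => [? ?] [? ?]. Qed.
Lemma ImM (a b : R[i]) : complex.Im (a * b) =
  complex.Re a * complex.Im b + complex.Im a * complex.Re b.
Proof. by case: a b => [? ?] [? ?]. Qed.

Lemma ReB (a b : R[i]) : complex.Re (a - b) = complex.Re a - complex.Re b.
Proof. by case: a b => [? ?] [? ?]. Qed.
Lemma ImB (a b : R[i]) : complex.Im (a - b) = complex.Im a - complex.Im b.
Proof. by case: a b => [? ?] [? ?]. Qed.

Lemma eq_ReIm (a b : R[i]) : complex.Re a = complex.Re b ->
  complex.Im a = complex.Im b -> a = b.
Proof. by case: a b => [? ?] [? ?] /= -> ->. Qed.

Lemma normcE (a : R[i]) :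
  normc a = Num.sqrt (complex.Re a ^+ 2 + complex.Im a ^+ 2).
Proof. by case: a. Qed.

Lemma normc_ge0 (a : R[i]) : 0 <= normc a.
Proof. by rewrite normcE sqrtr_ge0. Qed.

Lemma normc_triangle (a b : R[i]) : normc (a + b) <= normc a + normc b.
Proof. exact: le_normcD. Qed.

Lemma normc_sum (I : Type) (r : seq I) (P : pred I) (E : I -> R[i]) :
  normc (\sum_(i <- r | P i) E i) <= \sum_(i <- r | P i) normc (E i).
Proof.
elim/big_ind2 : _ => [|a b c d h1 h2|//]; first by rewrite Normc.normc0.
exact: le_trans (normc_triangle _ _) (lerD h1 h2).
Qed.

Lemma normcX (a : R[i]) n : normc (a ^+ n) = normc a ^+ n.
Proof.
elim: n => [|n ih]; first by rewrite !expr0 Normc.normc1.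
by rewrite !exprS Normc.normcM ih.
Qed.

Lemma normc_real (r : R) : normc r%:C = `|r|.
Proof. by rewrite normcE /= expr0n addr0 sqrtr_sqr. Qed.

Lemma Re_le_normc (a : R[i]) : `|complex.Re a| <= normc a.
Proof.
rewrite normcE -sqrtr_sqr ler_wsqrtr// lerDl sqr_ge0//.
Qed.
Lemma Im_le_normc (a : R[i]) : `|complex.Im a| <= normc a.
Proof. by rewrite normcE -sqrtr_sqr ler_wsqrtr// lerDr sqr_ge0. Qed.

Lemma normc_le_ReIm (a : R[i]) : normc a <= `|complex.Re a| + `|complex.Im a|.
Proof.
rewrite normcE -[leRHS]ger0_norm ?addr_ge0// -sqrtr_sqr ler_wsqrtr//.
rewrite sqrrD !real_normK ?num_real// lerD2r lerDl.
by rewrite mulrn_wge0// mulr_ge0.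
Qed.

Lemma normc_opp (a : R[i]) : normc (- a) = normc a.
Proof. exact: normcN. Qed.

Lemma ccontinuous_cst (c : R[i]) : ccontinuous (fun=> c).
Proof. by split => x; exact: cvg_cst. Qed.

Lemma ccontinuousD F G : ccontinuous F -> ccontinuous G ->
  ccontinuous (fun x => F x + G x).
Proof.
move=> [rF iF] [rG iG]; split.
  by under eq_fun do rewrite ReD; move=> x; apply: cvgD; [exact: rF|exact: rG].
by under eq_fun do rewrite ImD; move=> x; apply: cvgD; [exact: iF|exact: iG].
Qed.

Lemma ccontinuousM F G : ccontinuous F -> ccontinuous G ->
  ccontinuous (fun x => F x * G x).
Proof.
move=> [rF iF] [rG iG]; split.
  under eq_fun do rewrite ReM; move=> x; apply: cvgB; apply: cvgM;
  by [exact: rF|exact: rG|exact: iF|exact: iG].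
under eq_fun do rewrite ImM; move=> x; apply: cvgD; apply: cvgM;
by [exact: rF|exact: rG|exact: iF|exact: iG].
Qed.

Lemma ccontinuous_sum (I : Type) (r : seq I) (P : pred I) (E : I -> R -> R[i]) :
  (forall i, ccontinuous (E i)) -> ccontinuous (fun x => \sum_(i <- r | P i) E i x).
Proof.
move=> cE; elim: r => [|i r ih].
  by under eq_fun do rewrite big_nil; exact: ccontinuous_cst.
under eq_fun do rewrite big_cons; case: (P i) => //; exact: ccontinuousD.
Qed.

Lemma continuous_normc F : ccontinuous F -> continuous (fun x => normc (F x)).
Proof.
move=> [rF iF]; under eq_fun do rewrite normcE; move=> x.
apply: continuous_comp; last exact: sqrt_continuous.
by apply: cvgD; apply: cvgM; by [exact: rF|exact: iF].
Qed.

Lemma measurable_normc F : ccontinuous F -> measurable_fun setT (fun x => normc (F x)).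
Proof. by move=> /continuous_normc; exact: continuous_measurable_fun. Qed.

Lemma continuous_integrable01 (f : R -> R) : continuous f ->
  lebesgue_measure.-integrable `[0, 1] (EFin \o f).
Proof.
move=> cf; apply: continuous_compact_integrable; first exact: segment_compact.
exact: continuous_subspaceT.
Qed.

Lemma integral_torus_measure (f : R -> \bar R) : (forall x, 0 <= f x)%E ->
  measurable_fun setT f ->
  (\int[mu]_x f x = \int[lebesgue_measure]_(x in `[0%R, 1%R]) f x)%E.
Proof.
move=> f0 mf; have mI := measurable_itv `[(0:R), 1]%R.
rewrite -(setvU `[(0:R), 1]) ge0_integral_setU//=; last 3 first.
- exact: measurableC.
- exact: measurable_funTS.
- by apply/disj_setPS => x [].
rewrite [X in (X + _)%E](eq_measure_integral mzero); last first.
  move=> A mA AI; rewrite /= /mrestr (_ : A `&` _ = set0) ?measure0//.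
  by rewrite -subset0 => x [/AI].
rewrite integral_measure_zero add0e.
apply: eq_measure_integral => A mA AI; rewrite /= /mrestr; congr lebesgue_measure.
exact/setIidPl.
Qed.

Lemma torus_integralE F : torus_integral F =
  (\int[lebesgue_measure]_(x in `[0, 1]) complex.Re (F x)) +i*
  (\int[lebesgue_measure]_(x in `[0, 1]) complex.Im (F x)).
Proof. by []. Qed.

Lemma torus_integralD F G : ccontinuous F -> ccontinuous G ->
  torus_integral (fun x => F x + G x) = torus_integral F + torus_integral G.
Proof.
move=> [rF iF] [rG iG]; apply: eq_ReIm; rewrite ?ReD ?ImD /=.
  under eq_Rintegral do rewrite ReD.
  by rewrite RintegralD//; exact: continuous_integrable01.
under eq_Rintegral do rewrite ImD.
by rewrite RintegralD//; exact: continuous_integrable01.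
Qed.

Lemma torus_integralZ (a : R[i]) F : ccontinuous F ->
  torus_integral (fun x => a * F x) = a * torus_integral F.
Proof.
move=> [rF iF]; have Ir := continuous_integrable01 rF.
have Ii := continuous_integrable01 iF.
have Z (c : R) (f : R -> R) : continuous f ->
    lebesgue_measure.-integrable `[0, 1] (EFin \o (fun x => c * f x)).
  move=> cf; apply: continuous_integrable01 => x.
  by apply: cvgM; [exact: cvg_cst|exact: cf].
apply: eq_ReIm; rewrite ?ReM ?ImM /=.
  under eq_Rintegral do rewrite ReM.
  by rewrite RintegralB ?RintegralZl//; exact: Z.
under eq_Rintegral do rewrite ImM.
by rewrite RintegralD ?RintegralZl//; exact: Z.
Qed.

Lemma torus_integral_sum (I : Type) (r : seq I) (E : I -> R -> R[i]) :
  (forall i, ccontinuous (E i)) ->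
  torus_integral (fun x => \sum_(i <- r) E i x) = \sum_(i <- r) torus_integral (E i).
Proof.
move=> cE; elim: r => [|i r ih].
  rewrite big_nil; under eq_fun do rewrite big_nil.
  by rewrite torus_integralE /= !Rintegral_cst//= !mul0r.
rewrite big_cons; under eq_fun do rewrite big_cons.
by rewrite torus_integralD ?ih//; exact: ccontinuous_sum.
Qed.

(** Real and imaginary parts are bounded separately, which costs the factor 2;
    the sharp constant never matters below. *)
Lemma normc_torus_integral_le F : ccontinuous F -> normc (torus_integral F) <=
  2 * \int[lebesgue_measure]_(x in `[0, 1]) normc (F x).
Proof.
move=> cF; have [rF iF] := cF; apply: (le_trans (normc_le_ReIm _)) => /=.
have In := continuous_integrable01 (continuous_normc cF).
have key (f : R -> R) : continuous f -> (forall x, `|f x| <= normc (F x)) ->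
    `|\int[lebesgue_measure]_(x in `[0, 1]) f x| <=
    \int[lebesgue_measure]_(x in `[0, 1]) normc (F x).
  move=> cf fF; have If := continuous_integrable01 cf.
  apply: le_trans (le_normr_Rintegral _ If) _ => //.
  apply: le_Rintegral => //; exact: integrable_norm.
rewrite mulr_natl mulr2n; apply: lerD; apply: key => // x.
  exact: Re_le_normc.
exact: Im_le_normc.
Qed.

Lemma normc_torus_integral_le_sup F (M : R) : ccontinuous F -> (forall x, normc (F x) <= M) ->
  normc (torus_integral F) <= 2 * M.
Proof.
move=> cF FM; apply: le_trans (normc_torus_integral_le cF) _.
rewrite ler_wpM2l//.
have -> : M = \int[lebesgue_measure]_(x in `[0, 1]) M.
  rewrite Rintegral_cst//= lebesgue_measure_itv /= lte_fin ltr01.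
  by rewrite oppr0 adde0 mulr1.
apply: le_Rintegral => //; first exact: continuous_integrable01 (continuous_normc cF).
by apply: continuous_integrable01 => x; exact: cvg_cst.
Qed.

Lemma normc_torus_integral_le_Lnorm F (A : R) : ccontinuous F -> 0 <= A ->
  (Lnorm mu (1%:E^-1) (EFin \o (fun x => normc (F x))) <= A%:E)%E ->
  normc (torus_integral F) <= 2 * A.
Proof.
move=> cF A0 /Lnorm_inv_gt0P; rewrite invr1 => /(_ ltr01 (fun x => normc_ge0 _) A0).
rewrite powRr1//.
under eq_integral do rewrite powRr1 ?normc_ge0//.
rewrite integral_torus_measure//; last 2 first.
- by move=> x; rewrite lee_fin normc_ge0.
- by apply/measurable_EFinP; exact: measurable_normc.
move=> h; apply: le_trans (normc_torus_integral_le cF) _; rewrite ler_wpM2l//.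
rewrite /Rintegral -lee_fin fineK//.
apply: integrable_fin_num => //.
exact: continuous_integrable01 (continuous_normc cF).
Qed.

Lemma Rintegral_derive (f g : R -> R) : (forall x : R, is_derive x 1 f (g x)) ->
  continuous g -> \int[lebesgue_measure]_(x in `[0, 1]) g x = f 1 - f 0.
Proof.
move=> dfg cg; have cf : continuous f.
  move=> x; apply: differentiable_continuous; apply/derivable1_diffP.
  by have [] := dfg x.
rewrite /Rintegral (@continuous_FTC2 _ g f)//.
- exact: continuous_subspaceT.
- split.
  + by move=> x _; have [] := dfg x.
  + by apply: cvg_at_right_filter; exact: cf.
  + by apply: cvg_at_left_filter; exact: cf.
- by move=> x _; rewrite derive1E; have [] := dfg x.
Qed.

(** * Complex exponentials *)

Definition expc (x : R) : R[i] := cos (2 * pi * x) +i* sin (2 * pi * x).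

Lemma expcD x y : expc (x + y) = expc x * expc y.
Proof.
apply: eq_ReIm; rewrite ?ReM ?ImM /= mulrDr ?cosD ?sinD//; ring.
Qed.

Lemma expc0 : expc 0 = 1.
Proof. by rewrite /expc mulr0 cos0 sin0. Qed.

Lemma normc_expc x : normc (expc x) = 1.
Proof. by rewrite normcE /= cos2Dsin2 sqrtr1. Qed.

Lemma expc_neq0 x : expc x != 0.
Proof.
apply/eqP => h; have := normc_expc x; rewrite h Normc.normc0 => /eqP.
by rewrite eq_sym oner_eq0.
Qed.

Lemma expcMn n x : expc (n%:R * x) = expc x ^+ n.
Proof.
elim: n => [|n ih]; first by rewrite mul0r expc0.
by rewrite exprS -ih -expcD -natr1 mulrDl mul1r addrC.
Qed.

Lemma expiE (k : int) x : expi R k x = expc (k%:~R * x).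
Proof. by rewrite /= /expi_fun /expc !mulrA. Qed.

Lemma expiD (j k : int) x : expi R (j + k) x = expi R j x * expi R k x.
Proof. by rewrite !expiE intrD mulrDl expcD. Qed.

Lemma expi0 x : expi R 0 x = 1.
Proof. by rewrite expiE mul0r expc0. Qed.

Lemma normc_expi (k : int) x : normc (expi R k x) = 1.
Proof. by rewrite expiE normc_expc. Qed.

Lemma expi_nat (n : nat) x : expi R n x = expc x ^+ n.
Proof. by rewrite expiE -pmulrn expcMn. Qed.

Lemma is_derive_cosM (c : R) (x : R) :
  is_derive x 1 (fun y => cos (c * y)) (- c * sin (c * x)).
Proof.
have := @is_derive_trig R 1 0 c x; rewrite mul0r mul0r add0r mul1r => h.
rewrite (_ : (fun y => _) = fun y : R => 1 * cos (c * y) + 0 * sin (c * y))//.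
by apply/funext => y; rewrite mul1r mul0r addr0.
Qed.

Lemma is_derive_sinM (c : R) (x : R) :
  is_derive x 1 (fun y => sin (c * y)) (c * cos (c * x)).
Proof.
have := @is_derive_trig R 0 1 c x; rewrite mul0r oppr0 mul0r addr0 mul1r => h.
rewrite (_ : (fun y => _) = fun y : R => 0 * cos (c * y) + 1 * sin (c * y))//.
by apply/funext => y; rewrite mul1r mul0r add0r.
Qed.

Lemma is_derive_continuous (f g : R -> R) :
  (forall x : R, is_derive x 1 f (g x)) -> continuous f.
Proof.
move=> dfg x; apply: differentiable_continuous; apply/derivable1_diffP.
by have [] := dfg x.
Qed.

Lemma continuous_cosM (c : R) : continuous (fun y : R => cos (c * y)).
Proof. exact: is_derive_continuous (is_derive_cosM c). Qed.
Lemma continuous_sinM (c : R) : continuous (fun y : R => sin (c * y)).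
Proof. exact: is_derive_continuous (is_derive_sinM c). Qed.

Lemma ccontinuous_expi (k : int) : ccontinuous (expi R k).
Proof. by split; [exact: continuous_cosM|exact: continuous_sinM]. Qed.

(** Componentwise, in accordance with how test functions are differentiated. *)
Definition is_cderive (F G : R -> R[i]) := forall x : R,
  is_derive x 1 (fun y => complex.Re (F y)) (complex.Re (G x)) /\
  is_derive x 1 (fun y => complex.Im (F y)) (complex.Im (G x)).

Lemma is_cderiveM F F' G G' : is_cderive F F' -> is_cderive G G' ->
  is_cderive (fun x => F x * G x) (fun x => F' x * G x + F x * G' x).
Proof.
move=> dF dG x; have [rF iF] := dF x; have [rG iG] := dG x; split.
  under eq_fun do rewrite ReM.
  apply: (is_derive_eq (is_deriveB (is_deriveM rF rG) (is_deriveM iF iG))).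
  rewrite ReD !ReM /GRing.scale /=; ring.
under eq_fun do rewrite ImM.
apply: (is_derive_eq (is_deriveD (is_deriveM rF iG) (is_deriveM iF rG))).
rewrite ImD !ImM /GRing.scale /=; ring.
Qed.

Lemma is_cderive_expi (k : int) :
  is_cderive (expi R k) (fun x => (0 +i* (2 * pi * k%:~R)) * expi R k x).
Proof.
move=> x; split.
  apply: (is_derive_eq (is_derive_cosM _ x)); rewrite ReM /=; ring.
apply: (is_derive_eq (is_derive_sinM _ x)); rewrite ImM /=; ring.
Qed.

Lemma torus_integral_derive F G : is_cderive F G -> ccontinuous G ->
  torus_integral G = F 1 - F 0.
Proof.
move=> dF [rG iG]; rewrite torus_integralE (Rintegral_derive (fun x => proj1 (dF x)) rG).
rewrite (Rintegral_derive (fun x => proj2 (dF x)) iG).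
by case: (F 1) (F 0) => [? ?] [? ?].
Qed.

Lemma expi1 (k : int) : expi R k 1 = 1.
Proof.
have /smooth_periodicP[p _ _] := test_smooth (expi R k).
by have := p 0; rewrite add0r => ->; rewrite expiE mulr0 expc0.
Qed.

Lemma torus_integral_expi (k : int) : torus_integral (expi R k) = (k == 0)%:R.
Proof.
have [->|k0] := eqVneq k 0.
  rewrite (_ : test_fun (expi R 0) = fun=> 1); last by apply/funext => x; exact: expi0.
  rewrite torus_integralE /= !Rintegral_cst//= mul0r lebesgue_measure_itv /= lte_fin ltr01.
  by rewrite oppr0 adde0 mulr1.
have := torus_integral_derive (is_cderive_expi k).
rewrite torus_integralZ; last exact: ccontinuous_expi.
move=> /(_ (ccontinuousM (ccontinuous_cst _) (ccontinuous_expi k))).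
rewrite expi1 expiE mulr0 expc0 subrr => /eqP; rewrite mulf_eq0 => /orP[|/eqP//].
rewrite eq_complex /= eqxx /= !mulf_eq0 intr_eq0 (negbTE k0) orbF.
by rewrite pnatr_eq0 /= gt_eqF// pi_gt0.
Qed.

Lemma ccontinuous_horner (P : {poly R[i]}) : ccontinuous (fun x => P.[expc x]).
Proof.
under eq_fun do rewrite horner_coef; apply: ccontinuous_sum => i.
apply: ccontinuousM; first exact: ccontinuous_cst.
by under eq_fun do rewrite -expi_nat; exact: ccontinuous_expi.
Qed.

Lemma torus_integral_horner (P : {poly R[i]}) (k : nat) :
  torus_integral (fun x => P.[expc x] * expi R (- k%:Z) x) = P`_k.
Proof.
rewrite (_ : (fun x => _) =
    (fun x => \sum_(i < size P) P`_i * expi R (i%:Z - k%:Z) x)); last first.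
  apply/funext => x; rewrite horner_coef mulr_suml; apply: eq_bigr => i _.
  by rewrite expiD -mulrA expi_nat.
rewrite torus_integral_sum; last first.
  by move=> i; apply: ccontinuousM; [exact: ccontinuous_cst|exact: ccontinuous_expi].
under eq_bigr => i _ do rewrite (torus_integralZ _ (ccontinuous_expi _)) torus_integral_expi.
have [kP|kP] := ltnP k (size P); last first.
  rewrite nth_default// big1// => i _; rewrite subr_eq0 eqz_nat.
  by rewrite (ltn_eqF (leq_trans (ltn_ord i) kP)) mulr0.
rewrite (bigD1 (Ordinal kP))//= subrr eqxx mulr1 big1 ?addr0// => i ik.
rewrite subr_eq0 eqz_nat (_ : (i == k :> nat) = false) ?mulr0//.
by apply/negbTE; move: ik; apply: contra => /eqP ik; apply/eqP/val_inj.
Qed.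

(** A coefficient is an integral of P against an exponential.  This transfers
    norm decay of blocks to their Fourier coefficients, and also bounds norms
    from below. *)
Lemma coef_le_Lnorm1 (P : {poly R[i]}) (k : nat) (A : R) : 0 <= A ->
  (Lnorm mu (1%:E^-1) (EFin \o (fun x => normc (P.[expc x]))) <= A%:E)%E ->
  normc P`_k <= 2 * A.
Proof.
move=> A0 h; rewrite -torus_integral_horner; apply: normc_torus_integral_le_Lnorm => //.
  by apply: ccontinuousM; [exact: ccontinuous_horner|exact: ccontinuous_expi].
by under eq_fun do rewrite Normc.normcM normc_expi mulr1.
Qed.

(** * Distance to the nearest integer *)

Lemma half_le_cos_pi4 : (2^-1 : R) <= cos (pi / 4) /\ (2^-1 : R) <= sin (pi / 4).
Proof.
have p0 := pi_gt0 R.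
have c0 : 0 < cos (pi / 4 : R) by apply: cos_gt0_pihalf; apply/andP; split; lra.
have := tan_piquarter R; rewrite /tan => /(canRL (mulfVK _)) -/(_ _).
rewrite mul1r gt_eqF// => /(_ isT) scE.
by have := cos2Dsin2 (pi / 4 : R); rewrite scE => h; split; nra.
Qed.

(** On [0, 1/4] by the mean value theorem, since the derivative pi cos(pi y) is
    at least 1 there; on [1/4, 1/2] because sin increases and is at least 1/2. *)
Lemma jordan_sin (d : R) : 0 <= d <= 2^-1 -> d <= sin (pi * d).
Proof.
move=> /andP[d0 d2]; have p2 := pi_ge2 R; have [hc hs] := half_le_cos_pi4.
have [d4|d4] := ltP d 4^-1; last first.
  suff : sin (pi / 4) <= sin (pi * d) by lra.
  move: d4; rewrite le_eqVlt => /predU1P[<-//|d4].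
  rewrite ltW// ltr_sin ?in_itv /=; first by rewrite ltr_pM2l//; lra.
    by apply/andP; split; lra.
  by apply/andP; split; nra.
move: d0; rewrite le_eqVlt => /predU1P[<-|d0]; first by rewrite mulr0 sin0.
have [|c] := @MVT R (fun x => sin (pi * x)) (fun x => pi * cos (pi * x)) 0 d d0
  (fun x _ => is_derive_sinM pi x).
  by apply: continuous_subspaceT; exact: continuous_sinM.
rewrite in_itv /= mulr0 sin0 !subr0 => /andP[c0 cd] ->.
suff h : 2^-1 <= cos (pi * c) by rewrite ler_peMl ?(ltW d0)//; nra.
apply: (le_trans hc); rewrite ltW// ltr_cos ?in_itv /=.
- by rewrite ltr_pM2l//; lra.
- by apply/andP; split; nra.
- by apply/andP; split; lra.
Qed.

Lemma sin_shift_int (y : R) (k : int) : `|sin (pi * (y - k%:~R))| = `|sin (pi * y)|.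
Proof.
have h (x : R) (n : nat) : `|sin (pi * (x + n%:R))| = `|sin (pi * x)|.
  elim: n => [|n ih]; first by rewrite addr0.
  by rewrite -natr1 addrA mulrDr mulr1 sinDpi normrN.
case: k => n; last by rewrite NegzE mulrNz opprK -pmulrn h.
by rewrite -[in RHS](subrK n%:R y) h -pmulrn.
Qed.

(** Makes |sin (pi y)| a substitute for the distance on the torus, compatible
    with the kernel cos^(2N) and with the modulus of exp(2 i pi y) - 1. *)
Lemma dist_int_le_sin (y : R) : exists k : int, `|y - k%:~R| <= `|sin (pi * y)|.
Proof.
pose k := Num.floor (y + 2^-1); exists k.
have /andP[k1 k2] := floor_itv (y + 2^-1).
rewrite -(sin_shift_int y k).
have : `|y - k%:~R| <= 2^-1.
  by rewrite ler_norml; move: k1 k2; rewrite -/k intrD; lra.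
set d := y - _ => dh.
have [d0|d0] := leP 0 d.
  rewrite ger0_norm//; apply: le_trans (ler_norm _); apply: jordan_sin.
  by rewrite d0 /= -(ger0_norm d0).
rewrite -normrN -[X in _ <= X]normrN -sinN -mulrN.
rewrite [leLHS]ger0_norm; last by rewrite oppr_ge0 ltW.
apply: le_trans (ler_norm _); apply: jordan_sin.
by rewrite oppr_ge0 ltW//= -(ltr0_norm d0).
Qed.

Lemma normc_expc_sub1 (y : R) : normc (expc y - 1) = 2 * `|sin (pi * y)|.
Proof.
rewrite normcE /= subr0.
have -> : 2 * pi * y = (pi * y) *+ 2 by ring.
rewrite cos_mulr2n sin_mulr2n -[2 in RHS](@ger0_norm R)// -normrM -sqrtr_sqr.
congr Num.sqrt; have := cos2Dsin2 (pi * y); move: (cos _) (sin _) => c s cs.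
transitivity (4 * s ^+ 2 * (c ^+ 2 + s ^+ 2)); last by rewrite cs; ring.
have -> : c ^+ 2 *+ 2 - 1 - 1 = - (2 * s ^+ 2) by move: cs; lra.
by ring.
Qed.

(** * The kernel cos^(2N) *)

(** A nonnegative trigonometric polynomial that concentrates at the integers; it
    plays the role of the Fejer kernel, with an explicit second moment. *)
Definition cos_kernel (N : nat) (y : R) : R := cos (pi * y) ^+ (2 * N).
Definition cos_coef (N i : nat) : R := 'C(2 * N, i)%:R / 4 ^+ N.

Lemma cos_sqr_expc (y : R) : 4 * (cos (pi * y) ^+ 2)%:C * expc y = (1 + expc y) ^+ 2.
Proof.
have d : 2 * pi * y = (pi * y) *+ 2 by ring.
have h := cos2Dsin2 (pi * y).
have s2 : sin (pi * y) ^+ 2 = 1 - cos (pi * y) ^+ 2 by rewrite -h; ring.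
rewrite /expc d cos_mulr2n sin_mulr2n; move: s2; set c := cos _; set s := sin _ => s2.
have -> : (4 : R[i]) = (4 : R)%:C by rewrite -(rmorph_nat (real_complex R)).
rewrite expr2; apply: eq_ReIm; rewrite !(ReM, ImM, ReD, ImD) /=; last by ring.
transitivity (4 * c ^+ 4 - 4 * c ^+ 2 * s ^+ 2); last by ring.
by rewrite s2; ring.
Qed.

Lemma cos_kernelE (N : nat) (y : R) : (cos_kernel N y)%:C =
  \sum_(i < (2 * N).+1) (cos_coef N i)%:C * expi R (i%:Z - N%:Z) y.
Proof.
have z0 := expc_neq0 y; have n4 : (4 : R[i]) != 0 by rewrite pnatr_eq0.
apply: (mulIf (expf_neq0 N z0)); apply: (mulfI (expf_neq0 N n4)).
rewrite /cos_kernel exprM rmorphXn mulrA -!exprMn cos_sqr_expc -exprM exprDn.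
rewrite mulr_suml mulr_sumr; apply: eq_bigr => i _.
have e : expi R (i%:Z - N%:Z) y * expc y ^+ N = expc y ^+ i.
  by rewrite -!expi_nat -expiD subrK.
rewrite -[_ * _ * expc y ^+ N]mulrA e mulrA expr1n mul1r -mulr_natl; congr (_ * _).
rewrite /cos_coef rmorphM fmorphV rmorphXn !rmorph_nat mulrC divfK//.
Qed.

Lemma ccontinuous_real (f : R -> R) : continuous f -> ccontinuous (fun x => (f x)%:C).
Proof. by move=> cf; split => //; move=> x; exact: cvg_cst. Qed.

Lemma continuous_cos_kernel N (x : R) : continuous (fun y => cos_kernel N (x - y)).
Proof.
have c1 : continuous (fun y : R => cos (pi * (x - y))).
  move=> y; apply: (@continuous_comp _ _ _ (fun t : R => x - t) (fun t : R => cos (pi * t))).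
    by apply: cvgB; [exact: cvg_cst|exact: cvg_id].
  exact: continuous_cosM.
by move=> y; exact: continuous_comp (c1 y) (@exprn_continuous _ (2 * N) _).
Qed.

Lemma cos_kernel_ge0 N y : 0 <= cos_kernel N y.
Proof. by rewrite /cos_kernel exprM exprn_ge0// sqr_ge0. Qed.

Definition fcoef F (k : int) : R[i] := torus_integral (fun x => F x * expi R (- k) x).

Lemma expi_sub (k : int) x y : expi R k (x - y) = expi R k x * expi R (- k) y.
Proof. by rewrite !expiE mulrDr expcD mulrN mulrNz mulNr. Qed.

Lemma torus_integral_cos_kernel F N x : ccontinuous F ->
  torus_integral (fun y => F y * (cos_kernel N (x - y))%:C) =
  \sum_(i < (2 * N).+1) (cos_coef N i)%:C * fcoef F (i%:Z - N%:Z) *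
     expi R (i%:Z - N%:Z) x.
Proof.
move=> cF; have c1 (k : int) : ccontinuous (fun y => F y * expi R k y).
  by apply: ccontinuousM => //; exact: ccontinuous_expi.
rewrite (_ : (fun y => _) = (fun y => \sum_(i < (2 * N).+1)
    ((cos_coef N i)%:C * expi R (i%:Z - N%:Z) x) *
    (F y * expi R (- (i%:Z - N%:Z)) y))); last first.
  apply/funext => y; rewrite cos_kernelE mulr_sumr; apply: eq_bigr => i _.
  by rewrite expi_sub; ring.
rewrite torus_integral_sum; last first.
  by move=> i; apply: ccontinuousM => //; exact: ccontinuous_cst.
by apply: eq_bigr => i _; rewrite (torus_integralZ _ (c1 _)) /fcoef; ring.
Qed.

(** The integral of the kernel over a period. *)
Definition cos_mass N : R := cos_coef N N.

Lemma cos_mass_gt0 N : 0 < cos_mass N.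
Proof.
rewrite /cos_mass /cos_coef divr_gt0 ?exprn_gt0// ltr0n bin_gt0.
by rewrite mul2n -addnn leq_addr.
Qed.

Lemma integral_cos_kernel N x :
  \int[lebesgue_measure]_(y in `[0, 1]) cos_kernel N (x - y) = cos_mass N.
Proof.
have := torus_integral_cos_kernel N x (ccontinuous_cst 1).
under [in X in X = _ -> _]eq_fun do rewrite mul1r.
have vN : @inord (2 * N) N = N :> nat by rewrite inordK// ltnS mul2n -addnn leq_addr.
rewrite (bigD1 (inord N))// vN.
have f1 (k : int) : fcoef (fun=> 1) k = (k == 0)%:R.
  rewrite /fcoef; under eq_fun do rewrite mul1r.
  by rewrite torus_integral_expi oppr_eq0.
rewrite big1 ?addr0; last first.
  move=> i /eqP iN; rewrite f1 subr_eq0 eqz_nat; case: eqP => [iN'|]; last by rewrite mulr0 mul0r.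
  by case: iN; apply/val_inj; rewrite /= vN.
rewrite f1 subrr eqxx mulr1 expi0 mulr1 => /(congr1 (@complex.Re R)).
by rewrite [RHS]/= addr0.
Qed.

(** Ratio of consecutive central binomial coefficients. *)
Lemma cos_massS N : cos_mass N - cos_mass N.+1 = cos_mass N / (2 * N.+1%:R).
Proof.
rewrite /cos_mass /cos_coef.
have h : ('C(2 * N.+1, N.+1) * (N.+1 * N.+1) = 'C(2 * N, N) * ((2 * N).+2 * (2 * N).+1))%N.
  have e : (2 * N.+1 = (2 * N).+2)%N by rewrite mulnS.
  have := @bin_fact (2 * N.+1) N.+1; have := @bin_fact (2 * N) N.
  have -> : (2 * N.+1 - N.+1 = N.+1)%N by lia.
  have -> : (2 * N - N = N)%N by lia.
  move=> /(_ ltac:(lia)) h1 /(_ ltac:(lia)); rewrite e !factS -h1.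
  have f0 := fact_gt0 N; move: (_`!)%N f0 => f f0 h2.
  apply/eqP; rewrite -(@eqn_pmul2r (f * f)) ?muln_gt0 ?f0//; apply/eqP.
  move: h2; lia.
have hR : ('C(2 * N.+1, N.+1)%:R : R) = 'C(2 * N, N)%:R * (2 * (2 * N%:R + 1)) / N.+1%:R.
  apply: (mulIf (_ : N.+1%:R * N.+1%:R != 0 :> R)).
    by rewrite mulf_neq0// pnatr_eq0.
  rewrite -!natrM h !natrM.
  have -> : ((2 * N).+2%:R : R) = 2 * N.+1%:R by rewrite -natrM; congr _%:R; lia.
  have -> : ((2 * N).+1%:R : R) = 2 * N%:R + 1 by rewrite -natrM natr1.
  by field; rewrite addrC natr1 pnatr_eq0.
rewrite hR exprS -natr1; field.
by rewrite nat1r pnatr_eq0 expf_neq0 // natr1 pnatr_eq0.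
Qed.

(** sin^2 cos^(2N) = cos^(2N) - cos^(2N+2), so the second moment is a difference
    of consecutive masses.  It is smaller than the mass by a factor of order N,
    which is all the concentration that is needed. *)
Lemma integral_sin_cos_kernel N x :
  \int[lebesgue_measure]_(y in `[0, 1]) (sin (pi * (x - y)) ^+ 2 * cos_kernel N (x - y)) =
  cos_mass N / (2 * N.+1%:R).
Proof.
rewrite -cos_massS -!(integral_cos_kernel _ x) -RintegralB//; last 2 first.
- by apply: continuous_integrable01; exact: continuous_cos_kernel.
- by apply: continuous_integrable01; exact: continuous_cos_kernel.
apply: eq_Rintegral => y _; rewrite /cos_kernel mulnS exprD.
by have := cos2Dsin2 (pi * (x - y)) => /(canRL (addKr _)) ->; ring.
Qed.

(** The weight |sin| is bounded by (eta + sin^2 / eta) / 2 before integrating, so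
    that only the mass and the second moment of the kernel are needed. *)
Lemma cos_kernel_approx F (L eta : R) N x : ccontinuous F -> 0 <= L -> 0 < eta ->
  (forall y, normc (F y - F x) <= L * `|sin (pi * (y - x))|) ->
  normc (((cos_mass N)^-1)%:C * torus_integral (fun y => F y * (cos_kernel N (x - y))%:C) - F x)
  <= L * (eta + (2 * eta * N.+1%:R)^-1).
Proof.
move=> cF L0 e0 FL; have m0 := cos_mass_gt0 N.
have cK : ccontinuous (fun y => (cos_kernel N (x - y))%:C).
  by apply: ccontinuous_real; exact: continuous_cos_kernel.
have cFK : ccontinuous (fun y => (F y - F x) * (cos_kernel N (x - y))%:C).
  by apply: ccontinuousM => //; apply: ccontinuousD => //; exact: ccontinuous_cst.
have -> : ((cos_mass N)^-1)%:C * torus_integral (fun y => F y * (cos_kernel N (x - y))%:C) - F x =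
   ((cos_mass N)^-1)%:C * torus_integral (fun y => (F y - F x) * (cos_kernel N (x - y))%:C).
  have e1 : torus_integral (fun y => F x * (cos_kernel N (x - y))%:C) = F x * (cos_mass N)%:C.
    rewrite torus_integralZ//; congr (_ * _); apply: eq_ReIm; rewrite /= ?integral_cos_kernel//.
    by rewrite Rintegral_cst//= mul0r.
  rewrite -[F x in LHS]mul1r -[in X in X * F x](_ : ((cos_mass N)^-1)%:C * (cos_mass N)%:C = 1); last first.
    by rewrite -rmorphM mulVf ?gt_eqF.
  rewrite -mulrA -mulrBr [_ * F x]mulrC -e1; congr (_ * _).
  rewrite -[in LHS]mulN1r -torus_integralZ; last by apply: ccontinuousM => //; exact: ccontinuous_cst.
  rewrite -torus_integralD; last 2 first.
  - exact: ccontinuousM.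
  - by do 2 (apply: ccontinuousM; [exact: ccontinuous_cst|]).
  by congr torus_integral; apply/funext => y; ring.
rewrite Normc.normcM normc_real ger0_norm; last by rewrite invr_ge0 ltW.
rewrite [leLHS]mulrC ler_pdivrMr//.
apply: le_trans (normc_torus_integral_le cFK) _.
pose g y := L / 2 * (eta * cos_kernel N (x - y) +
  eta^-1 * (sin (pi * (x - y)) ^+ 2 * cos_kernel N (x - y))).
have cs : continuous (fun y => sin (pi * (x - y)) ^+ 2 * cos_kernel N (x - y)).
  move=> y; apply: cvgM; last exact: continuous_cos_kernel.
  have c1 : continuous (fun y : R => sin (pi * (x - y))).
    move=> z; apply: (@continuous_comp _ _ _ (fun t : R => x - t) (fun t : R => sin (pi * t))).
      by apply: cvgB; [exact: cvg_cst|exact: cvg_id].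
    exact: continuous_sinM.
  by apply: cvgM; exact: c1.
have cZ (c : R) (f : R -> R) : continuous f -> continuous (fun y => c * f y).
  by move=> cf y; apply: cvgM; [exact: cvg_cst|exact: cf].
have cg1 : continuous (fun y => eta * cos_kernel N (x - y)).
  by apply: cZ; exact: continuous_cos_kernel.
have cg2 := cZ eta^-1 _ cs.
have cg : continuous g.
  by apply: cZ => y; apply: cvgD; [exact: cg1|exact: cg2].
have ig : \int[lebesgue_measure]_(y in `[0, 1]) g y =
    L / 2 * (eta * cos_mass N + eta^-1 * (cos_mass N / (2 * N.+1%:R))).
  rewrite /g RintegralZl//; last first.
    by apply: continuous_integrable01 => y; apply: cvgD; [exact: cg1|exact: cg2].
  rewrite RintegralD//; [|exact: continuous_integrable01..].
  rewrite !RintegralZl//; [|exact: continuous_integrable01|].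
    by rewrite integral_cos_kernel integral_sin_cos_kernel.
  by apply: continuous_integrable01; exact: continuous_cos_kernel.
apply: (@le_trans _ _ (2 * \int[lebesgue_measure]_(y in `[0, 1]) g y)).
  rewrite ler_wpM2l//; apply: le_Rintegral => //.
  - by apply: continuous_integrable01; exact: continuous_normc.
  - exact: continuous_integrable01.
  - move=> y _; rewrite Normc.normcM normc_real ger0_norm ?cos_kernel_ge0//.
    have -> : g y = L / 2 * (eta + eta^-1 * sin (pi * (x - y)) ^+ 2) * cos_kernel N (x - y).
      by rewrite /g; ring.
    apply: ler_wpM2r; first exact: cos_kernel_ge0.
    apply: (le_trans (FL y)); rewrite -mulrA; apply: ler_wpM2l => //.
    rewrite -opprB mulrN sinN normrN -[sin _ ^+ 2]real_normK ?num_real//.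
    set s := `|_|; rewrite ler_pdivlMl// -subr_ge0.
    have -> : eta + eta^-1 * s ^+ 2 - 2 * s = eta^-1 * (eta - s) ^+ 2.
      by field; rewrite gt_eqF.
    by rewrite mulr_ge0 ?sqr_ge0// invr_ge0 ltW.
rewrite ig.
have -> : 2 * (L / 2 * (eta * cos_mass N + eta^-1 * (cos_mass N / (2 * N.+1%:R)))) =
  L * (eta + (2 * eta * N.+1%:R)^-1) * cos_mass N.
  by field; rewrite ?pnatr_eq0 ?gt_eqF.
done.
Qed.

(** * Derivatives of test functions *)

Implicit Types g h : torus_test R.

Lemma is_derive_derive1n (f : R -> R) n (x : R) : smooth f ->
  is_derive x 1 (derive1n n f) (derive1n n.+1 f x).
Proof.
by move=> sf; rewrite derive1nS derive1E; apply: derivableP; exact: sf.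
Qed.

Lemma is_cderive_cderive1n g m : is_cderive (cderive1n m g) (cderive1n m.+1 g).
Proof.
have /smooth_periodicP[_ rg ig] := test_smooth g.
by move=> x; split; [exact: (is_derive_derive1n m x rg)|exact: (is_derive_derive1n m x ig)].
Qed.

Lemma periodic_derive1n (f : R -> R) n : smooth f -> periodic f 1 ->
  periodic (derive1n n f) 1.
Proof.
move=> sf pf; elim: n => [//|n ih] x.
have d1 := is_derive_derive1n n (x + 1) sf.
have d2 := is_derive_derive1n n x sf.
have d3 : is_derive x 1 (fun y => derive1n n f (y + 1)) (derive1n n.+1 f (x + 1)).
  have ds : is_derive x 1 (fun y : R => y + 1) 1.
    exact: is_derive_shift.
  have := @is_derive1_comp R (derive1n n f) (fun y => y + 1) x _ _ d1 ds.
  by rewrite mulr1.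
have e : (fun y => derive1n n f (y + 1)) = derive1n n f by apply/funext => y; rewrite ih.
rewrite e in d3.
by have [_ <-] := d3; have [_ <-] := d2.
Qed.

Lemma cderive1n_periodic g m x : cderive1n m g (x + 1) = cderive1n m g x.
Proof.
have /smooth_periodicP[pg rg ig] := test_smooth g.
rewrite /cderive1n; congr (_ +i* _); apply: periodic_derive1n => //.
  by move=> y; rewrite /= pg.
by move=> y; rewrite /= pg.
Qed.

Lemma ccontinuous_cderive1n g m : ccontinuous (cderive1n m g).
Proof.
split; apply: is_derive_continuous => x;
  by have [] := is_cderive_cderive1n g m x.
Qed.

Lemma cderive1n0 g : cderive1n 0 g = g.
Proof. by apply/funext => x; rewrite /cderive1n /=; case: (g x). Qed.

Lemma ccontinuous_test g : ccontinuous g.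
Proof. by rewrite -cderive1n0; exact: ccontinuous_cderive1n. Qed.

(** Moves a point to the fundamental interval. *)
Lemma periodic_int (T : Type) (G : R -> T) : (forall x, G (x + 1) = G x) ->
  forall (k : int) x, G (x - k%:~R) = G x.
Proof.
move=> pG; have h (n : nat) x : G (x + n%:R) = G x.
  by elim: n => [|n ih]; rewrite ?addr0// -natr1 addrA pG ih.
case=> n x; last by rewrite NegzE mulrNz opprK -pmulrn h.
by rewrite -(h n (x - _)) -pmulrn subrK.
Qed.

Lemma cderive1n_bounded g m : exists2 M : R, 0 <= M &
  forall x, normc (cderive1n m g x) <= M.
Proof.
have cG := continuous_normc (ccontinuous_cderive1n g m).
have [||c _ hc] := @EVT_max R (fun x => normc (cderive1n m g x)) 0 1 => //.
  exact: continuous_subspaceT.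
exists (normc (cderive1n m g c)); first exact: normc_ge0.
move=> x; rewrite -(periodic_int (cderive1n_periodic g m) (Num.floor x)).
apply: hc; rewrite in_itv /=; have /andP[k1 k2] := floor_itv x.
by move: k2; rewrite intrD => k2; apply/andP; split; lra.
Qed.

Lemma mvt_lipschitz (f df : R -> R) (M : R) : (forall x : R, is_derive x 1 f (df x)) ->
  (forall x, `|df x| <= M) -> forall x y, `|f y - f x| <= M * `|y - x|.
Proof.
move=> dfP dM; have cf := is_derive_continuous dfP.
have key x y : x < y -> `|f y - f x| <= M * `|y - x|.
  move=> xy; have [c _ ->] := @MVT R f df x y xy (fun z _ => dfP z) (continuous_subspaceT cf).
  by rewrite normrM ler_wpM2r.
move=> x y; have [xy|xy|->] := ltgtP x y; first exact: key.
  by rewrite distrC [`|y - x|]distrC; exact: key.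
by rewrite !subrr normr0 mulr0.
Qed.

(** The mean value theorem after translating y by the integer closest to y - x. *)
Lemma cderive1n_lipschitz_sin g m : exists2 L : R, 0 <= L &
  forall x y, normc (cderive1n m g y - cderive1n m g x) <= L * `|sin (pi * (y - x))|.
Proof.
have [M M0 hM] := cderive1n_bounded g m.+1; exists (2 * M); first by rewrite mulr_ge0.
move=> x y; have [k hk] := dist_int_le_sin (y - x).
rewrite -(periodic_int (cderive1n_periodic g m) k y).
apply: (@le_trans _ _ (2 * M * `|y - x - k%:~R|)); last by rewrite ler_wpM2l// mulr_ge0.
rewrite (_ : y - x - k%:~R = y - k%:~R - x); last by ring.
apply: (le_trans (normc_le_ReIm _)).
rewrite ReB ImB.
rewrite -mulrA mulr_natl mulr2n; apply: lerD.
  apply: (@mvt_lipschitz (fun x => complex.Re (cderive1n m g x)) (fun x => complex.Re (cderive1n m.+1 g x))).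
    by move=> z; have [] := is_cderive_cderive1n g m z.
  by move=> z; apply: le_trans (Re_le_normc _) (hM z).
apply: (@mvt_lipschitz (fun x => complex.Im (cderive1n m g x)) (fun x => complex.Im (cderive1n m.+1 g x))).
  by move=> z; have [] := is_cderive_cderive1n g m z.
by move=> z; apply: le_trans (Im_le_normc _) (hM z).
Qed.

(** The multiplier of differentiation on the exponential of frequency k. *)
Definition two_pi_i (k : int) : R[i] := 0 +i* (2 * pi * k%:~R).

(** Integration by parts; the boundary terms cancel by periodicity. *)
Lemma fcoef_cderive1n g m k :
  fcoef (cderive1n m g) k = two_pi_i k ^+ m * fcoef g k.
Proof.
elim: m => [|m ih]; first by rewrite expr0 mul1r cderive1n0.
rewrite exprS -mulrA -ih.
have dP := is_cderiveM (is_cderive_cderive1n g m) (is_cderive_expi (- k)).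
have c1 := ccontinuousM (ccontinuous_cderive1n g m.+1) (ccontinuous_expi (- k)).
have c2 := ccontinuousM (ccontinuous_cderive1n g m) (ccontinuous_expi (- k)).
have c3 : ccontinuous (fun x => cderive1n m g x * (two_pi_i (- k) * expi R (- k) x)).
  by apply: ccontinuousM; [exact: ccontinuous_cderive1n|apply: ccontinuousM;
    [exact: ccontinuous_cst|exact: ccontinuous_expi]].
have := torus_integral_derive dP (ccontinuousD c1 c3).
have pg := cderive1n_periodic g m 0; rewrite add0r in pg.
rewrite expi1 expiE mulr0 expc0 pg subrr torus_integralD//.
have -> : torus_integral (fun x => cderive1n m g x * (two_pi_i (- k) * expi R (- k) x)) =
   torus_integral (fun x => two_pi_i (- k) * (cderive1n m g x * expi R (- k) x)).
  by congr torus_integral; apply/funext => x; ring.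
rewrite torus_integralZ// => /eqP; rewrite addr_eq0 /fcoef => /eqP ->.
have -> : two_pi_i (- k) = - two_pi_i k.
  by apply: eq_ReIm; rewrite /= ?oppr0// mulrNz mulrN.
by rewrite mulNr opprK.
Qed.

Lemma cderive1n_expi (k : int) m x : cderive1n m (expi R k) x = two_pi_i k ^+ m * expi R k x.
Proof.
elim: m x => [|m ih] x; first by rewrite expr0 mul1r cderive1n0.
have [r1 i1] := is_cderive_cderive1n (expi R k) m x.
have e : cderive1n m (expi R k) = (fun x => two_pi_i k ^+ m * expi R k x) by apply/funext.
have [r2 i2] : is_derive x 1 (fun y => complex.Re (cderive1n m (expi R k) y)) (complex.Re (two_pi_i k ^+ m.+1 * expi R k x)) /\
   is_derive x 1 (fun y => complex.Im (cderive1n m (expi R k) y)) (complex.Im (two_pi_i k ^+ m.+1 * expi R k x)).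
  have h0 : is_cderive (fun=> two_pi_i k ^+ m) (fun=> 0) by move=> z; split; exact: is_derive_cst.
  have := is_cderiveM h0 (is_cderive_expi k) x.
  by rewrite e mul0r add0r mulrA -exprSr.
apply: eq_ReIm.
  by move: r1 r2 => [_ <-] [_ <-].
by move: i1 i2 => [_ <-] [_ <-].
Qed.

Lemma cderive1n_lin (a : R[i]) g h m x :
  cderive1n m (a *: g + h) x = a * cderive1n m g x + cderive1n m h x.
Proof.
have /smooth_periodicP[_ rg ig] := test_smooth g.
have /smooth_periodicP[_ rh ih] := test_smooth h.
have e (z : R) : (a *: g + h : torus_test R) z = a * g z + h z by [].
rewrite /cderive1n.
have -> : (fun y => complex.Re ((a *: g + h : torus_test R) y)) = (fun x =>
      1 * (complex.Re a * complex.Re (g x) + (- complex.Im a) * complex.Im (g x))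
      + 1 * complex.Re (h x)).
  by apply/funext => y; rewrite e ReD ReM !mul1r mulNr.
have -> : (fun y => complex.Im ((a *: g + h : torus_test R) y)) = (fun x =>
      1 * (complex.Re a * complex.Im (g x) + complex.Im a * complex.Re (g x))
      + 1 * complex.Im (h x)).
  by apply/funext => y; rewrite e ImD ImM !mul1r.
rewrite (@derive1n_lin R _ _ _ _ m (@smooth_lin R _ _ (complex.Re a) (- complex.Im a) rg ig) rh).
rewrite (@derive1n_lin R _ _ _ _ m (@smooth_lin R _ _ (complex.Re a) (complex.Im a) ig rg) ih).
rewrite (@derive1n_lin R _ _ _ _ m rg ig) (@derive1n_lin R _ _ _ _ m ig rg).
by apply: eq_ReIm; rewrite ?ReD ?ImD ?ReM ?ImM /=; ring.
Qed.

Lemma cderive1n0f m x : cderive1n m (0 : torus_test R) x = 0.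
Proof.
have := cderive1n_lin (-1) 0 0 m x; rewrite scaler0 addr0 mulN1r addNr.
by [].
Qed.

Lemma cderive1nB g h m x : cderive1n m (g - h) x = cderive1n m g x - cderive1n m h x.
Proof. by rewrite addrC -scaleN1r cderive1n_lin mulN1r addrC. Qed.

Lemma cderive1n_sum (I : Type) (r : seq I) (c : I -> R[i]) (E : I -> torus_test R) m x :
  cderive1n m (\sum_(i <- r) c i *: E i) x = \sum_(i <- r) c i * cderive1n m (E i) x.
Proof.
elim: r => [|i r ih]; first by rewrite !big_nil cderive1n0f.
by rewrite !big_cons cderive1n_lin ih.
Qed.

(** * Density of trigonometric polynomials *)

(** The normalized convolution of h with the kernel, written as a trigonometric
    polynomial so that a functional vanishing on exponentials vanishes on it. *)
Definition cos_mean N h : torus_test R :=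
  \sum_(i < (2 * N).+1)
    ((cos_mass N)^-1)%:C * ((cos_coef N i)%:C * fcoef h (i%:Z - N%:Z)) *: expi R (i%:Z - N%:Z).

Lemma cderive1n_cos_mean N h m x : cderive1n m (cos_mean N h) x =
  ((cos_mass N)^-1)%:C * torus_integral (fun y => cderive1n m h y * (cos_kernel N (x - y))%:C).
Proof.
rewrite torus_integral_cos_kernel; last exact: ccontinuous_cderive1n.
rewrite /cos_mean cderive1n_sum mulr_sumr; apply: eq_bigr => i _.
by rewrite fcoef_cderive1n cderive1n_expi; ring.
Qed.

Lemma cos_mean_cvg h (n : nat) (d : R) : 0 < d ->
  exists N, forall m x, (m <= n)%N -> normc (cderive1n m (cos_mean N h - h) x) <= d.
Proof.
move=> d0.
have [L L0 hL] : exists2 L : R, 0 < L & forall m, (m <= n)%N ->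
    forall x y, normc (cderive1n m h y - cderive1n m h x) <= L * `|sin (pi * (y - x))|.
  elim: n => [|n [L L0 hL]].
    have [L L0 hL] := cderive1n_lipschitz_sin h 0; exists (L + 1); first by rewrite ltr_wpDl.
    move=> m; rewrite leqn0 => /eqP -> x y; apply: le_trans (hL _ _) _.
    by rewrite ler_wpM2r// lerDl.
  have [L' L'0 hL'] := cderive1n_lipschitz_sin h n.+1; exists (L + L').
    by rewrite ltr_pwDl.
  move=> m; rewrite leq_eqVlt => /predU1P[-> x y|].
    by apply: le_trans (hL' _ _) _; rewrite ler_wpM2r// lerDr ltW.
  by rewrite ltnS => mn x y; apply: le_trans (hL m mn _ _) _; rewrite ler_wpM2r// lerDl.
(* eta and N make both terms of the kernel estimate at most d / 2 *)
pose eta := d / (2 * L); have e0 : 0 < eta by rewrite divr_gt0// mulr_gt0.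
pose N := Num.truncn (L / (d * eta)); exists N => m x mn.
rewrite cderive1nB cderive1n_cos_mean.
apply: le_trans (cos_kernel_approx N (ccontinuous_cderive1n h m) (ltW L0) e0 (hL m mn x)) _.
have hN : L / (d * eta) < N.+1%:R by exact: truncnS_gt.
have h1 : L * eta = d / 2 by rewrite /eta; field; rewrite gt_eqF.
have h2 : L * (2 * eta * N.+1%:R)^-1 <= d / 2.
  rewrite ler_pdivrMr; last by apply: mulr_gt0 => //; exact: mulr_gt0.
  move: hN; rewrite ltr_pdivrMr; last exact: mulr_gt0.
  move=> hN.
  by rewrite (_ : d / 2 * _ = N.+1%:R * (d * eta)) ?ltW//; field.
rewrite mulrDr h1 [leRHS](_ : d = d / 2 + d / 2); last by field.
by rewrite lerD2l.
Qed.

(** Trigonometric polynomials are dense, so a continuous functional is determined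
    by its Fourier coefficients. *)
Lemma frechet_continuous_ext0 (D : torus_test R -> R[i]) : linear D ->
  frechet_continuous D -> (forall k, D (expi R k) = 0) -> forall h, D h = 0.
Proof.
move=> lD cD D0 h.
have Dsum (I : Type) (r : seq I) (c : I -> R[i]) (E : I -> int) :
    D (\sum_(i <- r) c i *: expi R (E i)) = 0.
  elim: r => [|i r ih].
    rewrite big_nil; have := lD (-1) 0 0; rewrite scaler0 addr0 => ->.
    by rewrite scaleN1r addNr.
  by rewrite big_cons lD D0 ih scaler0 addr0.
apply: Normc.eq0_normc; apply/eqP; rewrite eq_le normc_ge0 andbT.
apply/ler_addgt0Pr => e e0; rewrite add0r.
have [n [d d0 hd]] := cD h e e0.
have [N hN] := cos_mean_cvg h n d0.
have := hd _ hN; rewrite /cos_mean Dsum sub0r normc_opp => /ltW.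
by [].
Qed.

(** * Fourier series with decaying coefficients *)

Implicit Types c : int -> R[i].

Definition fourier_partial c N (x : R) : R[i] :=
  \sum_(n < N) (c (Posz n) * expi R (Posz n) x + c (Negz n) * expi R (Negz n) x).

(** The two halves of the series are summed symmetrically; [lim] is applied to
    real sequences. *)
Definition fourier_sum c (x : R) : R[i] :=
  (lim (complex.Re (fourier_partial c N x) @[N --> \oo])) +i*
  (lim (complex.Im (fourier_partial c N x) @[N --> \oo])).

(** Quadratic decay, the simplest condition under which partial sums converge
    uniformly, with error O(1/N) by comparison with a telescoping sum. *)
Definition sq_decay c (C : R) : Prop :=
  forall k : int, normc (c k) * (`|k|%N.+1%:R) ^+ 2 <= C.

Lemma sum_telescope (a : nat -> R) N M : (N <= M)%N ->
  \sum_(N <= n < M) (a n - a n.+1) = a N - a M.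
Proof. by move=> NM; rewrite -opprB -telescope_sumr// -sumrN; apply: eq_bigr => i _; rewrite opprB. Qed.

Lemma fourier_partial_tail c C x N M : sq_decay c C -> (N <= M)%N ->
  normc (fourier_partial c M x - fourier_partial c N x) <= 3 * C * (N.+1%:R^-1 - M.+1%:R^-1).
Proof.
move=> hC NM; rewrite /fourier_partial -!(big_mkord xpredT
  (fun n : nat => c (Posz n) * expi R (Posz n) x + c (Negz n) * expi R (Negz n) x)).
rewrite (big_cat_nat (n := N))//= [X in normc (X - _)]addrC addrK.
apply: (le_trans (normc_sum _ _ _)).
rewrite -(@sum_telescope (fun n => n.+1%:R^-1))// mulr_sumr.
apply: ler_sum_nat => n _.
apply: (le_trans (normc_triangle _ _)); rewrite !Normc.normcM !normc_expi !mulr1.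
have n1 : 0 < n.+1%:R :> R by rewrite ltr0n.
have h1 := hC (Posz n); have h2 := hC (Negz n).
have n0 : 0 <= n%:R :> R by rewrite ler0n.
have C0 : 0 <= C by apply: le_trans h1; rewrite mulr_ge0 ?normc_ge0// sqr_ge0.
have -> : (n.+1%:R^-1 - n.+2%:R^-1 : R) = (n.+1%:R * n.+2%:R)^-1.
  by rewrite -![_.+1%:R]natr1; field; apply/andP; split; rewrite ?natr1 ?pnatr_eq0//;
    rewrite gt_eqF//; lra.
rewrite ler_pdivlMr ?mulr_gt0// ?ltr0n//.
move: h1 h2; rewrite absz_nat (_ : `|Negz n|%N = n.+1)//.
have p1 := normc_ge0 (c (Posz n)); have p2 := normc_ge0 (c (Negz n)).
rewrite -![_.+1%:R]natr1; move: p1 p2; set a := normc _; set b := normc _ => p1 p2 h1 h2.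
set m : R := n%:R + 1; rewrite -/m in h1 h2; have m1 : 1 <= m by rewrite /m; lra.
rewrite mulrDl.
have ha : a * (m * (m + 1)) <= 2 * C.
  apply: (@le_trans _ _ (2 * (a * m ^+ 2))); last by rewrite ler_wpM2l.
  have : a * (m * (m + 1)) <= a * (2 * m ^+ 2) by rewrite ler_wpM2l//; nra.
  by rewrite [a * (2 * _)]mulrCA.
have hb : b * (m * (m + 1)) <= C.
  by apply: le_trans h2; rewrite ler_wpM2l//; nra.
by lra.
Qed.

Lemma cauchy_lim (s : nat -> R) (A : R) : 0 <= A ->
  (forall N M, (N <= M)%N -> `|s M - s N| <= A * N.+1%:R^-1) ->
  forall N, `|lim (s n @[n --> \oo]) - s N| <= A * N.+1%:R^-1.
Proof.
move=> A0 hs.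
have cs : cvgn s.
  apply: cauchy_cvg; apply: cauchy_exP => e e0.
  pose N := Num.truncn (A / e); exists (s N); exists N => // M /= NM.
  rewrite -ball_normE /= distrC; apply: le_lt_trans (hs N M NM) _.
  rewrite ltr_pdivrMr ?ltr0n// mulrC -ltr_pdivrMr//; exact: truncnS_gt.
move=> N; have h : `|s M - s N| @[M --> \oo] --> `|limn s - s N|.
  by apply: cvg_norm; apply: cvgB => //; exact: cvg_cst.
rewrite -(cvg_lim (@Rhausdorff R) h); apply: limr_le; first by apply/cvg_ex; eexists; exact: h.
by exists N => // M /= NM; exact: hs.
Qed.

Lemma sq_decay_ge0 c C : sq_decay c C -> 0 <= C.
Proof.
by move=> /(_ 0); apply: le_trans; rewrite mulr_ge0 ?normc_ge0// sqr_ge0.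
Qed.

Lemma fourier_sum_approx c C x N : sq_decay c C ->
  normc (fourier_sum c x - fourier_partial c N x) <= 6 * C * N.+1%:R^-1.
Proof.
move=> hC; have C0 := sq_decay_ge0 hC.
have A0 : 0 <= 3 * C by rewrite mulr_ge0.
have h N' M : (N' <= M)%N -> normc (fourier_partial c M x - fourier_partial c N' x) <= 3 * C * N'.+1%:R^-1.
  move=> NM; apply: le_trans (fourier_partial_tail x hC NM) _.
  by rewrite ler_wpM2l// gerBl invr_ge0.
apply: (le_trans (normc_le_ReIm _)); rewrite ReB ImB.
rewrite (_ : 6 * C = 3 * C + 3 * C); last by ring.
rewrite mulrDl; apply: lerD.
  apply: (@cauchy_lim (fun n => complex.Re (fourier_partial c n x))) => // N' M NM.
  by rewrite -ReB; apply: le_trans (Re_le_normc _) (h _ _ NM).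
apply: (@cauchy_lim (fun n => complex.Im (fourier_partial c n x))) => // N' M NM.
by rewrite -ImB; apply: le_trans (Im_le_normc _) (h _ _ NM).
Qed.

Lemma small_tail (A e : R) : 0 < e -> exists N, A * N.+1%:R^-1 < e.
Proof.
move=> e0; exists (Num.truncn (A / e)).
by rewrite ltr_pdivrMr ?ltr0n// mulrC -ltr_pdivrMr//; exact: truncnS_gt.
Qed.

Lemma ccontinuous_fourier_partial c N : ccontinuous (fourier_partial c N).
Proof.
by apply: ccontinuous_sum => n; apply: ccontinuousD; apply: ccontinuousM;
  by [exact: ccontinuous_cst|exact: ccontinuous_expi].
Qed.

Lemma continuous_unif (f : R -> R) (s : nat -> R -> R) (A : R) :
  (forall N, continuous (s N)) -> (forall N x, `|f x - s N x| <= A * N.+1%:R^-1) ->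
  continuous f.
Proof.
move=> cs fs x; apply/cvgrPdist_lt => e e0.
have [N hN] := small_tail A (divr_gt0 e0 (ltr0n R 3)).
have := cs N x => /cvgrPdist_lt /(_ (e / 3) (divr_gt0 e0 (ltr0n R 3))).
apply: filterS => t ht.
rewrite (_ : f x - f t = (f x - s N x) + (s N x - s N t) - (f t - s N t)); last by ring.
apply: le_lt_trans (ler_normB _ _) _.
apply: le_lt_trans (lerD (ler_normD _ _) (lexx _)) _.
have h1 := le_lt_trans (fs N x) hN; have h2 := le_lt_trans (fs N t) hN.
rewrite (_ : e = e / 3 + e / 3 + e / 3); last by field.
by rewrite !ltrD.
Qed.

Lemma ccontinuous_fourier_sum c C : sq_decay c C -> ccontinuous (fourier_sum c).
Proof.
move=> hC; split.
  apply: (@continuous_unif _ (fun N x => complex.Re (fourier_partial c N x)) (6 * C)).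
    by move=> N; have [] := ccontinuous_fourier_partial c N.
  by move=> N x; rewrite -ReB; apply: le_trans (Re_le_normc _) (fourier_sum_approx _ _ hC).
apply: (@continuous_unif _ (fun N x => complex.Im (fourier_partial c N x)) (6 * C)).
  by move=> N; have [] := ccontinuous_fourier_partial c N.
by move=> N x; rewrite -ImB; apply: le_trans (Im_le_normc _) (fourier_sum_approx _ _ hC).
Qed.

Lemma fcoef_expi (j k : int) : fcoef (expi R j) k = (j == k)%:R.
Proof.
rewrite /fcoef; under eq_fun do rewrite -expiD.
by rewrite torus_integral_expi subr_eq0.
Qed.

Lemma fcoef_lin (a : R[i]) F G k : ccontinuous F -> ccontinuous G ->
  fcoef (fun x => a * F x + G x) k = a * fcoef F k + fcoef G k.
Proof.
move=> cF cG; rewrite /fcoef.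
have cFe := ccontinuousM cF (ccontinuous_expi (- k)).
have cGe := ccontinuousM cG (ccontinuous_expi (- k)).
rewrite -torus_integralZ// -torus_integralD//; last by apply: ccontinuousM => //; exact: ccontinuous_cst.
by congr torus_integral; apply/funext => x; ring.
Qed.

Lemma fcoef_fourier_partial c N k : (`|k|%N < N)%N -> fcoef (fourier_partial c N) k = c k.
Proof.
move=> kN.
have step M : fcoef (fourier_partial c M.+1) k = c (Posz M) * (Posz M == k)%:R +
    c (Negz M) * (Negz M == k)%:R + fcoef (fourier_partial c M) k.
  have -> : fourier_partial c M.+1 = (fun x => c (Posz M) * expi R (Posz M) x +
      (c (Negz M) * expi R (Negz M) x + fourier_partial c M x)).
    by apply/funext => x; rewrite /fourier_partial big_ord_recr /= addrC addrA.
  have c1 : ccontinuous (fun x => c (Negz M) * expi R (Negz M) x + fourier_partial c M x).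
    apply: ccontinuousD; last exact: ccontinuous_fourier_partial.
    by apply: ccontinuousM; [exact: ccontinuous_cst|exact: ccontinuous_expi].
  rewrite fcoef_lin//; last exact: ccontinuous_expi.
  rewrite fcoef_lin//; [|exact: ccontinuous_expi|exact: ccontinuous_fourier_partial].
  by rewrite !fcoef_expi addrA.
have z M : (forall n, (n < M)%N -> Posz n != k /\ Negz n != k) -> fcoef (fourier_partial c M) k = 0.
  elim: M => [|M ih] h.
    rewrite /fcoef; have -> : (fun x => fourier_partial c 0 x * expi R (- k) x) = (fun=> 0).
      by apply/funext => x; rewrite /fourier_partial big_ord0 mul0r.
    by rewrite torus_integralE /= !Rintegral_cst//= !mul0r.
  have [h1 h2] := h M (ltnSn M).
  rewrite step (negbTE h1) (negbTE h2) !mulr0 !add0r ih// => n nM.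
  by apply: h; rewrite ltnS ltnW.
elim: N kN => [//|N ih]; rewrite ltnS leq_eqVlt => /predU1P[kN|kN]; last first.
  rewrite step ih//; case: k kN {z step ih} => k /= kN.
    rewrite eqz_nat (gtn_eqF kN) mulr0 add0r.
    by rewrite mulr0 add0r.
  rewrite mulr0 add0r.
  rewrite (_ : (Negz N == Negz k) = false) ?mulr0 ?add0r//.
  by apply/negbTE/eqP => -[h]; move: kN; rewrite h; lia.
move: kN; case: k {ih} step z => k step z /= kN.
  rewrite step -kN eqxx mulr1 (_ : (Negz k == k) = false)// mulr0 addr0 z ?addr0// => n nk.
  by split => //; rewrite eqz_nat (ltn_eqF nk).
rewrite step (_ : (Posz N == Negz k) = false)// mulr0 add0r.
rewrite (_ : (Negz N == Negz k) = false); last by apply/negbTE/eqP => -[h]; lia.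
rewrite mulr0 add0r -kN step eqxx mulr1 mulr0 add0r z ?addr0// => n nk.
by split => //; apply/eqP => -[h]; lia.
Qed.

Lemma fcoef_fourier_sum c C k : sq_decay c C -> fcoef (fourier_sum c) k = c k.
Proof.
move=> hC; apply/eqP; rewrite -subr_eq0; apply/eqP/Normc.eq0_normc/eqP.
rewrite eq_le normc_ge0 andbT; apply/ler_addgt0Pr => e e0; rewrite add0r.
have [N hN] := small_tail (2 * (6 * C)) e0.
have C0 := sq_decay_ge0 hC.
pose M := maxn N `|k|%N.+1.
have cs := ccontinuous_fourier_sum hC; have cp := ccontinuous_fourier_partial c M.
rewrite -(@fcoef_fourier_partial c M k); last by rewrite leq_maxr.
have e1 : fcoef (fun x => fourier_sum c x - fourier_partial c M x) k = fcoef (fourier_sum c) k - fcoef (fourier_partial c M) k.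
  have -> : (fun x => fourier_sum c x - fourier_partial c M x) = (fun x => (-1) * fourier_partial c M x + fourier_sum c x).
    by apply/funext => x; rewrite mulN1r addrC.
  by rewrite fcoef_lin// mulN1r addrC.
rewrite -e1; apply: (@le_trans _ _ (2 * (6 * C * M.+1%:R^-1))).
  apply: normc_torus_integral_le_sup.
    apply: ccontinuousM; last exact: ccontinuous_expi.
    apply: ccontinuousD => //.
    by under eq_fun do rewrite -mulN1r; apply: ccontinuousM => //; exact: ccontinuous_cst.
  by move=> x; rewrite Normc.normcM normc_expi mulr1; exact: fourier_sum_approx.
apply: le_trans (ltW hN); rewrite mulrA ler_wpM2l// ?mulr_ge0//.
by rewrite lef_pV2 ?posrE ?ltr0n// ler_nat ltnS leq_maxl.
Qed.

(** A quadratic Taylor remainder is stronger than differentiability, and it is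
    stable under pointwise limits. *)
Lemma is_derive_quadratic (f : R -> R) (x d M : R) :
  (forall y, `|f y - f x - d * (y - x)| <= M * (y - x) ^+ 2) -> is_derive x 1 f d.
Proof.
move=> h.
have H : h^-1 *: (f (h *: (1 : R) + x) - f x) @[h --> (0 : R)^'] --> d.
  apply/cvgrPdist_lt => e e0.
  have M1 : 0 < `|M| + 1 by rewrite ltr_wpDl.
  near=> t.
  have t0 : t != 0 by near: t; exact: nbhs_dnbhs_neq.
  rewrite distrC -(ltr_pM2l (_ : 0 < `|t|)) ?normr_gt0// -normrM /GRing.scale /= mulr1.
  rewrite mulrBr mulrA divff// mul1r.
  have := h (t + x); rewrite addrK [d * t]mulrC => /le_lt_trans; apply.
  apply: (@le_lt_trans _ _ (`|M| * `|t| ^+ 2)).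
    by rewrite real_normK ?num_real// ler_wpM2r ?sqr_ge0// ler_norm.
  rewrite mulrC expr2 -mulrA ltr_pM2l ?normr_gt0//.
  apply: (@le_lt_trans _ _ (`|t| * (`|M| + 1))); first by rewrite ler_wpM2l// lerDl.
  rewrite -ltr_pdivlMr//; near: t; apply: dnbhs0_lt; exact: divr_gt0.
apply: DeriveDef; last exact: cvg_lim H.
by apply/cvg_ex; exists d.
Unshelve. all: by end_near.
Qed.

(** Uniform convergence of s and s', with s'' uniformly bounded, gives a uniform
    quadratic Taylor estimate that passes to the limit. *)
Lemma is_derive_lim (f g : R -> R) (s s' s'' : nat -> R -> R) (A B M : R) :
  (forall N (x : R), is_derive x 1 (s N) (s' N x)) ->
  (forall N (x : R), is_derive x 1 (s' N) (s'' N x)) ->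
  (forall N x, `|s'' N x| <= M) ->
  (forall N x, `|f x - s N x| <= A * N.+1%:R^-1) ->
  (forall N x, `|g x - s' N x| <= B * N.+1%:R^-1) ->
  forall x : R, is_derive x 1 f (g x).
Proof.
move=> ds ds' hM fs gs x; apply: (@is_derive_quadratic _ _ _ M) => y.
have M0 : 0 <= M by apply: le_trans (hM 0%N 0).
have hN N : `|s N y - s N x - s' N x * (y - x)| <= M * (y - x) ^+ 2.
  have key z w : z < w -> exists2 c, z <= c <= w & s N w - s N z = s' N c * (w - z).
    move=> zw; have [c ci ->] := @MVT R (s N) (s' N) z w zw (fun t _ => ds N t)
      (continuous_subspaceT (is_derive_continuous (ds N))).
    by exists c => //; move: ci; rewrite in_itv /= => /andP[c1 c2]; rewrite !ltW.
  have [c cxy ->] : exists2 c, `|c - x| <= `|y - x| & s N y - s N x = s' N c * (y - x).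
    have [xy|yx|->] := ltgtP x y.
    - have [c /andP[c1 c2] e] := key _ _ xy; exists c => //.
      by rewrite !ger0_norm ?subr_ge0 ?(ltW xy)// lerD2r.
    - have [c /andP[c1 c2] e] := key _ _ yx; exists c.
        by rewrite distrC [leRHS]distrC !ger0_norm ?subr_ge0 ?(ltW yx)// lerD2l lerN2.
      by rewrite -opprB e -mulrN opprB.
    - by exists y => //; rewrite !subrr mulr0.
  rewrite -mulrBl normrM -[(y - x) ^+ 2]real_normK ?num_real// expr2 mulrA.
  rewrite ler_wpM2r//; apply: (@le_trans _ _ (M * `|c - x|)); last by rewrite ler_wpM2l.
  exact: (mvt_lipschitz (ds' N) (hM N)).
apply/ler_addgt0Pr => e e0.
have [N hN'] := small_tail (2 * A + B * `|y - x|) e0.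
rewrite (_ : f y - f x - g x * (y - x) = (s N y - s N x - s' N x * (y - x)) +
  ((f y - s N y) - (f x - s N x) - (g x - s' N x) * (y - x))); last by ring.
apply: le_trans (ler_normD _ _) (lerD (hN N) _).
apply: le_trans (ltW hN'); apply: le_trans (ler_normB _ _) _.
rewrite [leRHS]mulrDl; apply: lerD.
  apply: le_trans (ler_normB _ _) _; rewrite mulr_natl mulr2n [leRHS]mulrDl.
  by apply: lerD; exact: fs.
by rewrite normrM mulrAC ler_wpM2r.
Qed.

Lemma is_cderive_fourier_partial c N : is_cderive (fourier_partial c N) (fourier_partial (fun k => two_pi_i k * c k) N).
Proof.
have one (k : int) : is_cderive (fun x => c k * expi R k x) (fun x => two_pi_i k * c k * expi R k x).
  move=> x; have h0 : is_cderive (fun=> c k) (fun=> 0) by move=> z; split; exact: is_derive_cst.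
  by have := is_cderiveM h0 (is_cderive_expi k) x; rewrite mul0r add0r mulrA [c k * _]mulrC.
have add (F F' G G' : R -> R[i]) : is_cderive F F' -> is_cderive G G' ->
    is_cderive (fun x => F x + G x) (fun x => F' x + G' x).
  move=> dF dG x; have [a b] := dF x; have [a' b'] := dG x; split.
    by under eq_fun do rewrite ReD; rewrite ReD; exact: (is_deriveD a a').
  by under eq_fun do rewrite ImD; rewrite ImD; exact: (is_deriveD b b').
elim: N => [|N ih].
  have -> : fourier_partial c 0 = (fun=> 0) by apply/funext => x; rewrite /fourier_partial big_ord0.
  have -> : fourier_partial (fun k => two_pi_i k * c k) 0 = (fun=> 0).
    by apply/funext => x; rewrite /fourier_partial big_ord0.
  by move=> x; split; exact: is_derive_cst.
have fS (d : int -> R[i]) : fourier_partial d N.+1 = (fun x => fourier_partial d N x +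
    (d (Posz N) * expi R (Posz N) x + d (Negz N) * expi R (Negz N) x)).
  by apply/funext => x; rewrite /fourier_partial big_ord_recr.
by rewrite !fS; apply: (add) => //; apply: (add); exact: one.
Qed.

Lemma fourier_sum_bound c C x : sq_decay c C -> normc (fourier_sum c x) <= 6 * C.
Proof.
move=> hC; have := fourier_sum_approx x 0 hC.
by rewrite /fourier_partial big_ord0 subr0 invr1 mulr1.
Qed.

Lemma fourier_partial_bound c C N x : sq_decay c C -> normc (fourier_partial c N x) <= 12 * C.
Proof.
move=> hC; rewrite -[fourier_partial c N x](subrK (fourier_sum c x)).
apply: le_trans (normc_triangle _ _) _.
rewrite -normc_opp opprB (_ : 12 * C = 6 * C + 6 * C); last by ring.
apply: lerD (fourier_sum_bound x hC); apply: le_trans (fourier_sum_approx x N hC) _.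
have C0 := sq_decay_ge0 hC.
by rewrite ler_piMr ?mulr_ge0// invf_le1 ?ltr0n// ler1n.
Qed.

Lemma is_cderive_fourier_sum c C0 C1 C2 : sq_decay c C0 ->
  sq_decay (fun k => two_pi_i k * c k) C1 ->
  sq_decay (fun k => two_pi_i k * (two_pi_i k * c k)) C2 ->
  is_cderive (fourier_sum c) (fourier_sum (fun k => two_pi_i k * c k)).
Proof.
move=> h0 h1 h2 x; split.
  apply: (@is_derive_lim (fun x => complex.Re (fourier_sum c x))
    (fun x => complex.Re (fourier_sum (fun k => two_pi_i k * c k) x))
    (fun N x => complex.Re (fourier_partial c N x))
    (fun N x => complex.Re (fourier_partial (fun k => two_pi_i k * c k) N x))
    (fun N x => complex.Re (fourier_partial (fun k => two_pi_i k * (two_pi_i k * c k)) N x))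
    (6 * C0) (6 * C1) (12 * C2)).
  - by move=> N y; have [] := is_cderive_fourier_partial c N y.
  - by move=> N y; have [] := is_cderive_fourier_partial (fun k => two_pi_i k * c k) N y.
  - by move=> N y; apply: le_trans (Re_le_normc _) (fourier_partial_bound _ _ h2).
  - by move=> N y; rewrite -ReB; apply: le_trans (Re_le_normc _) (fourier_sum_approx _ _ h0).
  - by move=> N y; rewrite -ReB; apply: le_trans (Re_le_normc _) (fourier_sum_approx _ _ h1).
apply: (@is_derive_lim (fun x => complex.Im (fourier_sum c x))
    (fun x => complex.Im (fourier_sum (fun k => two_pi_i k * c k) x))
    (fun N x => complex.Im (fourier_partial c N x))
    (fun N x => complex.Im (fourier_partial (fun k => two_pi_i k * c k) N x))
    (fun N x => complex.Im (fourier_partial (fun k => two_pi_i k * (two_pi_i k * c k)) N x))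
    (6 * C0) (6 * C1) (12 * C2)).
- by move=> N y; have [] := is_cderive_fourier_partial c N y.
- by move=> N y; have [] := is_cderive_fourier_partial (fun k => two_pi_i k * c k) N y.
- by move=> N y; apply: le_trans (Im_le_normc _) (fourier_partial_bound _ _ h2).
- by move=> N y; rewrite -ImB; apply: le_trans (Im_le_normc _) (fourier_sum_approx _ _ h0).
- by move=> N y; rewrite -ImB; apply: le_trans (Im_le_normc _) (fourier_sum_approx _ _ h1).
Qed.

Lemma fourier_sum_smooth_periodic c :
  (forall m, exists C, sq_decay (fun k => two_pi_i k ^+ m * c k) C) ->
  fourier_sum c \in @smooth_periodic R.
Proof.
move=> hC; pose cm m k := two_pi_i k ^+ m * c k.
have cmS m : cm m.+1 = (fun k => two_pi_i k * cm m k).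
  by apply/funext => k; rewrite /cm exprS mulrA.
have dP m : is_cderive (fourier_sum (cm m)) (fourier_sum (cm m.+1)).
  have [C0 h0] := hC m; have [C1 h1] := hC m.+1; have [C2 h2] := hC m.+2.
  rewrite -/(cm m.+1) cmS in h1; rewrite -/(cm m.+2) !cmS in h2.
  by rewrite cmS; exact: is_cderive_fourier_sum h0 h1 h2.
have c0 : cm 0%N = c by apply/funext => k; rewrite /cm expr0 mul1r.
have dn m : derive1n m (fun x => complex.Re (fourier_sum c x)) = (fun x => complex.Re (fourier_sum (cm m) x)) /\
            derive1n m (fun x => complex.Im (fourier_sum c x)) = (fun x => complex.Im (fourier_sum (cm m) x)).
  elim: m => [|m [ihr ihi]]; first by rewrite c0.
  split; rewrite derive1nS ?ihr ?ihi; apply/funext => x; rewrite derive1E.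
    by have [[_ ->] _] := dP m x.
  by have [_ [_ ->]] := dP m x.
apply/smooth_periodicP; split.
- move=> x; pose G (a : nat -> R[i]) : R[i] := (lim (complex.Re (a N) @[N --> \oo])) +i*
    (lim (complex.Im (a N) @[N --> \oo])).
  rewrite -[LHS]/(G (fun N => fourier_partial c N (x + 1))) -[RHS]/(G (fun N => fourier_partial c N x)).
  congr G; apply/funext => N; rewrite /fourier_partial; apply: eq_bigr => n _.
  have p (k : int) : expi R k (x + 1) = expi R k x.
    by have /smooth_periodicP[p _ _] := test_smooth (expi R k); exact: p.
  by rewrite !p.
- by move=> m x; have [-> _] := dn m; have [[]] := dP m x.
- by move=> m x; have [_ ->] := dn m; have [_ []] := dP m x.
Qed.

Lemma normc_two_pi_i k : normc (two_pi_i k) = 2 * pi * `|k|%N%:R.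
Proof.
rewrite normcE /= expr0n add0r sqrtr_sqr normrM ger0_norm ?mulr_ge0 ?pi_ge0//.
by rewrite -intr_norm -abszE -pmulrn.
Qed.

Lemma sq_decay_two_pi_i c m (C : R) :
  (forall k, normc (c k) * (`|k|%N.+1%:R) ^+ m.+2 <= C) ->
  sq_decay (fun k => two_pi_i k ^+ m * c k) ((2 * pi) ^+ m * C).
Proof.
move=> h k; rewrite Normc.normcM normcX normc_two_pi_i exprMn -!mulrA ler_wpM2l//.
  by rewrite exprn_ge0// mulr_ge0// pi_ge0.
apply: le_trans (h k); rewrite mulrCA ler_wpM2l ?normc_ge0//.
rewrite -[m.+2]addn2 [leRHS]exprD ler_wpM2r ?sqr_ge0//.
by apply: lerXn2r; rewrite ?nnegrE ?ler0n// ler_nat.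
Qed.

(** * Generalized functions and the growth of Fourier coefficients *)

Lemma torus_pairing_linear F m (a : R[i]) g h : ccontinuous F ->
  torus_integral (fun x => F x * cderive1n m (a *: g + h) x) =
  a * torus_integral (fun x => F x * cderive1n m g x) +
  torus_integral (fun x => F x * cderive1n m h x).
Proof.
move=> cF; have c1 (u : torus_test R) : ccontinuous (fun x => F x * cderive1n m u x).
  by apply: ccontinuousM => //; exact: ccontinuous_cderive1n.
rewrite -torus_integralZ// -torus_integralD//; last by apply: ccontinuousM => //; exact: ccontinuous_cst.
by congr torus_integral; apply/funext => x; rewrite cderive1n_lin; ring.
Qed.

Lemma torus_pairingB F m g h : ccontinuous F ->
  torus_integral (fun x => F x * cderive1n m (g - h) x) =
  torus_integral (fun x => F x * cderive1n m g x) -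
  torus_integral (fun x => F x * cderive1n m h x).
Proof.
move=> cF; have -> : g - h = (-1) *: h + g by rewrite scaleN1r addrC.
by rewrite torus_pairing_linear// mulN1r addrC.
Qed.

Lemma torus_pairing_bound F m (B d : R) g : ccontinuous F -> (forall x, normc (F x) <= B) ->
  (forall x, normc (cderive1n m g x) <= d) ->
  normc (torus_integral (fun x => F x * cderive1n m g x)) <= 2 * (B * d).
Proof.
move=> cF hB hd; apply: normc_torus_integral_le_sup.
  by apply: ccontinuousM => //; exact: ccontinuous_cderive1n.
by move=> x; rewrite Normc.normcM; apply: ler_pM; rewrite ?normc_ge0.
Qed.

(** The sum of the Fourier series is smooth by termwise differentiation, and it
    represents f because the difference of the two functionals is continuous and
    vanishes on exponentials. *)
Lemma smooth_of_fourier_decay (f : periodic_gf R) :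
  (forall m, exists C, forall k, normc (fourier f k) * (`|k|%N.+1%:R) ^+ m <= C) ->
  is_smooth f.
Proof.
move=> hf.
have hC m : exists C, sq_decay (fun k => two_pi_i k ^+ m * fourier f k) C.
  have [C hC] := hf m.+2; exists ((2 * pi) ^+ m * C); exact: sq_decay_two_pi_i.
pose g : torus_test R := TorusTest (fourier_sum_smooth_periodic hC).
exists g; pose D h : R[i] := f h - torus_integral (fun x => g x * h x).
suff : forall h, D h = 0 by move=> + h => /(_ h) /eqP; rewrite subr_eq0 => /eqP.
have DE h : D h = f h - torus_integral (fun x => g x * cderive1n 0 h x).
  by rewrite cderive1n0.
have cg := ccontinuous_test g.
have lD : linear D.
  move=> a u v; rewrite !DE torus_pairing_linear// linearP /GRing.scale /=; ring.
apply: frechet_continuous_ext0 => //.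
  move=> u e e0.
  have [n [d d0 hd]] := pgf_continuous f u (divr_gt0 e0 (ltr0n R 2)).
  have [B B0 hB] := cderive1n_bounded g 0; rewrite cderive1n0 in hB.
  pose d' := Num.min d (e / (4 * (B + 1))).
  have B1 : 0 < 4 * (B + 1) by rewrite mulr_gt0// ltr_wpDl.
  exists n; exists d'; first by rewrite /d' lt_min d0 divr_gt0.
  move=> h hh.
  have -> : D h - D u = (f h - f u) - torus_integral (fun x => g x * cderive1n 0 (h - u) x).
    by rewrite !DE torus_pairingB//; ring.
  apply: le_lt_trans (normc_triangle _ _) _; rewrite normc_opp.
  rewrite [e](_ : _ = e / 2 + e / 2); last by field.
  apply: ltr_leD.
    by apply: hd => m x mn; apply: le_trans (hh m x mn) _; rewrite /d' ge_min lexx.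
  apply: le_trans (@torus_pairing_bound _ _ B d' _ cg hB _) _.
    by move=> x; exact: hh.
  apply: (@le_trans _ _ (2 * (B * (e / (4 * (B + 1)))))).
    by rewrite ler_wpM2l// ler_wpM2l// /d' ge_min lexx orbT.
  rewrite (_ : 2 * _ = (e / 2) * (B / (B + 1))); last by field; rewrite gt_eqF// ltr_wpDl.
  by rewrite ler_piMr ?divr_ge0 ?(ltW e0)// ler_pdivrMr ?ltr_wpDl// mul1r lerDl.
move=> k; have [C hC0] := hC 0%N.
have e : fcoef g (- k) = fourier f (- k).
  have h0 : sq_decay (fourier f) C by move=> j; have := hC0 j; rewrite expr0 mul1r.
  exact: fcoef_fourier_sum h0.
by rewrite /D -{2}[k]opprK -/(fcoef g (- k)) e /fourier opprK subrr.
Qed.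

Lemma fourier_decay_of_smooth (f : periodic_gf R) m : is_smooth f ->
  exists C, forall k, normc (fourier f k) * (`|k|%N%:R) ^+ m <= C.
Proof.
move=> [g hg]; have [B B0 hB] := cderive1n_bounded g m; exists (2 * B) => k.
have e : fourier f k = fcoef g k by rewrite /fourier hg.
have : normc (fcoef (cderive1n m g) k) <= 2 * B.
  apply: normc_torus_integral_le_sup.
    by apply: ccontinuousM; [exact: ccontinuous_cderive1n|exact: ccontinuous_expi].
  by move=> x; rewrite Normc.normcM normc_expi mulr1.
rewrite fcoef_cderive1n Normc.normcM normcX normc_two_pi_i e => /(le_trans _); apply.
rewrite mulrC ler_wpM2r ?normc_ge0//; apply: lerXn2r.
- by rewrite nnegrE ler0n.
- by rewrite nnegrE !mulr_ge0 ?pi_ge0 ?ler0n.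
- by rewrite ler_peMl ?ler0n//; have := pi_ge2 R; lra.
Qed.

(** Continuity of f at 0 tested on multiples of an exponential that are as large
    as the seminorms of order at most n permit. *)
Lemma fourier_growth (f : periodic_gf R) : exists n : nat, exists2 C : R, 0 < C &
  forall k, normc (fourier f k) <= C * (`|k|%N.+1%:R) ^+ n.
Proof.
have [n [d d0 hd]] := pgf_continuous f 0 (@ltr01 R).
exists n; exists ((2 * pi + 1) ^+ n / d).
  by rewrite divr_gt0// exprn_gt0// ltr_wpDl// mulr_ge0// pi_ge0.
move=> k; pose T : R := 2 * pi * `|k|%N%:R + 1.
have T0 : 0 <= 2 * pi * `|k|%N%:R :> R by rewrite !mulr_ge0 ?pi_ge0 ?ler0n.
have T1 : 1 <= T by rewrite lerDr.
have Tp : 0 < T by rewrite (lt_le_trans ltr01).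
pose a := d / T ^+ n; have a0 : 0 < a by rewrite divr_gt0// exprn_gt0.
have := hd (a%:C *: expi R (- k)); rewrite subr0 => /(_ _)/ltW.
have -> : f (a%:C *: expi R (- k)) - f 0 = a%:C * fourier f k.
  by rewrite linear0 subr0 linearZ.
rewrite Normc.normcM normc_real (gtr0_norm a0) => h.
have : a * normc (fourier f k) <= 1.
  apply: h => m x mn; rewrite -[_ *: _]addr0 cderive1n_lin cderive1n0f addr0.
  rewrite Normc.normcM normc_real (gtr0_norm a0) cderive1n_expi Normc.normcM normc_expi.
  rewrite mulr1 normcX normc_two_pi_i abszN.
  rewrite /a mulrAC ler_pdivrMr ?exprn_gt0// ler_wpM2l ?(ltW d0)//.
  apply: (@le_trans _ _ (T ^+ m)); first by apply: lerXn2r; rewrite ?nnegrE ?(ltW Tp)// lerDl.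
  by rewrite ler_weXn2l.
rewrite /a -ler_pdivlMl// invf_div mulr1 => /le_trans; apply.
rewrite mulrAC ler_wpM2r ?invr_ge0 ?(ltW d0)// -exprMn; apply: lerXn2r.
- by rewrite nnegrE ltW.
- by rewrite nnegrE mulr_ge0 ?ler0n// addr_ge0// mulr_ge0// pi_ge0.
rewrite (_ : (2 * pi + 1) * _ = T + (2 * pi + `|k|%N%:R)); last by rewrite -natr1 /T; ring.
by rewrite lerDl addr_ge0 ?ler0n// mulr_ge0// pi_ge0.
Qed.

(** Dividing the coefficients by a high power of 2 i pi k makes the series
    converge uniformly to a continuous function F, and f is the corresponding
    derivative of F, paired with test functions by moving the derivatives onto
    them. *)
Lemma periodic_gf_of_fourier c (n : nat) (C : R) :
  (forall k, normc (c k) <= C * (`|k|%N.+1%:R) ^+ n) ->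
  exists f : periodic_gf R, forall k, fourier f k = c k.
Proof.
move=> hc; have C0 : 0 <= C.
  by have := le_trans (normc_ge0 _) (hc 0); rewrite absz0 expr1n mulr1.
(* an even order of differentiation, so that no sign is lost when the derivatives are moved *)
have [M nM hM] : exists2 M, (n.+2 <= M)%N & forall k, two_pi_i (- k) ^+ M = two_pi_i k ^+ M.
  exists (2 * n.+2)%N => [|k]; first by rewrite mul2n -addnn leq_addr.
  have -> : two_pi_i (- k) = - two_pi_i k.
    by apply: eq_ReIm; rewrite /= ?oppr0// mulrNz mulrN.
  by rewrite !exprM sqrrN.
(* the constant term cannot be recovered by differentiation and is added apart *)
pose b (k : int) : R[i] := if k == 0 then 0 else c k / two_pi_i k ^+ M.
have tw0 k : k != 0 -> two_pi_i k != 0.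
  move=> k0; apply/eqP => /(congr1 (@normc R))/eqP; rewrite normc_two_pi_i Normc.normc0.
  by rewrite !mulf_eq0 (gt_eqF (pi_gt0 R)) !pnatr_eq0 absz_eq0 (negbTE k0).
have hb : sq_decay b (C * 2 ^+ n.+2).
  move=> k; rewrite /b; have [->|k0] := eqVneq k 0.
    by rewrite Normc.normc0 mul0r mulr_ge0// exprn_ge0.
  have k1 : 1 <= `|k|%N%:R :> R by rewrite ler1n absz_gt0.
  have p2 := pi_ge2 R.
  rewrite Normc.normcM Normc.normcV normcX normc_two_pi_i.
  set t : R := 2 * pi * _; have t1 : 1 <= t by rewrite /t; nra.
  have tk : `|k|%N.+1%:R <= 2 * t by rewrite -natr1 /t; nra.
  have tp : 0 < t ^+ M by rewrite exprn_gt0// (lt_le_trans ltr01).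
  rewrite mulrAC ler_pdivrMr//.
  apply: (@le_trans _ _ (C * (`|k|%N.+1%:R) ^+ n * (`|k|%N.+1%:R) ^+ 2)).
    by rewrite ler_wpM2r ?sqr_ge0.
  rewrite -[leLHS]mulrA -exprD -[leRHS]mulrA addn2 ler_wpM2l//.
  apply: (@le_trans _ _ ((2 * t) ^+ n.+2)); first by apply: lerXn2r; rewrite ?nnegrE//; lra.
  by rewrite exprMn ler_wpM2l ?exprn_ge0// ler_weXn2l.
have [F cF [F1 F2]] : exists2 F, ccontinuous F &
    (forall x, normc (F x) <= 6 * (C * 2 ^+ n.+2)) /\ forall k, fcoef F k = b k.
  exists (fourier_sum b); first exact: ccontinuous_fourier_sum hb.
  by split=> [x|k]; [exact: fourier_sum_bound hb|exact: fcoef_fourier_sum hb].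
pose G h : R[i]^o := torus_integral (fun x => F x * cderive1n M h x) +
   torus_integral (fun x => c 0 * cderive1n 0 h x).
have lG : linear G.
  move=> a u v; rewrite /G (torus_pairing_linear M a u v cF).
  rewrite (torus_pairing_linear 0 a u v (ccontinuous_cst (c 0))).
  by rewrite /GRing.scale /=; ring.
pose Gl := HB.pack_for {linear torus_test R -> R[i]^o} G
  (GRing.isLinear.Build R[i] (torus_test R) R[i]^o _ G lG).
have cG : frechet_continuous Gl.
  move=> u e e0.
  have [B B0 [B1 B2]] : exists2 B, 0 < B & (forall x, normc (F x) <= B) /\ normc (c 0) <= B.
    have K0 : 0 <= 6 * (C * 2 ^+ n.+2) by apply: le_trans (F1 0); exact: normc_ge0.
    exists (6 * (C * 2 ^+ n.+2) + normc (c 0) + 1).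
      by rewrite ltr_wpDl// addr_ge0// normc_ge0.
    split=> [x|]; last by rewrite addrAC lerDr addr_ge0.
    by apply: le_trans (F1 x) _; rewrite -addrA lerDl addr_ge0// normc_ge0.
  exists M; exists (e / (5 * B)); first by rewrite divr_gt0// mulr_gt0.
  move=> h hh; rewrite -linearB -[Gl _]/(G (h - u)) /G.
  apply: le_lt_trans (normc_triangle _ _) _.
  rewrite (_ : e = 5 * (B * (e / (5 * B)))); last by field; rewrite gt_eqF.
  set d := e / _.
  have d0 : 0 < d by rewrite /d divr_gt0// mulr_gt0.
  apply: (@le_lt_trans _ _ (2 * (B * d) + 2 * (B * d))); last first.
    by have := mulr_gt0 B0 d0; move: (B * d) => z z0; lra.
  apply: lerD; apply: torus_pairing_bound => //.
  - by move=> x; apply: hh.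
  - exact: ccontinuous_cst.
  - by move=> x; apply: hh.
exists (PeriodicGf cG) => k; rewrite /fourier -[PeriodicGf cG _]/(G (expi R (- k))) /G cderive1n0.
rewrite (torus_integralZ _ (ccontinuous_expi _)) torus_integral_expi oppr_eq0.
have -> : torus_integral (fun x => F x * cderive1n M (expi R (- k)) x) = two_pi_i k ^+ M * b k.
  rewrite -F2 /fcoef -torus_integralZ; last first.
    by apply: ccontinuousM => //; exact: ccontinuous_expi.
  congr torus_integral; apply/funext => x; rewrite cderive1n_expi.
  by rewrite hM; ring.
rewrite /b; have [->|k0] := eqVneq k 0; first by rewrite mulr0 add0r mulr1.
by rewrite mulr0 addr0 mulrC divfK// expf_neq0// tw0.
Qed.
End ComplexCalc.

(** * Dyadic partitions of unity *)

Section Dyadic.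
Variables (R : realType) (phi0 phi1 : R -> R).
Hypothesis hphi : is_dyadic_partition phi0 phi1.
Local Notation normc := Normc.normc.
Local Notation mu := (torus_measure R).
Local Notation dy := (dyadic phi0 phi1).

Lemma schwartz_continuous (f : R -> R) : schwartz f -> continuous f.
Proof.
move=> [sf _] x; apply: differentiable_continuous; apply/derivable1_diffP.
exact: (sf 0%N x).
Qed.

(** Opens up the closed support conditions: they hold on a neighbourhood of each
    point where the function does not vanish, hence with strict inequalities. *)
Lemma schwartz_nz_nbhs (f : R -> R) x : schwartz f -> f x != 0 ->
  exists2 d, 0 < d & forall y, `|x - y| < d -> closure [set z | f z != 0] y.
Proof.
move=> /schwartz_continuous cf fx.
have := cf x => /cvgrPdist_lt /(_ `|f x|); rewrite normr_gt0 => /(_ fx).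
move=> /nbhs_ballP [d d0 hd]; exists d => // y xy.
apply: subset_closure; apply/eqP => fy.
by have := hd y xy; rewrite /= fy subr0 ltxx.
Qed.

Lemma phi0_supp x : phi0 x != 0 -> `|x| < 2.
Proof.
have [[s0 _] _ sup0 _ _] := hphi => fx.
have [d d0 hd] := schwartz_nz_nbhs s0 fx.
pose s : R := if 0 <= x then 1 else -1.
have xs : `|x + s * (d / 2)| = `|x| + d / 2.
  rewrite /s; case: ifPn => x0.
    by rewrite mul1r !ger0_norm// addr_ge0// divr_ge0// ltW.
  by rewrite mulN1r !ltr0_norm -?ltNge//; move: x0; rewrite -ltNge => x0; lra.
have := sup0 (x + s * (d / 2)); rewrite /= xs => /(_ _); suff h : closure [set z | phi0 z != 0] (x + s * (d / 2)).
  by move=> /(_ h); lra.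
apply: hd; rewrite opprD addNKr normrN normrM.
have -> : `|s| = 1 by rewrite /s; case: ifP; rewrite ?normrN normr1.
by rewrite mul1r gtr0_norm ?divr_gt0//; lra.
Qed.

Lemma phi1_supp x : phi1 x != 0 -> 1 < `|x| < 4.
Proof.
have [[_ s0] _ _ sup0 _] := hphi => fx.
have [d d0 hd] := schwartz_nz_nbhs s0 fx.
have key (e : R) : `|e| < d -> 1 <= `|x + e| <= 4.
  by move=> ed; apply: sup0; apply: hd; rewrite opprD addNKr normrN.
have h0 := key 0; rewrite normr0 addr0 in h0; have /andP[h1 h4] := h0 d0.
pose t := Num.min (d / 2) 2^-1.
have t0 : 0 < t by rewrite /t lt_min divr_gt0//= invr_gt0.
have t1 : t <= 2^-1 by rewrite /t ge_min lexx orbT.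
have td : t < d by rewrite /t gt_min; apply/orP; left; lra.
have d2 : `|t| < d by rewrite gtr0_norm.
have d2' : `|- t| < d by rewrite normrN.
have /andP[a1 a2] := key _ d2; have /andP[b1 b2] := key _ d2'.
clearbody t; have [x0|x0] := leP 0 x.
  rewrite (ger0_norm x0) in h1 h4 *.
  rewrite ger0_norm in a2; last by lra.
  have xd : 0 <= x - t by lra.
  by rewrite ger0_norm// in b1; apply/andP; split; lra.
rewrite (ltr0_norm x0) in h1 h4 *.
rewrite ler0_norm in b2; last by lra.
have xd : x + t <= 0 by lra.
by rewrite ler0_norm// in a1; apply/andP; split; lra.
Qed.

Lemma dyadic_ge0 j x : 0 <= dy j x.
Proof. by have [_ [p0 p1] _ _ _] := hphi; case: j => [|j] /=; [exact: p0|exact: p1]. Qed.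

(** Strict inequalities, so that dyadic frequencies 2^j belong to a single
    function of the partition. *)
Lemma dyadic_supp j x : dy j x != 0 ->
  `|x| < 2 ^+ j.+1 /\ ((0 < j)%N -> 2 ^+ j.-1 < `|x|).
Proof.
case: j => [|j] /=; first by move=> /phi0_supp; rewrite expr1.
move=> /phi1_supp; rewrite normrM normfV [`|2 ^+ j|]gtr0_norm ?exprn_gt0//.
rewrite ltr_pdivlMr ?exprn_gt0// ltr_pdivrMr ?exprn_gt0// mul1r => /andP[h1 h2].
by split=> //; move: h2; rewrite !exprS; lra.
Qed.

Lemma dyadic_far x J j : `|x| < 2 ^+ J.+1 -> ((0 < J)%N -> 2 ^+ J <= `|x|) ->
  j != J -> j != J.+1 -> dy j x = 0.
Proof.
move=> xJ Jx jJ jJ1; apply/eqP; apply/negPn/negP => /dyadic_supp[h1 h2].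
have [jltJ|] := ltnP j J.
  have := Jx (leq_ltn_trans (leq0n _) jltJ); apply/negP; rewrite -ltNge.
  by apply: (lt_le_trans h1); rewrite ler_weXn2l// ler1n.
rewrite leq_eqVlt eq_sym (negbTE jJ)/= leq_eqVlt eq_sym (negbTE jJ1)/= => Jj.
have := h2 (leq_ltn_trans (leq0n _) Jj); apply/negP; rewrite -leNgt.
apply: (le_trans (ltW xJ)); rewrite ler_weXn2l ?ler1n//.
by case: j Jj {jJ jJ1 h1 h2}.
Qed.

Lemma dyadic_sum2 x J : `|x| < 2 ^+ J.+1 -> ((0 < J)%N -> 2 ^+ J <= `|x|) ->
  dy J x + dy J.+1 x = 1.
Proof.
move=> xJ Jx; have [_ _ _ _ /(_ x) hs] := hphi.
have z := dyadic_far xJ Jx.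
have e N : (J.+2 <= N)%N -> series (dy ^~ x) N = dy J x + dy J.+1 x.
  move=> JN; rewrite /series /= (big_cat_nat (n := J))//=; last by apply: leq_trans JN; rewrite -addn2 leq_addr.
  rewrite big_nat_cond big1 ?add0r; last first.
    move=> i; rewrite andbT => /andP[_ iJ].
    by apply: z; [rewrite (ltn_eqF iJ)|rewrite (ltn_eqF (leq_trans iJ (leqnSn _)))].
  rewrite big_ltn; last by apply: leq_trans JN; rewrite ltnW.
  rewrite big_ltn// addrA big_nat_cond big1 ?addr0// => i; rewrite andbT => /andP[iJ _].
  by apply: z; [rewrite (gtn_eqF (ltnW iJ))|rewrite (gtn_eqF iJ)].
have : (fun n => series (dy ^~ x) n) @ \oo --> dy J x + dy J.+1 x.
  apply: cvg_near_cst; exists J.+2 => // N /= JN; exact: e.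
by move=> h; exact: (cvg_unique (@Rhausdorff R) h hs).
Qed.

Lemma dyadic_level (x : R) : exists J, `|x| < 2 ^+ J.+1 /\ ((0 < J)%N -> 2 ^+ J <= `|x|).
Proof.
have ex : exists J, `|x| < 2 ^+ J.+1.
  exists (Num.truncn `|x|); apply: (lt_le_trans (truncnS_gt _)).
  by rewrite -natrX ler_nat ltnW// ltn_expl.
case: (ex_minnP ex) => J xJ Jmin; exists J; split=> // J0.
rewrite leNgt; apply/negP => h; have := Jmin J.-1; rewrite prednK// => /(_ h).
by rewrite -ltnS prednK// ltnn.
Qed.

Lemma dyadic_le1 j x : dy j x <= 1.
Proof.
have [J [h1 h2]] := dyadic_level x; have h := dyadic_sum2 h1 h2.
have p0 := dyadic_ge0 J x; have p1 := dyadic_ge0 J.+1 x.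
have [->|jJ] := eqVneq j J; first by lra.
have [->|jJ1] := eqVneq j J.+1; first by lra.
by rewrite (dyadic_far h1 h2 jJ jJ1).
Qed.

Lemma dyadic_ge_half x : exists2 j, 2^-1 <= dy j x & `|x| < 2 ^+ j.+1.
Proof.
have [J [h1 h2]] := dyadic_level x; have h := dyadic_sum2 h1 h2.
have [hJ|hJ] := leP 2^-1 (dy J x); first by exists J.
exists J.+1; first by lra.
by apply: (lt_le_trans h1); rewrite ler_weXn2l// ler1n.
Qed.

(** All other functions of the partition vanish at 2^j. *)
Lemma dyadic_pow2 j : dy j (2 ^+ j) = 1.
Proof.
have z : dy j.+1 (2 ^+ j) = 0.
  apply/eqP; apply/negPn/negP => /dyadic_supp[_] /(_ isT).
  by rewrite normrX normr_nat ltxx.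
have := @dyadic_sum2 (2 ^+ j) j; rewrite z addr0; apply.
  by rewrite normrX normr_nat ltr_eXn2l// ltr1n.
by rewrite normrX normr_nat.
Qed.

(** * Dyadic blocks and Besov membership *)

Implicit Types f : periodic_gf R.

(** Shifting the frequencies by 2^(j+1) makes them nonnegative and leaves the
    modulus of the block unchanged. *)
Definition block_poly f j : {poly R[i]} :=
  \poly_(i < 2 ^ j.+2) ((dy j (i%:Z - (2 ^ j.+1)%:Z)%:~R)%:C * fourier f (i%:Z - (2 ^ j.+1)%:Z)).

Lemma normc_besov_block f j x :
  normc (besov_block phi0 phi1 f j x) = normc (block_poly f j).[expc x].
Proof.
pose K := (2 ^ j.+1)%N.
pose r := [seq i%:Z - K%:Z | i <- iota 0 (2 ^ j.+2)].
have ur : uniq r.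
  by rewrite map_inj_uniq ?iota_uniq// => a b /addIr [].
have -> : besov_block phi0 phi1 f j x =
    \sum_(i < 2 ^ j.+2) (dy j (i%:Z - K%:Z)%:~R)%:C * fourier f (i%:Z - K%:Z) * expi R (i%:Z - K%:Z) x.
  rewrite /besov_block (fsbigE r)//.
    rewrite big_map -(big_mkord xpredT (fun i : nat => (dy j (i%:Z - K%:Z)%:~R)%:C * fourier f (i%:Z - K%:Z) * expi R (i%:Z - K%:Z) x)).
    by rewrite /index_iota subn0; apply: eq_bigl => i; rewrite in_setT.
  move=> k _ kr; suff -> : dy j k%:~R = 0 by rewrite !mul0r.
  apply/eqP; apply/negPn/negP => /dyadic_supp[h _]; move/negP: kr; apply.
  have kK : (`|k| < K)%N.
    move: h; rewrite -intr_norm -abszE -natrX -pmulrn ltr_nat//.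
  apply/mapP; exists (absz (k + K%:Z)).
    by rewrite mem_iota add0n /= expnS -/K; move: kK; lia.
  by move: kK; lia.
rewrite -[RHS]mulr1 -[X in _ = _ * X](normc_expi (- K%:Z) x) -Normc.normcM /block_poly horner_poly.
congr normc; rewrite mulr_suml; apply: eq_bigr => i _.
by rewrite expiD expi_nat; ring.
Qed.

Lemma pow2_gt0 (x : R) : 0 < 2 `^ x :> R.
Proof. exact: powR_gt0. Qed.

Lemma pow2D (x y : R) : 2 `^ (x + y) = 2 `^ x * 2 `^ y :> R.
Proof. by rewrite powRD// pnatr_eq0 implybT. Qed.

Lemma pow2_le (x y : R) : x <= y -> 2 `^ x <= 2 `^ y :> R.
Proof. by move=> xy; apply: ler_powR => //; rewrite ler1n. Qed.

Lemma pow2_lt (x y : R) : x < y -> 2 `^ x < 2 `^ y :> R.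
Proof.
move=> xy; rewrite -[y](subrK x) addrC pow2D ltr_pMr ?pow2_gt0//.
have := @gt0_ltr_powR R (y - x); rewrite subr_gt0 => /(_ xy 1 2).
by rewrite powR1 !nnegrE ler01 ler0n ltr1n; apply.
Qed.

Definition block_abs f j (x : R) : R := normc (block_poly f j).[expc x].

Lemma block_abs_ge0 f j x : 0 <= block_abs f j x.
Proof. exact: normc_ge0. Qed.

Lemma measurable_block_abs f j : measurable_fun setT (block_abs f j).
Proof. by apply: measurable_normc; exact: ccontinuous_horner. Qed.

Lemma besov_block_normE f p j :
  besov_block_norm phi0 phi1 f p j = Lnorm mu p (EFin \o block_abs f j).
Proof. by apply: eq_Lnorm => x /=; rewrite normc_besov_block. Qed.

(** Membership in the Besov space with exponents p = 1/u and s, up to an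
    arbitrarily small change of s, for every q at once. *)
Definition block_decay f (u s : R) : Prop := exists2 C : R, 0 < C &
  forall j : nat, (Lnorm mu (u%:E^-1) (EFin \o block_abs f j) <= (C * 2 `^ (- (j%:R * s)))%:E)%E.

Lemma block_decay_le f u s s' : s' <= s -> block_decay f u s -> block_decay f u s'.
Proof.
move=> ss [C C0 hC]; exists C => // j; apply: Lnorm_ge0_le (hC j).
rewrite ler_wpM2l ?(ltW C0)// ler_powR ?ler1n// lerN2 ler_wpM2l//.
Qed.

Lemma weighted_le (N : \bar R) (a S : R) : (0 <= N)%E ->
  ((2 `^ a)%:E * N <= S%:E)%E -> (N <= (S * 2 `^ (- a))%:E)%E.
Proof.
move=> N0 h; have a0 : 0 < 2 `^ a :> R by rewrite powR_gt0.
rewrite powRN mulrC EFinM lee_pdivlMl//.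
Qed.

Lemma block_decay_of_besov f (p q : \bar R) s u : p = (u%:E^-1)%E -> (0 < q)%E ->
  besov phi0 phi1 p q s f -> block_decay f u s.
Proof.
move=> -> q0; rewrite /besov /=.
suff key (S : R) : (forall j, (2 `^ (j%:R * s))%:E *
    besov_block_norm phi0 phi1 f (u%:E^-1) j <= S%:E)%E -> block_decay f u s.
  case: q q0 => [r| |//] /=; rewrite ?lte_fin => r0 hfin.
  - have T0 j : (0 <= (2 `^ (j%:R * s * r))%:E *
       besov_block_norm phi0 phi1 f (u%:E^-1) j `^ r)%E.
      by rewrite mule_ge0 ?poweR_ge0// lee_fin powR_ge0.
    move: hfin; set Sm := (\sum_(0 <= j <oo) _)%E => hfin.
    have Sm0 : (0 <= Sm)%E by apply: nneseries_ge0.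
    have Smf : (Sm < +oo)%E by apply: lty_poweRy hfin; rewrite invr_neq0// gt_eqF.
    apply: (key ((fine Sm) `^ r^-1)) => j.
    have hj : ((2 `^ (j%:R * s * r))%:E *
       besov_block_norm phi0 phi1 f (u%:E^-1) j `^ r <= Sm)%E.
      apply: (@le_trans _ _ (\sum_(0 <= i < j.+1) ((2 `^ (i%:R * s * r))%:E *
         besov_block_norm phi0 phi1 f (u%:E^-1) i `^ r))%E).
        by rewrite big_nat_recr//= leeDr// sume_ge0.
      exact: nneseries_lim_ge.
    move: hj; rewrite powRrM -poweR_EFin -poweRM; last 2 first.
      by rewrite lee_fin powR_ge0.
      exact: Lnorm_ge0.
    set X := (_%:E * _)%E => hj.
    rewrite -poweR_EFin fineK ?ge0_fin_numE//.
    have X0 : (0 <= X)%E by rewrite mule_ge0 ?Lnorm_ge0// lee_fin powR_ge0.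
    rewrite -[X]poweRe1// -(divff (lt0r_neq0 r0)) poweRrM.
    apply: gt0_ler_poweR => //; first by rewrite invr_ge0 ltW.
      by rewrite in_itv /= poweR_ge0 leey.
    by rewrite in_itv /= Sm0 leey.
  - apply: (key (fine (ereal_sup (range (fun j : nat => (2 `^ (j%:R * s))%:E *
        besov_block_norm phi0 phi1 f (u%:E^-1) j)%E)))) => j.
    rewrite fineK; first by apply: ereal_sup_ubound; exists j.
    rewrite ge0_fin_numE//.
    apply: le_trans (ereal_sup_ubound _); last by exists 0%N.
    by rewrite mule_ge0 ?Lnorm_ge0// lee_fin powR_ge0.
move=> hS; exists (`|S| + 1); first by rewrite ltr_wpDl.
move=> j; have := hS j; rewrite besov_block_normE => /(weighted_le (Lnorm_ge0 _ _ _)).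
apply: Lnorm_ge0_le; rewrite ler_wpM2r ?powR_ge0//.
by apply: (le_trans (ler_norm _)); rewrite lerDl.
Qed.

(** The strict inequality between s and s' turns the decay into a convergent
    geometric series, whatever q is. *)
Lemma besov_of_block_decay f (p q : \bar R) s s' u : p = (u%:E^-1)%E -> (0 < q)%E ->
  s < s' -> block_decay f u s' -> besov phi0 phi1 p q s f.
Proof.
move=> -> q0 ss [C C0 hC]; rewrite /besov /=.
case: q q0 => [r| |//]; rewrite ?lte_fin => r0 /=.
  have z1 : `|2 `^ ((s - s') * r)| < 1 :> R.
    rewrite ger0_norm ?powR_ge0// -[X in _ < X](powRr0 2) pow2_lt//.
    by rewrite pmulr_llt0// subr_lt0.
  have hle : (\sum_(0 <= j <oo) (2 `^ (j%:R * s * r))%:E *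
                 besov_block_norm phi0 phi1 f (u%:E^-1) j `^ r <=
     \sum_(0 <= j <oo) (geometric (C `^ r) (2 `^ ((s - s') * r)) j)%:E)%E.
    apply: lee_nneseries => j _.
      by move=> _; rewrite mule_ge0 ?poweR_ge0// lee_fin powR_ge0.
    have A0 : 0 <= C * 2 `^ (- (j%:R * s')) by rewrite mulr_ge0 ?powR_ge0// ltW.
    have h : (besov_block_norm phi0 phi1 f (u%:E^-1) j `^ r <=
        ((C * 2 `^ (- (j%:R * s'))) `^ r)%:E)%E.
      rewrite -poweR_EFin besov_block_normE; apply: gt0_ler_poweR (hC j).
      - exact: ltW.
      - by rewrite in_itv /= Lnorm_ge0 leey.
      - by rewrite in_itv /= leey lee_fin A0.
    apply: (le_trans (lee_wpmul2l _ h)); first by rewrite lee_fin powR_ge0.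
    rewrite -EFinM lee_fin /geometric /= powRM ?powR_ge0 ?(ltW C0)// mulrCA.
    rewrite ler_wpM2l ?powR_ge0// -powRrM -powRD; last by rewrite pnatr_eq0 implybT.
    rewrite -powR_mulrn ?powR_ge0// -powRrM le_eqVlt; apply/orP; left; apply/eqP.
    by congr (_ `^ _); ring.
  apply: poweR_lty; apply: le_lt_trans hle _.
  have -> : (fun n => (\sum_(0 <= j < n) (geometric (C `^ r) (2 `^ ((s - s') * r)) j)%:E)%E) =
      EFin \o series (geometric (C `^ r) (2 `^ ((s - s') * r))).
    by apply/funext => n; rewrite /= sumEFin.
  by rewrite EFin_lim ?ltry//; exact: is_cvg_geometric_series.
apply: (@le_lt_trans _ _ C%:E); last exact: ltry.
apply: ge_ereal_sup => _ [j _ <-].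
rewrite besov_block_normE; apply: (le_trans (lee_wpmul2l _ (hC j))); first by rewrite lee_fin powR_ge0.
rewrite -EFinM lee_fin mulrCA ler_piMr ?(ltW C0)// -powRD; last by rewrite pnatr_eq0 implybT.
rewrite -[X in _ <= X](powRr0 2) pow2_le// -mulrBr -[leRHS](mulr0 j%:R) ler_wpM2l// subr_le0 ltW//.
Qed.

Lemma critical_smoothnessE f (p q : \bar R) u : p = (u%:E^-1)%E -> (0 < q)%E ->
  critical_smoothness phi0 phi1 f p q = ereal_sup [set s%:E | s in block_decay f u].
Proof.
move=> pu q0; apply/eqP; rewrite eq_le; apply/andP; split.
  apply: ge_ereal_sup => _ [s hs <-]; apply: ereal_sup_ubound; exists s => //.
  exact: block_decay_of_besov hs.
apply: ge_ereal_sup => _ [s hs <-]; apply/lee_subgt0Pr => e e0.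
rewrite -EFinB; apply: ereal_sup_ubound; exists (s - e) => //=.
by apply: besov_of_block_decay pu q0 _ hs; rewrite ltrBlDr ltrDl.
Qed.

(** * Concavity, finiteness and slope of the critical smoothness *)

Lemma block_decay_interpolate f u v s s' t : 0 <= u -> 0 <= v -> 0 <= t <= 1 ->
  block_decay f u s -> block_decay f v s' ->
  block_decay f (t * u + (1 - t) * v) (t * s + (1 - t) * s').
Proof.
move=> u0 v0 t01 [A A0 hA] [B B0 hB].
exists (A `^ t * B `^ (1 - t)); first by rewrite mulr_gt0// powR_gt0.
move=> j; have := lyapunov u0 v0 t01 (measurable_block_abs f j) (block_abs_ge0 f j)
  (mulr_gt0 A0 (pow2_gt0 _)) (mulr_gt0 B0 (pow2_gt0 _)) (hA j) (hB j).
apply: Lnorm_ge0_le; rewrite le_eqVlt; apply/orP; left; apply/eqP.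
rewrite !powRM ?powR_ge0// ?ltW// -!powRrM mulrACA -pow2D.
by congr (_ * 2 `^ _); ring.
Qed.

Lemma normc_horner_le (P : {poly R[i]}) (z : R[i]) : normc z = 1 ->
  normc P.[z] <= \sum_(i < size P) normc P`_i.
Proof.
move=> z1; rewrite horner_coef; apply: le_trans (normc_sum _ _ _) _.
by apply: ler_sum => i _; rewrite Normc.normcM normcX z1 expr1n mulr1.
Qed.

Lemma size_block_poly f j : (size (block_poly f j) <= 2 ^ j.+2)%N.
Proof. exact: size_poly. Qed.

Lemma coef_block_poly f j (k : int) : (`|k| < 2 ^ j.+1)%N ->
  (block_poly f j)`_(absz (k + (2 ^ j.+1)%:Z)) = (dy j k%:~R)%:C * fourier f k.
Proof.
move=> kK; rewrite coef_poly (_ : (_ < _)%N = true); last first.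
  by move: kK; rewrite [(2 ^ j.+2)%N]expnS; move: (2 ^ j.+1)%N => K; lia.
rewrite (_ : Posz (absz (k + (2 ^ j.+1)%:Z)) - (2 ^ j.+1)%:Z = k)//.
by move: kK; move: (2 ^ j.+1)%N => K; lia.
Qed.

(** The trivial bound of a block by the sum of its coefficients does not depend on
    the exponent, so a single s serves for all u. *)
Lemma exists_block_decay f : exists s0, forall u, 0 <= u -> block_decay f u s0.
Proof.
have [n [C C0 hC]] := fourier_growth f.
exists (- n.+1%:R) => u u0; exists (C * 4 ^+ n.+1); first by rewrite mulr_gt0// exprn_gt0.
move=> j; apply: Lnorm_le_of_bound => //.
- by rewrite !mulr_ge0 ?powR_ge0 ?exprn_ge0 ?(ltW C0).
- exact: measurable_block_abs.
- exact: block_abs_ge0.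
move=> x; apply: le_trans (normc_horner_le _ (normc_expc x)) _.
apply: (@le_trans _ _ (\sum_(i < size (block_poly f j)) C * (2 ^+ j.+2) ^+ n)).
  apply: ler_sum => i _; rewrite coef_poly; case: ifP => iK; last first.
    by rewrite Normc.normc0 mulr_ge0 ?(ltW C0)// exprn_ge0// exprn_ge0.
  rewrite Normc.normcM normc_real ger0_norm ?dyadic_ge0//.
  apply: le_trans (ler_piMl (normc_ge0 _) (dyadic_le1 _ _)) _.
  apply: (le_trans (hC _)); rewrite ler_wpM2l ?(ltW C0)//.
  apply: lerXn2r; rewrite ?nnegrE ?ler0n ?exprn_ge0//.
  by rewrite -natrX ler_nat; move: iK; rewrite expnS; have := expn_gt0 2 j.+1; lia.
rewrite sumr_const card_ord -[leLHS]mulr_natr -[leLHS]mulrA -[leRHS]mulrA ler_wpM2l ?(ltW C0)//.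
rewrite mulrN opprK powRrM powR_mulrn// powR_mulrn ?exprn_ge0// -exprMn.
apply: (@le_trans _ _ ((2 ^+ j.+2) ^+ n * 2 ^+ j.+2)).
  by rewrite ler_wpM2l ?exprn_ge0// ?exprn_ge0// -natrX ler_nat; exact: size_block_poly.
by rewrite -exprSr !exprS mulrA -natrM.
Qed.

(** P^m is a polynomial whose L_1 norm is the m-th power of the quasi-norm of P;
    its coefficients are bounded by that norm, and its values by their sum. *)
Lemma nikolskii (P : {poly R[i]}) (m : nat) (A : R) (x : R) : (0 < m)%N -> 0 <= A ->
  (Lnorm mu (m%:R^-1%:E^-1) (EFin \o (fun x => normc P.[expc x])) <= A%:E)%E ->
  normc P.[expc x] ^+ m <= (m * size P)%:R * (2 * A ^+ m).
Proof.
move=> m0 A0 hA.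
have mi : 0 < m%:R^-1 :> R by rewrite invr_gt0 ltr0n.
have hP : (Lnorm mu (1%:E^-1) (EFin \o (fun x => normc (P ^+ m).[expc x])) <= (A ^+ m)%:E)%E.
  apply/Lnorm_inv_gt0P => //; [by move=> y; exact: normc_ge0|exact: exprn_ge0|].
  move: hA => /(Lnorm_inv_gt0P mi (fun y => normc_ge0 _) A0).
  rewrite invrK invr1 (powR_mulrn _ A0) (powRr1 (exprn_ge0 _ A0)).
  have -> : (fun y => ((normc P.[expc y]) `^ m%:R)%:E) =
      (fun y => ((normc (P ^+ m).[expc y]) `^ 1)%:E).
    apply/funext => y; congr EFin.
    by rewrite (powR_mulrn _ (normc_ge0 _)) (powRr1 (normc_ge0 _)) horner_exp normcX.
  by [].
rewrite -normcX -horner_exp; apply: le_trans (normc_horner_le _ (normc_expc x)) _.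
apply: (@le_trans _ _ (\sum_(i < size (P ^+ m)) 2 * A ^+ m)).
  by apply: ler_sum => i _; apply: coef_le_Lnorm1 => //; exact: exprn_ge0.
rewrite sumr_const card_ord -[leLHS]mulr_natl ler_wpM2r ?mulr_ge0 ?exprn_ge0// ler_nat.
have [->|Pn0] := eqVneq P 0; first by rewrite expr0n gtn_eqF// size_poly0.
apply: leq_trans (size_poly_exp_leq _ _) _.
have : (0 < size P)%N by rewrite size_poly_gt0.
by case: (size P) => // k _; move: m0; rewrite /=; nia.
Qed.

Lemma block_decay_nikolskii f s m : (0 < m)%N ->
  block_decay f (m%:R^-1) s -> block_decay f 0 (s - m%:R^-1).
Proof.
move=> m0 [C C0 hC]; have m1 : 0 < m%:R :> R by rewrite ltr0n.
exists ((8 * m%:R) `^ m%:R^-1 * C); first by rewrite mulr_gt0// powR_gt0// mulr_gt0.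
move=> j; apply: Lnorm_le_of_bound => //.
- by rewrite !mulr_ge0 ?powR_ge0 ?(ltW C0).
- exact: measurable_block_abs.
- exact: block_abs_ge0.
move=> x; have A0 : 0 <= C * 2 `^ (- (j%:R * s)) by rewrite mulr_ge0 ?powR_ge0 ?(ltW C0).
have h := nikolskii x m0 A0 (hC j).
rewrite -[block_abs f j x]powRr1 ?block_abs_ge0// -(divff (lt0r_neq0 m1)) powRrM.
rewrite powR_mulrn ?block_abs_ge0//.
apply: (@le_trans _ _ ((8 * m%:R * 2 ^+ j * (C * 2 `^ (- (j%:R * s))) ^+ m) `^ m%:R^-1)).
  apply: ge0_ler_powR; rewrite ?nnegrE ?invr_ge0 ?(ltW m1) ?exprn_ge0 ?block_abs_ge0//.
    by rewrite !mulr_ge0 ?exprn_ge0 ?(ltW m1).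
  apply: (le_trans h).
  rewrite (_ : 8 * _ * _ * _ = (m * 2 ^ j.+2)%:R * (2 * (C * 2 `^ (- (j%:R * s))) ^+ m)); last first.
    by rewrite natrM natrX !exprS; ring.
  rewrite ler_wpM2r ?mulr_ge0 ?exprn_ge0// ler_nat leq_mul2l size_block_poly orbT//.
rewrite powRM ?mulr_ge0 ?exprn_ge0 ?(ltW m1)//.
rewrite powRM ?mulr_ge0 ?exprn_ge0 ?(ltW m1)//.
rewrite -[X in _ * _ * X `^ _]powR_mulrn// -powRrM divff ?gt_eqF// powRr1//.
have -> : (2 ^+ j) `^ m%:R^-1 = 2 `^ (j%:R * m%:R^-1) :> R by rewrite powRrM powR_mulrn.
rewrite (_ : - (j%:R * (s - m%:R^-1)) = j%:R * m%:R^-1 + - (j%:R * s)); last by ring.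
by rewrite pow2D le_eqVlt; apply/orP; left; apply/eqP; ring.
Qed.

(** Every frequency k is seen with weight at least 1/2 by a block of comparable
    index, so rapid decay of the blocks in L_1 is rapid decay of the Fourier
    coefficients; an arbitrary u reduces to 1 by interpolation with the growth
    bound at 0 or 2. *)
Lemma smooth_of_block_decay f u : 0 <= u -> (forall s, block_decay f u s) -> is_smooth f.
Proof.
move=> u0 hu.
have h1 s : block_decay f 1 s.
  have [s0 hs0] := exists_block_decay f.
  have [u1|u1] := leP u 1.
    (* 1 lies between u and 2, so decay at u pays for the growth at 2 *)
    pose t := (2 - u)^-1; have t2 : 0 < 2 - u by lra.
    have t0 : 0 < t by rewrite invr_gt0.
    have t1 : 0 <= t <= 1 by rewrite ltW//= invf_le1//; lra.
    have := block_decay_interpolate u0 (ler0n R 2) t1 (hu ((s - (1 - t) * s0) / t)) (hs0 2 (ler0n R 2)).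
    have -> : t * u + (1 - t) * 2 = 1 by rewrite /t; field; rewrite gt_eqF.
    have -> : t * ((s - (1 - t) * s0) / t) + (1 - t) * s0 = s by field; rewrite gt_eqF.
    by [].
  have up : 0 < u by rewrite (lt_trans ltr01).
  have t1 : 0 <= u^-1 <= 1 by rewrite invr_ge0 u0 invf_le1// ltW.
  have := block_decay_interpolate u0 (lexx 0) t1 (hu ((s - (1 - u^-1) * s0) * u)) (hs0 0 (lexx 0)).
  have -> : u^-1 * u + (1 - u^-1) * 0 = 1 by field; rewrite gt_eqF.
  have -> : u^-1 * ((s - (1 - u^-1) * s0) * u) + (1 - u^-1) * s0 = s by field; rewrite gt_eqF.
  by [].
apply: smooth_of_fourier_decay => m; have [C C0 hC] := h1 m%:R.
exists (4 * C * 2 ^+ m) => k.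
have [j hj] := dyadic_ge_half k%:~R; rewrite -intr_norm -abszE -natrX -pmulrn ltr_nat => kj.
have := coef_le_Lnorm1 (absz (k + (2 ^ j.+1)%:Z)) _ (hC j).
rewrite coef_block_poly// Normc.normcM normc_real ger0_norm ?dyadic_ge0//.
move=> /(_ (mulr_ge0 (ltW C0) (powR_ge0 _ _))) h.
have hk : normc (fourier f k) <= 4 * (C * 2 `^ (- (j%:R * m%:R))).
  have := normc_ge0 (fourier f k); move: h hj.
  set a := dy _ _; set b := normc _; set c := C * _ => h hj b0.
  have : 2^-1 * b <= a * b by rewrite ler_wpM2r.
  lra.
apply: (@le_trans _ _ (4 * (C * 2 `^ (- (j%:R * m%:R))) * (2 ^+ j.+1) ^+ m)).
  apply: ler_pM => //; rewrite ?normc_ge0 ?exprn_ge0//.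
  by apply: lerXn2r; rewrite ?nnegrE ?ler0n ?exprn_ge0// -natrX ler_nat.
rewrite powRN powRrM !powR_mulrn ?powR_ge0// exprS exprMn [2 ^+ m * _]mulrC.
by rewrite !mulrA mulfVK// expf_neq0// expf_neq0.
Qed.

Lemma exists_recip (p : \bar R) : (0 < p)%E -> exists2 u : R, 0 <= u & p = (u%:E^-1)%E.
Proof.
case: p => [r| |//]; last by move=> _; exists 0; rewrite ?inve0.
rewrite lte_fin => r0; exists r^-1; first by rewrite invr_ge0 ltW.
by rewrite inver invr_eq0 (gt_eqF r0) invrK.
Qed.

Lemma is_critical_smoothness_functionP f (s : \bar R -> R) :
  (forall u, 0 <= u -> ereal_sup [set x%:E | x in block_decay f u] = (recip_arg s u)%:E) ->
  is_critical_smoothness_function phi0 phi1 f (fun p => (s p)%:E).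
Proof.
move=> h p q p0 q0; have [u u0 pu] := exists_recip p0.
by rewrite (critical_smoothnessE f pu q0) h// pu.
Qed.

(** Concavity turns a lower bound into monotonicity, since a negative slope would
    persist to the right, and it makes the slopes at 0 dominate all others; the
    latter are approximated at the points 1/m. *)
Lemma concave_nondec_lipschitz (g : R -> R) (s0 : R) :
  (forall u, 0 <= u -> s0 <= g u) ->
  (forall t u v : R, 0 <= t <= 1 -> 0 <= u -> 0 <= v ->
         t * g u + (1 - t) * g v <= g (t * u + (1 - t) * v)) ->
  (forall m : nat, (0 < m)%N -> g m%:R^-1 <= g 0 + m%:R^-1) ->
  nondec_concave_1lipschitz g.
Proof.
move=> gs0 conc gm.
have mono u v : 0 <= u -> u <= v -> g u <= g v.
  move=> u0; rewrite le_eqVlt => /predU1P[->//|uv].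
  have vu : 0 < v - u by rewrite subr_gt0.
  apply/ler_addgt0Pr => e e0; pose d := g u - s0.
  have d0 : 0 <= d by rewrite subr_ge0 gs0.
  (* v is t u + (1 - t) w with w so far to the right of v that (1 - t) d <= e *)
  pose w := v + (v - u) * (d / e).
  have hw : 0 <= (v - u) * (d / e) by rewrite mulr_ge0 ?(ltW vu)// divr_ge0// ltW.
  have wu : 0 < w - u by rewrite /w; lra.
  pose t := (w - v) / (w - u).
  have t01 : 0 <= t <= 1.
    rewrite /t divr_ge0 ?(ltW wu)//=; last by rewrite /w; lra.
    by rewrite ler_pdivrMr// mul1r lerD2l lerN2 ltW.
  have w0 : 0 <= w by lra.
  have := conc t u w t01 u0 w0.
  have -> : t * u + (1 - t) * w = v by rewrite /t; field; rewrite gt_eqF.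
  have t1 : 1 - t = (v - u) / (w - u) by rewrite /t; field; rewrite gt_eqF.
  have hd : (1 - t) * d <= e.
    rewrite t1 mulrAC ler_pdivrMr// /w.
    have -> : e * (v + (v - u) * (d / e) - u) = e * (v - u) + (v - u) * d.
      by field; rewrite gt_eqF.
    by rewrite lerDr mulr_ge0 ?(ltW e0) ?(ltW vu).
  move=> h; have h2 : (1 - t) * s0 <= (1 - t) * g w.
    by apply: ler_wpM2l; [move: t01 => /andP[? ?]; rewrite subr_ge0|exact: gs0].
  by move: hd; rewrite /d mulrBr; lra.
have slope0 v : 0 < v -> g v - g 0 <= v.
  move=> v0; pose m := (Num.truncn v^-1).+1.
  have mv : v^-1 < m%:R := truncnS_gt _.
  have m0 : 0 < m%:R :> R by rewrite ltr0n.
  pose l := (m%:R * v)^-1.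
  have mv1 : 1 < m%:R * v by rewrite -ltr_pdivrMr// mul1r.
  have l0 : 0 < l by rewrite invr_gt0 (lt_trans ltr01).
  have l01 : 0 <= l <= 1 by rewrite ltW//= invf_le1 ?ltW// (lt_trans ltr01).
  have := conc l v 0 l01 (ltW v0) (lexx 0).
  rewrite mulr0 addr0 (_ : l * v = m%:R^-1); last by rewrite /l; field; rewrite !gt_eqF.
  move=> /le_trans /(_ (gm m isT)) h.
  rewrite -(ler_pM2l l0) (_ : l * v = m%:R^-1); last by rewrite /l; field; rewrite !gt_eqF.
  by rewrite mulrBr; move: h; rewrite mulrBl mul1r; lra.
have slope u v : 0 <= u -> u <= v -> g v - g u <= v - u.
  rewrite le_eqVlt => /predU1P[<-|u0].
    rewrite le_eqVlt => /predU1P[<-|]; first by rewrite !subrr.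
    by rewrite subr0; exact: slope0.
  move=> uv; have v0 : 0 < v by apply: lt_le_trans uv.
  pose l := u / v.
  have l01 : 0 <= l <= 1 by rewrite divr_ge0 ?(ltW u0) ?(ltW v0)//= ler_pdivrMr// mul1r.
  have := conc l v 0 l01 (ltW v0) (lexx 0).
  rewrite mulr0 addr0 (_ : l * v = u); last by rewrite /l divfK ?gt_eqF.
  have hs := slope0 v v0.
  have l1 : 0 <= 1 - l by case/andP: l01 => _; rewrite subr_ge0.
  have : (1 - l) * (g v - g 0) <= (1 - l) * v by rewrite ler_wpM2l.
  have -> : (1 - l) * v = v - u by rewrite /l; field; rewrite gt_eqF.
  by move=> h1 h2; move: h1; rewrite mulrBl mul1r mulrBr; move: h2; rewrite mulrBl mul1r; lra.
split => //.
- move=> u v; rewrite !inE /= !in_itv /= !andbT => u0 v0 uv; exact: mono.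
- move=> [u v] /= []; rewrite !in_itv /= !andbT mul1r => u0 v0.
  have [uv|vu] := leP u v.
    rewrite distrC [leRHS]distrC !ger0_norm ?subr_ge0 ?mono//; exact: slope.
  by rewrite !ger0_norm ?subr_ge0 ?mono ?(ltW vu)//; apply: slope => //; exact: ltW.
Qed.

(** The function s is defined by suprema of real sets, which are bounded because an
    unbounded one would make f smooth. *)
Lemma critical_smoothness_nonsmooth f : ~ is_smooth f ->
  exists s : \bar R -> R,
    is_critical_smoothness_function phi0 phi1 f (fun p => (s p)%:E) /\
    nondec_concave_1lipschitz (recip_arg s).
Proof.
move=> nf; have [s0 hs0] := exists_block_decay f.
pose A u := [set s | block_decay f u s].
pose s (p : \bar R) := sup (A (fine p^-1)).
have sE u : recip_arg s u = sup (A u) by rewrite /recip_arg /s inveK.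
have ne u : 0 <= u -> A u !=set0 by exists s0; exact: hs0.
have ub u : 0 <= u -> has_ubound (A u).
  move=> u0; apply: contrapT => nub; apply: nf.
  apply: (smooth_of_block_decay u0) => x.
  apply: contrapT => nx; apply: nub; exists x => y Ay.
  by rewrite leNgt; apply/negP => xy; apply: nx; apply: block_decay_le Ay; exact: ltW.
exists s; split.
  apply: is_critical_smoothness_functionP => u u0.
  by rewrite sE ereal_sup_EFin//; [exact: ub|exact: ne].
have le_g u x : 0 <= u -> block_decay f u x -> x <= recip_arg s u.
  by move=> u0 hx; rewrite sE; apply: ub_le_sup => //; exact: ub.
have g_adh u e : 0 <= u -> 0 < e -> exists2 x, block_decay f u x & recip_arg s u - e < x.
  by move=> u0 e0; rewrite sE; apply: sup_adherent => //; split; [exact: ne|exact: ub].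
apply: (@concave_nondec_lipschitz _ s0).
- by move=> u u0; apply: le_g => //; exact: hs0.
- move=> t u v t01 u0 v0; apply/ler_addgt0Pr => e e0.
  have [x hx xu] := g_adh u e u0 e0; have [y hy yv] := g_adh v e v0 e0.
  have w0 : 0 <= t * u + (1 - t) * v.
    by case/andP: t01 => t0 t1; rewrite addr_ge0// mulr_ge0// subr_ge0.
  have := le_g _ _ w0 (block_decay_interpolate u0 v0 t01 hx hy).
  rewrite -lerBlDr; apply: le_trans.
  case/andP: t01 => t0 t1; rewrite (_ : _ - e = t * (recip_arg s u - e) + (1 - t) * (recip_arg s v - e)); last by ring.
  by apply: lerD; apply: ler_wpM2l; rewrite ?subr_ge0// ltW.
- move=> m m0; have m1 : 0 <= m%:R^-1 :> R by rewrite invr_ge0.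
  apply/ler_addgt0Pr => e e0.
  have [x hx xu] := g_adh _ e m1 e0.
  have := le_g _ _ (lexx 0) (block_decay_nikolskii m0 hx); lra.
Qed.
End Dyadic.

(** * Finite differences *)

Section FiniteDifferences.
Variable R : realType.
Local Notation normc := Normc.normc.

Definition int_diff (u : int -> R) (k : int) : R := u k - u (k - 1).

(** The step h is that of the sampling points of the coefficients. *)
Definition step_diff (h : R) (F : R -> R) (t : R) : R := F t - F (t - h).

Lemma iter_int_diffS (u : int -> R) r k :
  iter r.+1 int_diff u k = iter r int_diff u k - iter r int_diff u (k - 1).
Proof. by []. Qed.

Lemma iter_step_diffS (h : R) F r t :
  iter r.+1 (step_diff h) F t = iter r (step_diff h) F t - iter r (step_diff h) F (t - h).
Proof. by []. Qed.

(** Differences of samples are samples of differences with the sampling step. *)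
Lemma iter_int_diff_sample (F : R -> R) (h c : R) r k :
  iter r int_diff (fun k => F (k%:~R * h + c)) k = iter r (step_diff h) F (k%:~R * h + c).
Proof.
elim: r k => [|r ih] k; first by [].
rewrite iter_int_diffS !ih iter_step_diffS.
have -> : (k - 1)%:~R * h + c = k%:~R * h + c - h by rewrite intrB mulrBl mul1r addrAC.
by [].
Qed.

Lemma step_diff_is_derive (h : R) (F F' : R -> R) r :
  (forall x : R, is_derive x 1 F (F' x)) ->
  forall x : R, is_derive x 1 (iter r (step_diff h) F) (iter r (step_diff h) F' x).
Proof.
move=> dF; elim: r => [//|r ih] x.
have d2 : is_derive x 1 (fun t => iter r (step_diff h) F (t - h)) (iter r (step_diff h) F' (x - h)).
  have := @is_derive1_comp R (iter r (step_diff h) F) (fun y => y - h) x _ _ (ih _) (is_derive_shift x 1 (- h)).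
  by rewrite mulr1.
exact: (is_deriveB (ih x) d2).
Qed.

(** Mean value theorem, one difference being traded for one derivative and a
    factor h at a time. *)
Lemma step_diff_bound (h B : R) (Fs : nat -> R -> R) r : 0 <= h ->
  (forall n (x : R), is_derive x 1 (Fs n) (Fs n.+1 x)) ->
  (forall x, `|Fs r x| <= B) ->
  forall t, `|iter r (step_diff h) (Fs 0%N) t| <= B * h ^+ r.
Proof.
move=> h0; elim: r Fs => [|r ih] Fs dFs hB t; first by rewrite mulr1; exact: hB.
have hB' := ih (fun n => Fs n.+1) (fun n => dFs n.+1) hB.
have := mvt_lipschitz (step_diff_is_derive h r (dFs 0%N)) hB' (t - h) t.
rewrite iter_step_diffS => /le_trans; apply.
by rewrite opprD opprK addrA subrr add0r ger0_norm// -mulrA exprSr.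
Qed.

Lemma iter_int_diffD (u v : int -> R) r k :
  iter r int_diff (fun k => u k + v k) k = iter r int_diff u k + iter r int_diff v k.
Proof.
elim: r k => [//|r ih] k; rewrite !iter_int_diffS !ih; ring.
Qed.

Lemma iter_int_diff_shift (u : int -> R) r k :
  iter r int_diff (fun k => u (k - 1)) k = iter r int_diff u (k - 1).
Proof. by elim: r k => [//|r ih] k; rewrite !iter_int_diffS !ih. Qed.

Lemma eq_iter_int_diff (u v : int -> R) r : u =1 v -> iter r int_diff u =1 iter r int_diff v.
Proof.
move=> uv; elim: r => [//|r ih] k; by rewrite !iter_int_diffS !ih.
Qed.

(** Discrete Leibniz rule.  The constant D must not depend on the step h or on the
    sequences, as it serves all blocks at once. *)
Lemma int_diff_mul_bound r (C1 C2 : nat -> R) : exists2 D, 0 <= D &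
  forall (h A B : R) (u v : int -> R), 0 <= h -> 0 <= A -> 0 <= B ->
  (forall s k, `|iter s int_diff u k| <= A * C1 s * h ^+ s) ->
  (forall s k, `|iter s int_diff v k| <= B * C2 s * h ^+ s) ->
  forall k, `|iter r int_diff (fun k => u k * v k) k| <= A * B * D * h ^+ r.
Proof.
elim: r C1 C2 => [|r ih] C1 C2.
  exists `|C1 0%N * C2 0%N| => // h A B u v h0 A0 B0 hu hv k /=.
  rewrite mulr1 normrM; apply: (@le_trans _ _ (A * C1 0%N * (B * C2 0%N))).
    by apply: ler_pM => //; [have := hu 0%N k|have := hv 0%N k]; rewrite mulr1.
  by rewrite mulrACA ler_wpM2l ?mulr_ge0// ler_norm.
have [D1 D10 h1] := ih (fun s => C1 s.+1) C2.
have [D2 D20 h2] := ih C1 (fun s => C2 s.+1).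
exists (D1 + D2); first by rewrite addr_ge0.
move=> h A B u v h0 A0 B0 hu hv k.
rewrite iterSr (@eq_iter_int_diff _ (fun k => int_diff u k * v k + u (k - 1) * int_diff v k)); last first.
  by move=> l; rewrite /int_diff; ring.
rewrite iter_int_diffD; apply: le_trans (ler_normD _ _) _.
rewrite mulrDr mulrDl; apply: lerD.
  have := h1 h (A * h) B (int_diff u) v h0 (mulr_ge0 A0 h0) B0 _ hv k.
  rewrite exprS (_ : A * h * B * D1 * h ^+ r = A * B * D1 * (h * h ^+ r)); last by ring.
  apply => s l; have := hu s.+1 l; rewrite iterSr exprS => /le_trans; apply.
  by rewrite le_eqVlt; apply/orP; left; apply/eqP; ring.
have := h2 h A (B * h) (fun k => u (k - 1)) (int_diff v) h0 A0 (mulr_ge0 B0 h0) _ _ k.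
rewrite exprS (_ : A * (B * h) * D2 * h ^+ r = A * B * D2 * (h * h ^+ r)); last by ring.
apply => s l; first by rewrite iter_int_diff_shift.
have := hv s.+1 l; rewrite iterSr exprS => /le_trans; apply.
by rewrite le_eqVlt; apply/orP; left; apply/eqP; ring.
Qed.

Lemma coef_diff_poly (P : {poly R[i]}) (u : int -> R) r :
  (forall m : nat, P`_m = (u m)%:C) -> (forall k : int, k < 0 -> u k = 0) ->
  (forall m : nat, ((1 - 'X) ^+ r * P)`_m = (iter r int_diff u m)%:C) /\
  (forall k : int, k < 0 -> iter r int_diff u k = 0).
Proof.
move=> Pu u0; elim: r => [|r [ih1 ih2]]; first by split=> [m|//]; rewrite mul1r.
split=> [m|k k0]; last by rewrite iter_int_diffS !ih2 ?subrr//; lia.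
rewrite exprS -mulrA mulrBl mul1r coefB coefXM ih1 iter_int_diffS rmorphB.
case: m => [|m]; last by rewrite ih1 /= intS addrAC subrr add0r.
have -> : iter r int_diff u (0%Z - 1) = 0 by apply: ih2.
by rewrite eqxx rmorph0.
Qed.

(** Summation by parts: (1 - X)^r P has the r-th differences of the coefficients
    of P as coefficients. *)
Lemma diff_poly_bound (P : {poly R[i]}) (u : int -> R) r N (B : R) z : normc z = 1 ->
  (forall m : nat, P`_m = (u m)%:C) -> (forall k : int, k < 0 -> u k = 0) ->
  (size P <= N)%N -> 0 <= B -> (forall k, `|iter r int_diff u k| <= B) ->
  normc (z - 1) ^+ r * normc P.[z] <= (N + r)%:R * B.
Proof.
move=> z1 Pu u0 sP B0 hB; have [c1 _] := coef_diff_poly r Pu u0.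
have -> : normc (z - 1) ^+ r * normc P.[z] = normc ((1 - 'X) ^+ r * P).[z].
  rewrite hornerM horner_exp hornerD hornerN hornerX hornerC Normc.normcM normcX.
  by rewrite -normc_opp opprB.
apply: le_trans (normc_horner_le _ z1) _.
apply: (@le_trans _ _ (\sum_(i < size ((1 - 'X) ^+ r * P)%R) B)).
  by apply: ler_sum => i _; rewrite c1 normc_real.
rewrite sumr_const card_ord -[leLHS]mulr_natl ler_wpM2r// ler_nat.
apply: leq_trans (size_polyMleq _ _) _.
have : (size ((1 - 'X : {poly R[i]}) ^+ r)%R <= r.+1)%N.
  apply: leq_trans (size_poly_exp_leq _ _) _; rewrite ltnS.
  have -> : size (1 - 'X : {poly R[i]})%R = 2%N by rewrite -size_polyN opprB size_XsubC.
  by rewrite mul1n.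
move=> h; rewrite -subn1 leq_subLR (_ : 1 + (N + r) = r.+1 + N)%N; last by lia.
exact: leq_add.
Qed.
End FiniteDifferences.

(** * Functions concentrated near a lattice *)

Section Concentration.
Variable R : realType.
Local Notation normc := Normc.normc.
Local Notation mu := (torus_measure R).

(** The points at distance of order lam 2^(-a) from the lattice 2^(-a) Z. *)
Definition near_lattice (a : nat) (lam : R) : set R :=
  [set x | normc (expc (2 ^+ a * x) - 1) <= lam].

Lemma measurable_near_lattice a lam : measurable (near_lattice a lam : set (measurableTypeR R)).
Proof.
have c1 : ccontinuous (fun x : R => expc (2 ^+ a * x) - 1).
  apply: ccontinuousD; last exact: ccontinuous_cst.
  rewrite (_ : (fun x => _) = expi R (2 ^ a)%N); first exact: ccontinuous_expi.
  by apply/funext => x; rewrite expiE -pmulrn natrX.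
have := measurable_normc c1 measurableT (measurable_itv `]-oo, lam]%R : measurable (`]-oo, lam] : set R)).
rewrite setTI; congr measurable; apply/seteqP.
Qed.

(** About 2^a intervals of length lam 2^(-a) cover the part in [0, 1]. *)
Lemma measure_near_lattice a lam : 0 < lam ->
  (mu (near_lattice a lam) <= (8 * lam)%:E)%E.
Proof.
move=> l0; have [l1|l1] := leP 1 lam.
  apply: (@le_trans _ _ (mu setT)).
    by apply: le_measure; rewrite ?inE//; exact: measurable_near_lattice.
  by rewrite torus_measureT lee_fin; lra.
have p0 : 0 < 2 ^+ a :> R by rewrite exprn_gt0.
pose I (m : nat) : set R := `[(m%:R - 1 - lam / 2) / 2 ^+ a, (m%:R - 1 + lam / 2) / 2 ^+ a].
have mI m : measurable (I m : set (measurableTypeR R)) by exact: measurable_itv.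
have sub : near_lattice a lam `&` `[0, 1] `<=` \big[setU/set0]_(m < 2 ^ a + 3) I m.
  move=> x [hx0]; rewrite /= in_itv /= => /andP[x0 x1].
  have hx : normc (expc (2 ^+ a * x) - 1) <= lam := hx0.
  rewrite normc_expc_sub1 in hx.
  have [k hk] := dist_int_le_sin (2 ^+ a * x).
  have : `|2 ^+ a * x - k%:~R| <= lam / 2 by move: hx hk; lra.
  rewrite ler_norml => /andP[k1 k2].
  have a0 : 0 <= 2 ^+ a * x by rewrite mulr_ge0// ltW.
  have a1 : 2 ^+ a * x <= 2 ^+ a by rewrite ler_piMr// ltW.
  have k0 : 0 <= k + 1.
    rewrite -(@ler_int R) intrD /=; apply: ltW; move: k2 a0; lra.
  have ka : k + 1 <= (2 ^ a + 2)%N%:Z.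
    rewrite -(@ler_int R) intrD /= -pmulrn natrD natrX; move: k1 a1; lra.
  have [m km] : exists m : nat, k + 1 = m%:Z by exists (absz (k + 1)); rewrite gez0_abs.
  have kR : k%:~R = m%:R - 1 :> R by rewrite -[k](addrK 1) km intrB -pmulrn.
  rewrite km lez_nat in ka.
  rewrite -bigcup_mkord; exists m; first by rewrite /= addnS ltnS.
  rewrite /I /= in_itv /= ler_pdivrMr// ler_pdivlMr// [x * _]mulrC.
  by apply/andP; split; move: k1 k2; rewrite kR; lra.
rewrite /torus_measure /= /mrestr.
apply: (@le_trans _ _ (lebesgue_measure (\big[setU/set0]_(m < 2 ^ a + 3) I m))).
  apply: le_measure; rewrite ?inE//.
    by apply: measurableI; [exact: measurable_near_lattice|exact: measurable_itv].
  by apply: bigsetU_measurable.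
have hB := @le_mu_bigsetU _ R (measurableTypeR R) (@lebesgue_measure R) I (2 ^ a + 3) (fun i _ => mI i).
apply: le_trans hB _.
have hI m : lebesgue_measure (I m) = (lam / 2 ^+ a)%:E.
  rewrite /I lebesgue_measure_itv /= lte_fin ifT.
    by rewrite -EFinB; congr EFin; field; rewrite gt_eqF.
  by rewrite ltr_pM2r ?invr_gt0//; lra.
rewrite (eq_bigr (fun=> (lam / 2 ^+ a)%:E)); last by move=> i _; exact: hI.
rewrite sumEFin sumr_const card_ord lee_fin -[leLHS]mulr_natl mulrA ler_pdivrMr//.
rewrite natrD natrX; have : 1 <= 2 ^+ a :> R by rewrite exprn_ege1// ler1n.
set t := 2 ^+ a; nra.
Qed.

Lemma integral_split_le (w : R -> R) (E : set (measurableTypeR R)) (p M N e : R) :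
  0 <= p -> measurable E -> measurable_fun setT w -> (forall x, 0 <= w x) ->
  0 <= M -> 0 <= N -> (forall x, w x <= M) -> (forall x, ~ E x -> w x <= N) ->
  (mu E <= e%:E)%E ->
  (\int[mu]_x (w x `^ p)%:E <= (M `^ p * e + N `^ p)%:E)%E.
Proof.
move=> p0 mE mw w0 M0 N0 wM wN hE.
have h := @integral_lin_le R (fun x => \1_E x) (fun=> 1) (M `^ p) (N `^ p) e 1.
have iE : (\int[mu]_x (\1_E x)%:E <= e%:E)%E by rewrite integral_indic// setIT.
have i1 : (\int[mu]_x (cst 1%:E x) <= 1%:E)%E by rewrite integral_cst// torus_measureT mule1.
have := h (measurable_indic mE) (measurable_cst _) (fun=> ler0n _ _) (fun=> ler01)
  (powR_ge0 _ _) (powR_ge0 _ _) iE i1.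
rewrite mulr1; apply: integral_le_of_ae.
- exact: measurable_powR_comp.
- apply: measurable_funD; last exact: measurable_cst.
  by apply: measurable_funM; [exact: measurable_cst|exact: measurable_indic].
- by move=> x; rewrite powR_ge0.
- by move=> x; rewrite addr_ge0 ?mulr_ge0 ?powR_ge0// ler0n.
apply: aeW => x; rewrite indicE.
have [xE|xE] := boolP (x \in E).
  rewrite mulr1; apply: (@le_trans _ _ (M `^ p)); last by rewrite lerDl powR_ge0.
  by apply: ge0_ler_powR; rewrite ?nnegrE.
rewrite mulr0 add0r; apply: ge0_ler_powR; rewrite ?nnegrE//.
by apply: wN => Ex; move/negP: xE; apply; rewrite inE.
Qed.

(** Splits the integral at distance lam from the lattice: the height M is used on a
    small set, the polynomial decay elsewhere. *)
Lemma Lnorm_concentrated_le (w : R -> R) (a r : nat) (u M K lam : R) :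
  0 < u -> 0 < lam -> measurable_fun setT w -> (forall x, 0 <= w x) ->
  0 <= M -> 0 <= K -> (forall x, w x <= M) ->
  (forall x, normc (expc (2 ^+ a * x) - 1) ^+ r * w x <= K) ->
  (Lnorm mu (u%:E^-1) (EFin \o w) <=
    ((M `^ u^-1 * (8 * lam) + (K / lam ^+ r) `^ u^-1) `^ u)%:E)%E.
Proof.
move=> u0 l0 mw w0 M0 K0 wM wK.
apply/Lnorm_inv_gt0P => //; first exact: powR_ge0.
rewrite -powRrM divff ?gt_eqF// powRr1; last first.
  by rewrite addr_ge0 ?powR_ge0// mulr_ge0 ?powR_ge0// mulr_ge0// ltW.
apply: (@integral_split_le _ (near_lattice a lam)) => //.
- by rewrite invr_ge0 ltW.
- exact: measurable_near_lattice.
- by rewrite divr_ge0// exprn_ge0// ltW.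
- move=> x /negP; rewrite -ltNge => hx.
  rewrite ler_pdivlMr ?exprn_gt0// mulrC; apply: le_trans (wK x).
  by rewrite ler_wpM2r//; apply: lerXn2r; rewrite ?nnegrE ?normc_ge0 ?(ltW l0) ?(ltW hx).
- exact: measure_near_lattice.
Qed.
End Concentration.

(** * Superposition of concentrated bumps *)

Section Construction.
Variables (R : realType) (phi0 phi1 : R -> R).
Hypothesis hphi : is_dyadic_partition phi0 phi1.
Variables (intercept slope : nat -> R) (s0 : R).
Hypothesis slope01 : forall j, 0 <= slope j <= 1.
Hypothesis intercept_ge : forall j, s0 <= intercept j.
Local Notation normc := Normc.normc.
Local Notation mu := (torus_measure R).
Local Notation dy := (dyadic phi0 phi1).

(** The set that carries the j-th bump has measure about 2^(- level j); the shift by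
    2 keeps the level below j. *)
Definition level (j : nat) : nat := (Num.truncn (slope j * (j%:R - 2))).+1.
(** The j-th bump is a function of 2^(dilation j) x, dilated from a kernel with
    about 2^(level j) frequencies. *)
Definition dilation (j : nat) : nat := (j.-1 - level j)%N.
Definition amplitude (j : nat) : R := 2 `^ (- (j%:R * intercept j)) * 2 ^- level j.
(** Only one index in four carries a bump, so that every block meets at most one
    bump. *)
Definition active (j : nat) : bool := (0 < j)%N && (4 %| j)%N.
Definition adjacent (i j : nat) : bool := (i <= j.+1)%N && (j <= i.+1)%N.
Definition bump_coef (j : nat) (k : int) : R :=
  if active j && (2 ^ dilation j %| `|k|)%N then amplitude j * dy j k%:~R else 0.
(** The sum is finite because the j-th bump has no frequency below j. *)
Definition bumps_coef (k : int) : R := \sum_(j < `|k|.+1) bump_coef j k.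

Lemma active_ge4 j : active j -> (4 <= j)%N.
Proof. by move=> /andP[j0 dj]; exact: dvdn_leq. Qed.

Lemma level_bounds j : active j -> [/\ (level j <= j.-1)%N, slope j * j%:R - 2 <= (level j)%:R &
  (level j)%:R <= slope j * j%:R + 1].
Proof.
move=> /active_ge4 j4; have /andP[b0 b1] := slope01 j.
have j2 : 2 <= j%:R :> R by rewrite ler_nat (leq_trans _ j4).
have x0 : 0 <= slope j * (j%:R - 2) by rewrite mulr_ge0// subr_ge0.
have /andP[t1 t2] := truncn_itv x0.
split.
- rewrite /level; case: j j4 b0 b1 j2 x0 t1 t2 => [//|j] j4 b0 b1 j2 x0 t1 t2 /=.
  have h : (Num.truncn (slope j.+1 * (j.+1%:R - 2)))%:R <= (j.-1)%:R :> R.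
    apply: (le_trans t1).
    have -> : (j.-1)%:R = j.+1%:R - 2 :> R.
      by case: j j4 {b0 b1 j2 x0 t1 t2} => [//|j] _; rewrite -[j.+2%:R]natr1 -[j.+1%:R]natr1 /=; ring.
    by rewrite ler_piMl// subr_ge0.
  move: h; rewrite ler_nat; case: j j4 {b0 b1 j2 x0 t1 t2} => [//|j] _ h.
  by rewrite ltnS.
- by rewrite /level; apply: le_trans (ltW t2); rewrite mulrBr lerD2l lerN2; lra.
- by rewrite /level -natr1 lerD2r; apply: (le_trans t1); rewrite mulrBr gerDl oppr_le0 mulr_ge0.
Qed.

Lemma amplitude_gt0 j : 0 < amplitude j.
Proof. by rewrite mulr_gt0// ?powR_gt0// invr_gt0 exprn_gt0. Qed.

Lemma dyadic_adjacent i j x : dy i x != 0 -> dy j x != 0 -> adjacent i j.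
Proof.
move=> /(dyadic_supp hphi)[i1 i2] /(dyadic_supp hphi)[j1 j2].
have key a b (A B : nat) : `|x| < 2 ^+ a.+1 -> ((0 < b)%N -> 2 ^+ b.-1 < `|x|) -> (b <= a.+1)%N.
  move=> h1; case: b => [//|b] /(_ isT) h2; have := lt_trans h2 h1.
  by rewrite ltr_eXn2l ?ltr1n.
by rewrite /adjacent (key j i)// (key i j).
Qed.

Lemma active_adjacent_uniq i j j' : active j -> active j' -> adjacent i j -> adjacent i j' -> j = j'.
Proof.
move=> /andP[_ /dvdnP[a ->]] /andP[_ /dvdnP[b ->]] /andP[h1 h2] /andP[h3 h4]; lia.
Qed.

Lemma bump_coef_far i j k : ~~ (active j && adjacent i j) -> dy i k%:~R * bump_coef j k = 0.
Proof.
move=> h; rewrite /bump_coef; case: ifP => [/andP[aj _]|_]; last by rewrite mulr0.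
have [->|di] := eqVneq (dy i k%:~R) 0; first by rewrite mul0r.
have [->|dj] := eqVneq (dy j k%:~R) 0; first by rewrite !mulr0.
by case/negP: h; rewrite aj (dyadic_adjacent di dj).
Qed.

Lemma bump_coef_big j k : (`|k| < j)%N -> bump_coef j k = 0.
Proof.
move=> kj; rewrite /bump_coef; case: ifP => // _.
have [->|dj] := eqVneq (dy j k%:~R) 0; first by rewrite mulr0.
have [_ h] := dyadic_supp hphi dj.
have j0 : (0 < j)%N by apply: leq_ltn_trans kj.
move: (h j0); rewrite -intr_norm -abszE -natrX -pmulrn ltr_nat => h2.
have : (j.-1 < 2 ^ j.-1)%N by rewrite ltn_expl.
by move: h2 kj j0; case: (j) => // n /=; lia.
Qed.

Lemma bumps_coef_adjacent i j k : active j -> adjacent i j -> dy i k%:~R * bumps_coef k = dy i k%:~R * bump_coef j k.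
Proof.
move=> aj nij; rewrite /bumps_coef mulr_sumr.
have z (j' : nat) : j' != j -> dy i k%:~R * bump_coef j' k = 0.
  move=> jj; apply: bump_coef_far; apply/negP => /andP[aj' nij'].
  by move/eqP: jj; apply; apply: active_adjacent_uniq aj' aj nij' nij.
have [jk|jk] := ltnP j `|k|.+1.
  by rewrite (bigD1 (Ordinal jk))//= big1 ?addr0// => i' ii'; rewrite z.
rewrite bump_coef_big// mulr0 big1// => j' _; apply: z.
by rewrite (ltn_eqF (leq_trans (ltn_ord j') jk)).
Qed.

Lemma bumps_coef_far i k : (forall j, ~~ (active j && adjacent i j)) -> dy i k%:~R * bumps_coef k = 0.
Proof. by move=> h; rewrite /bumps_coef mulr_sumr big1// => j _; rewrite bump_coef_far. Qed.

(** The slopes only help; the lower bound on the intercepts limits the growth. *)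
Lemma bumps_coef_growth : exists n C, forall k, normc (bumps_coef k)%:C <= C * (`|k|%N.+1%:R) ^+ n.
Proof.
pose n := (Num.truncn `|s0|).+1.
have hn : `|s0| <= n%:R by apply: ltW; exact: truncnS_gt.
exists n.+1, (2 ^+ n) => k; rewrite normc_real.
apply: (le_trans (ler_norm_sum _ _ _)).
apply: (@le_trans _ _ (\sum_(j < `|k|.+1) (2 * `|k|%N.+1%:R) ^+ n)).
  apply: ler_sum => j _; rewrite /bump_coef; case: ifP => [/andP[aj _]|_]; last first.
    by rewrite normr0 exprn_ge0.
  have [->|dj] := eqVneq (dy j k%:~R) 0; first by rewrite mulr0 normr0 exprn_ge0.
  have [_ h] := dyadic_supp hphi dj; have j0 : (0 < j)%N by case/andP: aj.
  rewrite ger0_norm; last by rewrite mulr_ge0 ?(ltW (amplitude_gt0 _))// dyadic_ge0.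
  apply: (le_trans (ler_piMr (ltW (amplitude_gt0 _)) (dyadic_le1 hphi _ _))).
  apply: (@le_trans _ _ (2 `^ (- (j%:R * intercept j)))).
    by rewrite /amplitude ler_piMr ?powR_ge0// invf_le1 ?exprn_gt0// exprn_ege1// ler1n.
  apply: (@le_trans _ _ (2 `^ (j%:R * n%:R))).
    apply: pow2_le; rewrite -mulrN ler_wpM2l//; have := intercept_ge j.
    by move: hn; have := ler_norm (- s0); rewrite normrN; lra.
  rewrite powRrM !powR_mulrn ?powR_ge0//; apply: lerXn2r; rewrite ?nnegrE ?exprn_ge0//.
  move: (h j0); rewrite -intr_norm -abszE => h2.
  rewrite -[X in 2 ^+ X](prednK j0) exprS ler_wpM2l//.
  by apply: (le_trans (ltW h2)); rewrite -pmulrn ler_nat.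
rewrite sumr_const card_ord -[leLHS]mulr_natr exprMn -[leLHS]mulrA.
by rewrite -exprSr.
Qed.

Lemma sum_multiples (V : zmodType) (F : nat -> V) b q : (0 < b)%N ->
  (forall m, ~~ (b %| m)%N -> F m = 0) ->
  \sum_(m < b * q) F m = \sum_(l < q) F (b * l)%N.
Proof.
move=> b0 F0; elim: q => [|q ih]; first by rewrite muln0 !big_ord0.
rewrite mulnS addnC -(big_mkord xpredT F) (big_cat_nat (n := b * q))//=; last exact: leq_addr.
rewrite big_mkord ih big_ord_recr /=; congr (_ + _).
rewrite big_ltn; last by rewrite -[X in (X < _)%N]addn0 ltn_add2l.
rewrite big_nat_cond big1 ?addr0// => m; rewrite andbT => /andP[m1 m2].
apply: F0; apply/negP => /dvdnP[c mc]; move: m1 m2.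
rewrite mc ![(b * q)%N]mulnC -mulSnr !ltn_pmul2r// ltnS => h1 h2.
by move: (leq_trans h1 h2); rewrite ltnn.
Qed.

Variable f : periodic_gf R.
Hypothesis hf : forall k, fourier f k = (bumps_coef k)%:C.

(** The frequency 2^j belongs to the j-th bump, and to no other function of the
    partition. *)
Lemma coef_block_construct j : active j ->
  amplitude j <= normc (block_poly phi0 phi1 f j)`_(2 ^ j + 2 ^ j.+1).
Proof.
move=> aj; pose k : int := (2 ^ j)%N.
have -> : (2 ^ j + 2 ^ j.+1)%N = absz (k + (2 ^ j.+1)%:Z) by rewrite /k -PoszD.
have kj : (`|k| < 2 ^ j.+1)%N by rewrite /k absz_nat ltn_exp2l.
have kR : k%:~R = 2 ^+ j :> R by rewrite /k -pmulrn natrX.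
have nj : adjacent j j by rewrite /adjacent !leqnSn.
have [hL _ _] := level_bounds aj.
rewrite coef_block_poly// hf -rmorphM normc_real (bumps_coef_adjacent _ aj nj) /bump_coef aj.
rewrite kR (dyadic_pow2 hphi) mul1r /k absz_nat dvdn_exp2l; last by rewrite /dilation; have := active_ge4 aj; lia.
by rewrite /= mulr1 ler_norm.
Qed.

(** The coefficients of block i restricted to the multiples of 2^(dilation j), with
    the shift that makes their indices nonnegative; the amplitude is left out. *)
Definition profile (i j : nat) (m : int) : R :=
  dy i ((2 ^ dilation j)%:Z * (m - (2 ^ (i.+1 - dilation j))%:Z))%:~R *
  dy j ((2 ^ dilation j)%:Z * (m - (2 ^ (i.+1 - dilation j))%:Z))%:~R.

Definition profile_poly (i j : nat) : {poly R[i]} :=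
  \poly_(m < 2 ^ (i.+2 - dilation j)) (profile i j m)%:C.

Lemma profile_out i j (m : int) : active j -> adjacent i j ->
  (m < 0) || ((2 ^ (i.+2 - dilation j))%:Z <= m) -> profile i j m = 0.
Proof.
move=> aj /andP[n1 n2] hm; rewrite /profile.
set k : int := (_ * _)%R.
have [->|di] := eqVneq (dy i k%:~R) 0; first by rewrite mul0r.
have [h _] := dyadic_supp hphi di; exfalso.
move: h; rewrite -intr_norm -abszE -natrX -pmulrn ltr_nat.
have j4 := active_ge4 aj.
have e1 : (2 ^ i.+1 = 2 ^ dilation j * 2 ^ (i.+1 - dilation j))%N.
  by rewrite -expnD subnKC// /dilation; lia.
have e2 : (2 ^ (i.+2 - dilation j) = 2 * 2 ^ (i.+1 - dilation j))%N.
  by rewrite -expnS subSn// /dilation; lia.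
rewrite /k abszM absz_nat e1 ltn_pmul2l ?expn_gt0//.
by move: hm; rewrite e2; move: (2 ^ (i.+1 - dilation j))%N => K; lia.
Qed.

Lemma coef_profile_poly i j (m : nat) : active j -> adjacent i j ->
  (profile_poly i j)`_m = (profile i j m)%:C.
Proof.
move=> aj nij; rewrite coef_poly; case: ifP => // hm.
by rewrite profile_out// lez_nat leqNgt hm orbT.
Qed.

Lemma block_abs_profile i j x : active j -> adjacent i j ->
  block_abs phi0 phi1 f i x = amplitude j * normc (profile_poly i j).[expc (2 ^+ dilation j * x)].
Proof.
move=> aj nij; have j4 := active_ge4 aj.
have ai : (dilation j <= i.+1)%N by move: nij; rewrite /adjacent /dilation; lia.
rewrite /block_abs /block_poly horner_poly.
have eq2 : (2 ^ i.+2 = 2 ^ dilation j * 2 ^ (i.+2 - dilation j))%N.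
  by rewrite -expnD subnKC// ltnW.
have eq1 : (2 ^ i.+1 = 2 ^ dilation j * 2 ^ (i.+1 - dilation j))%N by rewrite -expnD subnKC.
pose F (m : nat) : R[i] := (dy i (m%:Z - (2 ^ i.+1)%:Z)%:~R)%:C *
   fourier f (m%:Z - (2 ^ i.+1)%:Z) * expc x ^+ m.
have F0 m : ~~ (2 ^ dilation j %| m)%N -> F m = 0.
  move=> hm; rewrite /F hf -rmorphM (bumps_coef_adjacent _ aj nij) /bump_coef ifF ?mulr0 ?mul0r//.
  apply/negbTE; rewrite aj /=; apply: contra hm => hm.
  have hz : ((2 ^ dilation j)%N%:Z %| m%:Z - (2 ^ i.+1)%N%:Z)%Z by rewrite dvdzE absz_nat.
  suff : ((2 ^ dilation j)%N%:Z %| m%:Z)%Z by rewrite dvdzE !absz_nat.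
  by rewrite -[m%:Z](subrK (2 ^ i.+1)%N%:Z) rpredD// dvdzE !absz_nat dvdn_exp2l.
have sE n : n = (2 ^ dilation j * 2 ^ (i.+2 - dilation j))%N ->
    \sum_(m < n) F m = \sum_(l < 2 ^ (i.+2 - dilation j)) F (2 ^ dilation j * l)%N.
  by move=> ->; apply: sum_multiples => //; rewrite expn_gt0.
rewrite -[X in normc X]/(\sum_(m < 2 ^ i.+2) F m) (sE _ eq2).
rewrite -(ger0_norm (ltW (amplitude_gt0 j))) -normc_real -Normc.normcM horner_poly mulr_sumr.
congr normc; apply: eq_bigr => l _.
have kE : (2 ^ dilation j * l)%N%:Z - (2 ^ i.+1)%:Z = (2 ^ dilation j)%:Z * (l%:Z - (2 ^ (i.+1 - dilation j))%:Z).
  by rewrite eq1 !PoszM mulrBr.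
rewrite /F hf -rmorphM (bumps_coef_adjacent _ aj nij) kE /bump_coef aj abszM absz_nat dvdn_mulr//=.
rewrite [RHS]mulrA -[X in _ = X * _]rmorphM /profile; congr (_%:C * _); first by ring.
by rewrite exprM -expcMn natrX.
Qed.

Lemma dyadic_sample i (b K : nat) (m : int) : (0 < i)%N ->
  dy i (b%:Z * (m - K%:Z))%:~R =
  phi1 (m%:~R * (b%:R / 2 ^+ i.-1) + - (K%:R * (b%:R / 2 ^+ i.-1))).
Proof.
case: i => [//|i] _ /=; congr phi1.
by rewrite intrM intrB -!pmulrn; ring.
Qed.

(** Each of the two factors samples phi1 with a step comparable to 2^(- level j),
    the index i being within one of j. *)
Lemma profile_diff_bound r : exists2 D, 0 <= D & forall i j, active j -> adjacent i j ->
  forall k, `|iter r (@int_diff R) (profile i j) k| <= D * (2 ^- level j) ^+ r.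
Proof.
have [[_ [sm bd]] _ _ _ _] := hphi.
have hB s : {C : R | forall x, `|derive1n s phi1 x| <= C}.
  by apply: cid; have [C hC] := bd 0%N s; exists C => x; have := hC x; rewrite mul1r.
pose B s := projT1 (hB s).
have BP s x : `|derive1n s phi1 x| <= B s := projT2 (hB s) x.
have [D D0 hD] := int_diff_mul_bound r (fun s => B s * 2 ^+ s) (fun s => B s * 2 ^+ s).
exists D => // i j aj nij k; have j4 := active_ge4 aj; have [hL _ _] := level_bounds aj.
have hl0 : 0 <= 2 ^- level j :> R by rewrite invr_ge0 exprn_ge0.
have key i' c : (j <= i'.+1)%N -> (0 < i')%N -> forall s k,
   `|iter s (@int_diff R) (fun m : int => phi1 (m%:~R * ((2 ^ dilation j)%N%:R / 2 ^+ i'.-1) + c)) k| <=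
   1 * (B s * 2 ^+ s) * (2 ^- level j) ^+ s.
  move=> ji i0 s l; set h := _ / _.
  have h0 : 0 <= h by rewrite /h divr_ge0 ?ler0n ?exprn_ge0.
  rewrite iter_int_diff_sample mul1r.
  apply: le_trans (step_diff_bound h0 (fun n x => is_derive_derive1n n x sm) (BP s) _) _.
  have Bs : 0 <= B s by apply: le_trans (BP s 0).
  rewrite -mulrA ler_wpM2l// -exprMn; apply: lerXn2r; rewrite ?nnegrE ?mulr_ge0//.
  rewrite /h ler_pdivrMr ?exprn_gt0// mulrAC ler_pdivlMr ?exprn_gt0//.
  rewrite natrX -exprD -exprS prednK// ler_weXn2l ?ler1n//.
  by rewrite /dilation; move: hL ji j4; lia.
have nij' := nij; move: nij'; rewrite /adjacent => /andP[n1 n2].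
have i0 : (0 < i)%N by move: n2 j4; lia.
have j0 : (0 < j)%N by move: j4; lia.
rewrite (@eq_iter_int_diff _ _ (fun m => phi1 (m%:~R * ((2 ^ dilation j)%N%:R / 2 ^+ i.-1) +
    - ((2 ^ (i.+1 - dilation j))%N%:R * ((2 ^ dilation j)%N%:R / 2 ^+ i.-1))) *
  phi1 (m%:~R * ((2 ^ dilation j)%N%:R / 2 ^+ j.-1) +
    - ((2 ^ (i.+1 - dilation j))%N%:R * ((2 ^ dilation j)%N%:R / 2 ^+ j.-1))))); last first.
  by move=> m; rewrite /profile !dyadic_sample.
have := hD _ 1 1 _ _ hl0 ler01 ler01 (key i _ n2 i0) (key j _ (leqnSn j) j0) k.
by rewrite !mul1r; apply.
Qed.

(** Combines the number 2^(level j) of coefficients, which the amplitude cancels,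
    with the size of their r-th differences. *)
Lemma block_abs_concentrated r : exists2 D, 0 <= D & forall i j x, active j -> adjacent i j ->
  normc (expc (2 ^+ dilation j * x) - 1) ^+ r * block_abs phi0 phi1 f i x <=
  D * 2 `^ (- (j%:R * intercept j)) * (2 ^- level j) ^+ r.
Proof.
have [D D0 hD] := profile_diff_bound r.
exists ((16 + r%:R) * D); first by rewrite mulr_ge0// addr_ge0.
move=> i j x aj nij; have j4 := active_ge4 aj; have [hL _ _] := level_bounds aj.
rewrite (block_abs_profile x aj nij) mulrCA.
have hl0 : 0 < 2 ^- level j :> R by rewrite invr_gt0 exprn_gt0.
have := @diff_poly_bound R (profile_poly i j) (profile i j) r _ (D * (2 ^- level j) ^+ r)
  (expc (2 ^+ dilation j * x)) (normc_expc _) (fun m => coef_profile_poly m aj nij) _ (size_poly _ _).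
move=> /(_ _ _ (hD i j aj nij)) h.
have {}h : normc (expc (2 ^+ dilation j * x) - 1) ^+ r * normc (profile_poly i j).[expc (2 ^+ dilation j * x)] <=
   (2 ^ (i.+2 - dilation j) + r)%:R * (D * (2 ^- level j) ^+ r).
  apply: h; last by rewrite mulr_ge0// exprn_ge0// ltW.
  by move=> k k0; apply: profile_out => //; rewrite k0.
apply: (le_trans (ler_wpM2l (ltW (amplitude_gt0 j)) h)).
rewrite /amplitude; set E := 2 `^ _; set T := (2 ^- level j) ^+ r.
rewrite (_ : (16 + r%:R) * D * E * T = E * ((16 + r%:R) * (D * T))); last by ring.
rewrite -[E / _ * _]mulrA; apply: ler_wpM2l; first exact: powR_ge0.
rewrite (mulrA (2 ^- level j)).
apply: ler_wpM2r.
  by apply: mulr_ge0 => //; apply: exprn_ge0; exact: ltW.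
rewrite mulrC ler_pdivrMr ?exprn_gt0// natrD mulrDl natrX; apply: lerD.
  rewrite (_ : (16 : R) = 2 ^+ 4); last by rewrite -natrX.
  rewrite -exprD ler_weXn2l ?ler1n//.
  by move: nij; rewrite /adjacent /dilation; move: hL j4; lia.
by rewrite ler_peMr// exprn_ege1// ler1n.
Qed.

Lemma level_pow j : active j -> 2 ^- level j <= 4 * 2 `^ (- (slope j * j%:R)) :> R.
Proof.
move=> aj; have [_ h _] := level_bounds aj.
have -> : 2 ^- level j = 2 `^ (- (level j)%:R) :> R by rewrite powRN powR_mulrn.
have -> : (4 : R) = 2 `^ 2 by rewrite powR_mulrn// -natrX.
by rewrite -pow2D; apply: pow2_le; lra.
Qed.

(** The distance to the lattice at which the norm is split is taken slightly
    larger than 2^(- level j), by the factor 2^(j e / u); then a large order r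
    makes the contribution of the tail negligible. *)
Lemma construct_upper u e : 0 <= u -> 0 < e -> exists2 C, 0 < C &
  forall i j, active j -> adjacent i j ->
  (Lnorm mu (u%:E^-1) (EFin \o block_abs phi0 phi1 f i) <=
    (C * 2 `^ (- (j%:R * (intercept j + slope j * u - e))))%:E)%E.
Proof.
have [D0 D00 h0] := block_abs_concentrated 0.
have bd i j x : active j -> adjacent i j ->
   block_abs phi0 phi1 f i x <= D0 * 2 `^ (- (j%:R * intercept j)).
  by move=> aj nij; have := h0 i j x aj nij; rewrite !expr0 mul1r mulr1.
rewrite le_eqVlt => /predU1P[<-|u0] e0.
  exists (D0 + 1); first by rewrite ltr_wpDl.
  move=> i j aj nij; rewrite mulr0 addr0.
  apply: Lnorm_le_of_bound => //.
  - by rewrite mulr_ge0 ?powR_ge0// addr_ge0.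
  - exact: measurable_block_abs.
  - exact: block_abs_ge0.
  move=> x; apply: (le_trans (bd i j x aj nij)); apply: ler_pM; rewrite ?powR_ge0//.
    by rewrite lerDl.
  apply: pow2_le; rewrite lerN2 ler_wpM2l// gerBl ltW//.
(* the norm is the power u of an integral, so the exponent e is shared out by u *)
pose e' := e / u; have e'0 : 0 < e' by rewrite divr_gt0.
pose r := (Num.truncn (u / e')).+1.
have hr : u <= e' * r%:R by rewrite mulrC -ler_pdivrMr//; apply: ltW; exact: truncnS_gt.
have [Dr Dr0 hDr] := block_abs_concentrated r.
pose G := 4 * (8 * D0 `^ u^-1 + Dr `^ u^-1) + 1.
have G0 : 0 < G by rewrite ltr_wpDl// mulr_ge0// addr_ge0 ?mulr_ge0 ?powR_ge0.
exists (G `^ u); first by rewrite powR_gt0.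
move=> i j aj nij; set E := 2 `^ (- (j%:R * intercept j)).
have E0 : 0 < E by exact: pow2_gt0.
have L0 : 0 < 2 ^- level j :> R by rewrite invr_gt0 exprn_gt0.
(* r is such that 2^(-j e' r / u) <= 2^(-j) <= 2^(- level j) *)
pose lam : R := 2 ^- level j * 2 `^ (j%:R * e').
have l0 : 0 < lam by rewrite mulr_gt0// pow2_gt0.
have M0 : 0 <= D0 * E by rewrite mulr_ge0// ltW.
have K0 : 0 <= Dr * E * (2 ^- level j) ^+ r.
  by rewrite !mulr_ge0 ?exprn_ge0 ?(ltW E0) ?(ltW L0).
have := Lnorm_concentrated_le u0 l0 (measurable_block_abs phi0 phi1 f i) (block_abs_ge0 phi0 phi1 f i) M0 K0
  (fun x => bd i j x aj nij) (fun x => hDr i j x aj nij).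
apply: Lnorm_ge0_le.
have -> : Dr * E * (2 ^- level j) ^+ r / lam ^+ r = Dr * E * 2 `^ (- (j%:R * e' * r%:R)).
  rewrite /lam exprMn invfM mulrA mulfK; last by rewrite expf_neq0// gt_eqF.
  by rewrite powRN [2 `^ (_ * r%:R)]powRrM powR_mulrn// powR_ge0.
have -> : G `^ u * 2 `^ (- (j%:R * (intercept j + slope j * u - e))) =
    (E `^ u^-1 * (G * 2 `^ (- (j%:R * (slope j - e'))))) `^ u.
  have -> : (E `^ u^-1 * (G * 2 `^ (- (j%:R * (slope j - e'))))) `^ u =
      (E `^ u^-1) `^ u * (G `^ u * (2 `^ (- (j%:R * (slope j - e')))) `^ u).
    by rewrite powRM ?powR_ge0 ?mulr_ge0 ?powR_ge0 ?(ltW G0)// powRM ?powR_ge0 ?(ltW G0).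
  rewrite -(powRrM E) mulVf ?gt_eqF// powRr1 ?(ltW E0)// -(powRrM 2) mulrCA /E -pow2D.
  by congr (_ * 2 `^ _); rewrite /e'; field; rewrite gt_eqF.
apply: ge0_ler_powR; rewrite ?nnegrE ?(ltW u0)//.
- by rewrite addr_ge0 ?mulr_ge0 ?powR_ge0 ?(ltW l0).
- by rewrite !mulr_ge0 ?powR_ge0 ?(ltW G0).
rewrite !powRM ?powR_ge0 ?mulr_ge0 ?(ltW E0)//.
set d0 := D0 `^ u^-1; set dr := Dr `^ u^-1; set E' := E `^ u^-1.
have -> : d0 * E' * (8 * lam) = E' * (8 * d0 * lam) by ring.
rewrite -[dr * E' * _]mulrA [dr * (E' * _)]mulrCA -mulrDr ler_wpM2l ?powR_ge0//.
have d00 : 0 <= d0 by exact: powR_ge0.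
have dr0 : 0 <= dr by exact: powR_ge0.
have lamle : lam <= 4 * 2 `^ (- (j%:R * (slope j - e'))).
  rewrite /lam (_ : - (j%:R * (slope j - e')) = - (slope j * j%:R) + j%:R * e'); last by ring.
  by rewrite pow2D mulrA ler_wpM2r ?powR_ge0// level_pow.
have tail : (2 `^ (- (j%:R * e' * r%:R))) `^ u^-1 <= lam.
  have -> : (2 `^ (- (j%:R * e' * r%:R))) `^ u^-1 = 2 `^ (- (j%:R * (e' * r%:R / u))).
    by rewrite -powRrM; congr (_ `^ _); ring.
  have j1 : 1 <= 2 `^ (j%:R * e') :> R.
    by rewrite -[leLHS](powRr0 2); apply: pow2_le; rewrite mulr_ge0// ltW.
  apply: (@le_trans _ _ (2 ^- level j)); last by rewrite /lam ler_peMr// ltW.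
  have -> : 2 ^- level j = 2 `^ (- (level j)%:R) :> R by rewrite powRN powR_mulrn.
  apply: pow2_le; rewrite lerN2.
  have hl : (level j)%:R <= j%:R :> R.
    by rewrite ler_nat; case: (level_bounds aj) => hL _ _; apply: leq_trans hL (leq_pred j).
  apply: (le_trans hl); rewrite ler_peMr//.
  by rewrite ler_pdivlMr// mul1r.
apply: (@le_trans _ _ ((8 * d0 + dr) * lam)).
  by rewrite [leRHS]mulrDl; apply: lerD => //; apply: ler_wpM2l.
apply: (le_trans (ler_wpM2l (addr_ge0 (mulr_ge0 (ler0n _ 8) d00) dr0) lamle)).
rewrite mulrA ler_wpM2r ?powR_ge0// /G -/d0 -/dr.
by rewrite [(_ + dr) * 4]mulrC lerDl.
Qed.

Lemma block_abs_adjacent i : (exists2 j, active j & adjacent i j) \/ block_abs phi0 phi1 f i =1 fun=> 0.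
Proof.
have [[j aj nij]|h] := pselect (exists2 j, active j & adjacent i j); [by left; exists j|right].
move=> x; rewrite /block_abs (_ : block_poly phi0 phi1 f i = 0) ?horner0 ?Normc.normc0//.
apply/polyP => k; rewrite coef_poly coef0; case: ifP => // _.
rewrite hf -rmorphM bumps_coef_far//= => j.
by apply/negP => /andP[aj nij]; apply: h; exists j.
Qed.

(** An active index next to i differs from i by at most one, which changes
    2^(-j s) by a bounded factor. *)
Lemma construct_decay u s e : 0 <= u -> 0 < e ->
  (forall j, active j -> s + e <= intercept j + slope j * u) -> block_decay phi0 phi1 f u s.
Proof.
move=> u0 e0 hs; have [C C0 hC] := construct_upper u0 e0.
exists (C * 2 `^ `|s|); first by rewrite mulr_gt0// pow2_gt0.
move=> i; have [[j aj nij]|h] := block_abs_adjacent i; last first.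
  apply: Lnorm_le_of_bound => //; [|exact: measurable_block_abs|exact: block_abs_ge0|].
    by rewrite !mulr_ge0 ?powR_ge0 ?(ltW C0).
  by move=> x; rewrite h !mulr_ge0 ?powR_ge0 ?(ltW C0).
apply: (le_trans (hC i j aj nij)); rewrite lee_fin -mulrA ler_wpM2l ?(ltW C0)//.
rewrite -pow2D; apply: pow2_le.
have h1 : j%:R * s <= j%:R * (intercept j + slope j * u - e).
  by rewrite ler_wpM2l// lerBrDr hs.
suff : (i%:R - j%:R) * s <= `|s| by rewrite mulrBl; lra.
apply: (le_trans (ler_norm _)); rewrite normrM ler_piMl//.
move: nij => /andP[]; rewrite -!(ler_nat R) -!natr1 => n1 n2.
by rewrite ler_norml; lra.
Qed.

Lemma amplitude_lower j : active j -> 2 `^ (- (j%:R * (intercept j + slope j) + 1)) <= amplitude j.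
Proof.
move=> aj; have [_ _ h] := level_bounds aj.
have E : 2 ^- level j = 2 `^ (- (level j)%:R) :> R by rewrite powRN powR_mulrn.
by rewrite /amplitude E -pow2D; apply: pow2_le; lra.
Qed.

Lemma pow2_unbounded (c K : R) : 0 < c -> exists N, forall j, (N <= j)%N -> K < 2 `^ (j%:R * c).
Proof.
move=> c0; pose n := (Num.truncn K).+1; exists (Num.truncn (n%:R / c)).+1 => j hj.
have hn : n%:R <= j%:R * c.
  rewrite -ler_pdivrMr//; apply: ltW; apply: lt_le_trans (truncnS_gt _) _.
  by rewrite ler_nat.
apply: lt_le_trans (pow2_le hn); rewrite powR_mulrn//.
apply: (lt_le_trans (truncnS_gt K)); rewrite -natrX ler_nat.
by apply: ltnW; exact: ltn_expl.
Qed.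

Section Line.
Variables (a b : R).
Hypothesis line_often : forall N, exists2 j, (N <= j)%N & [/\ active j, intercept j = a & slope j = b].

(** Faster decay at u, interpolated with the upper bound at 0 or 2, would beat the
    lower bound for the Fourier coefficient at 2^j in the exponent 1. *)
Lemma construct_no_decay u s : 0 <= u -> a + b * u < s -> ~ block_decay phi0 phi1 f u s.
Proof.
move=> u0 us [C C0 hC].
have [t [w [t0 t1 w0 tw]]] : exists t w, [/\ 0 < t, t <= 1, 0 <= w & t * u + (1 - t) * w = 1 :> R].
  have [u1|u1] := leP u 1.
    exists (2 - u)^-1, 2; have h : 1 <= 2 - u by lra.
    have h' : 0 < 2 - u by lra.
    split => //; [by rewrite invr_gt0|by rewrite invf_le1|by field; rewrite gt_eqF].
  exists u^-1, 0; have h : 0 < u by lra.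
  by split => //; [rewrite invr_gt0|rewrite invf_le1// ltW|rewrite mulr0 addr0 mulVf ?gt_eqF].
pose d := s - (a + b * u); have d0 : 0 < d by rewrite subr_gt0.
pose e := t * d / 2; have e0 : 0 < e by rewrite divr_gt0// mulr_gt0.
have [C2 C20 hC2] := construct_upper w0 e0.
have t1' : 0 <= 1 - t by rewrite subr_ge0.
pose K := 4 * (C `^ t * C2 `^ (1 - t)).
have [N hN] := pow2_unbounded K e0.
have [j Nj [aj aja bjb]] := line_often N.
have := hN j Nj; apply/negP; rewrite -leNgt.
have nj : adjacent j j by rewrite /adjacent !leqnSn.
have := lyapunov u0 w0 (introT andP (conj (ltW t0) t1)) (measurable_block_abs phi0 phi1 f j)
  (block_abs_ge0 phi0 phi1 f j) (mulr_gt0 C0 (pow2_gt0 _)) (mulr_gt0 C20 (pow2_gt0 _))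
  (hC j) (hC2 j j aj nj).
rewrite tw => /(coef_le_Lnorm1 (2 ^ j + 2 ^ j.+1)%N (mulr_ge0 (powR_ge0 _ _) (powR_ge0 _ _))).
move=> /(le_trans (coef_block_construct aj)) /(le_trans (amplitude_lower aj)).
rewrite aja bjb !powRM ?powR_ge0 ?(ltW C0) ?(ltW C20)// -!(powRrM 2).
set c := C `^ t; set c2 := C2 `^ (1 - t).
set X := - (_ * s) * t; set Y := _ * (1 - t) => h.
have {}h : 2 `^ (- (j%:R * (a + b) + 1)) <= 2 * (c * c2) * 2 `^ (X + Y).
  by apply: (le_trans h); rewrite pow2D le_eqVlt; apply/orP; left; apply/eqP; ring.
have hXY : X + Y <= - (j%:R * (a + b + e)).
  suff : a + b + e <= t * s + (1 - t) * (a + b * w - e).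
    move=> /(ler_wpM2l (ler0n R j)); rewrite /X /Y; lra.
  rewrite (_ : t * s = t * (a + b * u) + 2 * e); last by rewrite /e /d; field.
  have : b * (t * u + (1 - t) * w) = b by rewrite tw mulr1.
  have : 0 <= t * e by rewrite mulr_ge0 ?ltW.
  lra.
have cc : 0 <= 2 * (c * c2) by rewrite !mulr_ge0 ?powR_ge0.
have {}h := le_trans h (ler_wpM2l cc (pow2_le hXY)).
have : 2 `^ (j%:R * (a + b + e) + 1) * 2 `^ (- (j%:R * (a + b) + 1)) <=
   2 `^ (j%:R * (a + b + e) + 1) * (2 * (c * c2) * 2 `^ (- (j%:R * (a + b + e)))).
  by rewrite ler_wpM2l ?powR_ge0.
rewrite -pow2D (_ : _ + _ = j%:R * e); last by ring.
move=> /le_trans; apply; rewrite mulrCA -pow2D (_ : _ + 1 + _ = 1); last by ring.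
by rewrite powRr1// le_eqVlt; apply/orP; left; apply/eqP; rewrite /K -/c -/c2; ring.
Qed.

(** The coefficients at the frequencies 2^j, for the indices j that use the line,
    decay only like a fixed power. *)
Lemma construct_not_smooth : ~ is_smooth f.
Proof.
(* the coefficient at 2^j is at least 2^(- j (a + b) - 1), and m exceeds a + b + 1 *)
pose m := (Num.truncn (a + b + 1)).+1.
move=> /(@fourier_decay_of_smooth _ f m)[C hC].
have [N hN] := pow2_unbounded (2 * C) (ltr01 : 0 < 1 :> R).
have [j Nj [aj aja bjb]] := line_often N.
have := hN j Nj; apply/negP; rewrite -leNgt mulr1.
have := coef_block_construct aj.
pose k : int := (2 ^ j)%N.
have -> : (2 ^ j + 2 ^ j.+1)%N = absz (k + (2 ^ j.+1)%:Z) by rewrite /k -PoszD.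
rewrite coef_block_poly; last by rewrite /k absz_nat ltn_exp2l.
rewrite (_ : k%:~R = 2 ^+ j); last by rewrite /k -pmulrn natrX.
rewrite (dyadic_pow2 hphi) mul1r => /(le_trans (amplitude_lower aj)) h.
have := hC k; rewrite /k absz_nat natrX -exprM.
have p0 : 0 <= 2 ^+ (j * m) :> R by rewrite exprn_ge0.
move=> /(le_trans (ler_wpM2r p0 h)); rewrite aja bjb.
rewrite -powR_mulrn// -pow2D natrM => h2.
have h3 : j%:R - 1 <= - (j%:R * (a + b) + 1) + j%:R * m%:R.
  have : j%:R * (a + b + 1) <= j%:R * m%:R by rewrite ler_wpM2l// ltW// truncnS_gt.
  lra.
have := le_trans (pow2_le h3) h2; rewrite pow2D => h4.
rewrite -ler_pdivrMl//; apply: le_trans h4.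
by rewrite powRN powRr1// mulrC.
Qed.
End Line.
End Construction.

(** * Supporting lines of a concave function *)

Section SupportingLines.
Variables (R : realType) (g : R -> R).
Hypothesis hg : nondec_concave_1lipschitz g.

Lemma lipschitz_at u v : 0 <= u -> 0 <= v -> `|g u - g v| <= `|u - v|.
Proof.
case: hg => _ _ lip u0 v0; have := lip (u, v).
by rewrite /= !in_itv /= !andbT mul1r; apply.
Qed.

(** The slope is the supremum of the difference quotients to the right of v;
    concavity puts them below those to the left. *)
Lemma supporting_line v : 0 < v ->
  exists2 b, 0 <= b <= 1 & forall u, 0 <= u -> g u <= g v + b * (u - v).
Proof.
move=> v0; have v0' := ltW v0; case: (hg) => mono conc _.
pose S := [set (g w - g v) / (w - v) | w in [set w | v < w]].
have vw w : v < w -> 0 < w - v by rewrite subr_gt0.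
have S01 x : S x -> 0 <= x <= 1.
  move=> [w vwlt <-]; have w0 := lt_trans v0 vwlt.
  have d0 := vw w vwlt.
  have gvw : g v <= g w.
    by apply: mono; rewrite ?inE/= ?in_itv/= ?andbT ?v0' ?(ltW w0) ?(ltW vwlt).
  rewrite divr_ge0 ?subr_ge0 ?(ltW vwlt)//= ler_pdivrMr// mul1r.
  by have := lipschitz_at (ltW w0) v0'; rewrite !ger0_norm ?subr_ge0 // ltW.
have S1 : S ((g (v + 1) - g v) / (v + 1 - v)) by exists (v + 1) => //=; rewrite ltrDl.
have Sub : has_ubound S by exists 1 => x /S01/andP[].
have Sle x : S x -> x <= sup S by move=> Sx; apply: ub_le_sup.
exists (sup S).
  have /andP[h0 _] := S01 _ S1; rewrite (le_trans h0 (Sle _ S1))/=.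
  by apply: ge_sup; [exists ((g (v + 1) - g v) / (v + 1 - v))|move=> x /S01/andP[]].
move=> u u0; have [uv|vu|->] := ltgtP u v; last by rewrite subrr mulr0 addr0.
  have uv0 : 0 < v - u by rewrite subr_gt0.
  suff h : sup S <= (g v - g u) / (v - u).
    by move: h; rewrite ler_pdivlMr//; lra.
  apply: ge_sup; first by exists ((g (v + 1) - g v) / (v + 1 - v)).
  move=> _ [w vwlt <-]; have w0 := lt_trans v0 vwlt; have d0 := vw w vwlt.
  have wu : 0 < w - u by lra.
  pose t := (w - v) / (w - u).
  have t1 : 1 - t = (v - u) / (w - u) by rewrite /t; field; rewrite gt_eqF.
  have t01 : 0 <= t <= 1.
    by rewrite divr_ge0 ?(ltW d0) ?(ltW wu)//= -subr_ge0 t1 divr_ge0 ?(ltW uv0) ?(ltW wu).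
  have := conc t u w t01 u0 (ltW w0).
  have -> : t * u + (1 - t) * w = v by rewrite t1 /t; field; rewrite gt_eqF.
  rewrite t1 /t -(ler_pM2r wu) mulrDl ![_ / _ * g _]mulrAC !divfK ?gt_eqF// => h.
  rewrite ler_pdivrMr// mulrAC ler_pdivlMr//; lra.
have d0 := vw u vu.
have : (g u - g v) / (u - v) <= sup S by apply: Sle; exists u.
by rewrite ler_pdivrMr//; lra.
Qed.
End SupportingLines.

(** * Prescribing the critical smoothness *)

Lemma injective_unbounded (h : nat -> nat) : injective h -> forall N, exists c, (N <= h c)%N.
Proof.
move=> ih N; apply: contrapT => nh.
have lt c : (h c < N)%N by rewrite ltnNge; apply/negP => hc; apply: nh; exists c.
have := @leq_card 'I_N.+1 'I_N (fun c => Ordinal (lt c)).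
by rewrite !card_ord ltnn => H; have := H (fun x y e => val_inj (ih _ _ (congr1 val e))).
Qed.

(** The index j / 4 encodes a positive rational point and a dummy integer; the
    dummy makes every point, hence every line, occur infinitely often. *)
Lemma exists_critical_smoothness (R : realType) (phi0 phi1 : R -> R) (s : \bar R -> R) :
  is_dyadic_partition phi0 phi1 -> nondec_concave_1lipschitz (recip_arg s) ->
  exists f : periodic_gf R, ~ is_smooth f /\
    is_critical_smoothness_function phi0 phi1 f (fun p => (s p)%:E).
Proof.
move=> hphi hg; pose g := recip_arg s.
have /choice[B hB] : forall v, exists b, 0 < v ->
    0 <= b <= 1 /\ forall u, 0 <= u -> g u <= g v + b * (u - v).
  move=> v; have [v0|v0] := ltP 0 v; last by exists 0.
  by have [b b01 hb] := supporting_line hg v0; exists b.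
pose pt (n : nat) : R := if (unpickle n : option (nat * nat * nat)) is Some (a, b, _)
  then a.+1%:R / b.+1%:R else 1.
have pt0 n : 0 < pt n.
  by rewrite /pt; case: unpickle => [[[a b] c]|//]; rewrite divr_gt0.
pose slope (j : nat) := B (pt (j %/ 4)%N).
pose intercept (j : nat) := g (pt (j %/ 4)%N) - slope j * pt (j %/ 4)%N.
have slope01 j : 0 <= slope j <= 1 by case: (hB _ (pt0 (j %/ 4)%N)).
have line_ge j u : 0 <= u -> g u <= intercept j + slope j * u.
  by move=> u0; case: (hB _ (pt0 (j %/ 4)%N)) => _ /(_ u u0); rewrite /intercept -/(slope j); lra.
have intercept_ge j : g 0 <= intercept j by have := line_ge j 0 (lexx 0); rewrite mulr0 addr0.
have [n [C hC]] := bumps_coef_growth hphi slope intercept_ge.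
have [f hf] := periodic_gf_of_fourier hC.
have often a b N : let v := a.+1%:R / b.+1%:R in
  exists2 j, (N <= j)%N & [/\ active j, intercept j = g v - B v * v & slope j = B v].
  move=> v.
  have inj : injective (fun c : nat => pickle (a, b, c)).
    by move=> c c' /(pcan_inj (@pickleK _)) [].
  have [c hc] := injective_unbounded inj N.+1.
  (* the third component is free, hence arbitrarily large codes *)
  exists (pickle (a, b, c) * 4)%N; first by move: hc; set p := pickle _; lia.
  have e : pt (pickle (a, b, c) * 4 %/ 4)%N = v by rewrite mulnK// /pt pickleK.
  by split; rewrite ?/intercept ?/slope ?e// /active dvdn_mull// andbT muln_gt0 andbT (leq_ltn_trans _ hc).
exists f; split.
  exact: (construct_not_smooth hphi slope01 hf (often 0%N 0%N)).
apply: is_critical_smoothness_functionP => // u u0; rewrite -/(g u).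
have lo e : 0 < e -> block_decay phi0 phi1 f u (g u - e).
  move=> e0; apply: (construct_decay hphi slope01 hf u0 e0) => j aj.
  by rewrite subrK line_ge.
have hi x : block_decay phi0 phi1 f u x -> x <= g u.
  move=> hx; rewrite leNgt; apply/negP => gx.
  pose d := x - g u; have d0 : 0 < d by rewrite subr_gt0.
  (* a rational point within d / 2 to the right of u: at u its line exceeds g by less than d *)
  pose b := Num.truncn (2 / d); pose a := Num.truncn (u * b.+1%:R).
  pose v : R := a.+1%:R / b.+1%:R.
  have b0 : 0 < b.+1%:R :> R by [].
  have v0 : 0 < v by rewrite divr_gt0.
  have bd : b.+1%:R^-1 < d / 2.
    by rewrite invf_plt ?posrE ?divr_gt0// invf_div truncnS_gt.
  have /andP[a1 a2] := truncn_itv (mulr_ge0 u0 (ltW b0)).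
  have uv : u <= v by rewrite ler_pdivlMr// ltW.
  have vu : v <= u + b.+1%:R^-1.
    rewrite /v ler_pdivrMr// mulrDl mulVf ?gt_eqF// -[a.+1%:R]natr1 lerD2r; exact: a1.
  apply: (construct_no_decay hphi slope01 hf (often a b) u0 _ hx).
  have [/andP[B0 B1] _] := hB v v0.
  have := lipschitz_at hg (ltW v0) u0; rewrite [leRHS]ger0_norm ?subr_ge0// ler_norml => /andP[_ hl].
  have : B v * (u - v) <= 0 by rewrite mulr_ge0_le0// subr_le0.
  rewrite (_ : g v - B v * v + B v * u = B v * (u - v) + g v); last by ring.
  move=> hB0.
  apply: (@le_lt_trans _ _ (g u + b.+1%:R^-1)).
    by rewrite -[leRHS]add0r lerD// -lerBlDl (le_trans hl)// lerBlDl.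
  by rewrite -ltrBrDl (lt_trans bd)// ltr_pdivrMr// ltr_pMr// ltr1n.
rewrite ereal_sup_EFin.
- congr EFin; apply/eqP; rewrite eq_le; apply/andP; split.
    by apply: ge_sup => //; exists (g u - 1); exact: lo.
  apply/ler_addgt0Pr => e e0; rewrite -lerBlDr.
  by apply: ub_le_sup; [exists (g u) => x; exact: hi|exact: lo].
- by exists (g u) => x; exact: hi.
- by exists (g u - 1); exact: lo.
Qed.

Theorem theorem4p1 (R : realType) (phi0 phi1 : R -> R)
    (hphi : is_dyadic_partition phi0 phi1) :
  (forall f : periodic_gf R, ~ is_smooth f ->
     exists s : \bar R -> R,
       is_critical_smoothness_function phi0 phi1 f (fun p => (s p)%:E%E) /\
       nondec_concave_1lipschitz (recip_arg s))
  /\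
  (forall s : \bar R -> R, nondec_concave_1lipschitz (recip_arg s) ->
     exists f : periodic_gf R, ~ is_smooth f /\
       is_critical_smoothness_function phi0 phi1 f (fun p => (s p)%:E%E)).
Proof.
split=> [f|s]; first exact: (critical_smoothness_nonsmooth hphi).
exact: (exists_critical_smoothness hphi).
Qed.
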